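(* Let $\mathbf{P}=\mathbf{P}(a_0,a_1,a_2,a_3)\subset\mathbf{P}^{g+1}$ be a $3$-dimensional Gorenstein weighted projective space, considered in its anticanonical embedding. Then $\mathbf{P}$ is projectively normal, and its homogeneous coordinate ring $A=R/I_{\mathbf{P}}$, where $R=\mathbf{C}[X_0,\dots,X_{g+1}]$, has a minimal graded free resolution over $R$ of the form $$\cdots\longrightarrow R(-3)^{\beta_2}\longrightarrow R(-2)^{\beta_1}\longrightarrow R\longrightarrow A\longrightarrow 0$$ with $g$, $\beta_1$, $\beta_2$ as indicated in the following table: $$\begin{array}{|l|l|l|l|}\hline \text{weights}&g&\beta_1&\beta_2\\ \hline (1,1,1,3)&37&595&13056\\ (1,1,4,6)&37&595&13056\\ (1,2,2,5)&26&276&4025\\ (1,1,1,1)&33&465&8960\\ (1,1,2,4)&33&465&8960\\ (1,3,4,4)&19&136&1344\\ (1,1,2,2)&28&325&5175\\ (1,2,6,9)&28&325&5175\\ (2,3,3,4)&13&55&320\\ (1,4,5,10)&21&171&1920\\ (1,2,3,6)&25&253&3520\\ (1,3,8,12)&25&253&3520\\ (2,3,10,15)&16&91&715\\ (1,6,14,21)&22&190&2261\\ \hline \end{array}$$ In particular $\mathbf{P}\subset\mathbf{P}^{g+1}$ has the property $N_2$.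
   Context: We work over $\mathbf{C}$. A weighted projective space is Gorenstein if its canonical sheaf $\omega_{\mathbf{P}}=\mathcal{O}(-a_0-a_1-a_2-a_3)$ is invertible (weights well formed: any three of them are relatively prime). There are exactly 14 Gorenstein weighted projective $3$-spaces, namely those with the weights in the table. The genus $g$ is defined by $2g-2=-K_{\mathbf{P}}^3$, and the anticanonical embedding $\mathbf{P}\subset\mathbf{P}^{g+1}$ is the one given by the complete linear system $|-K_{\mathbf{P}}|$. $I_{\mathbf{P}}$ denotes the saturated homogeneous ideal of $\mathbf{P}$ in $\mathbf{P}^{g+1}$. Property $N_2$: a non-degenerate projectively normal scheme $X\subset\mathbf{P}^r$ of pure dimension $\ge1$ has the property $N_2$ if its homogeneous coordinate ring $A=R/I_X$, $R=\mathbf{C}[X_0,\dots,X_r]$, has a minimal graded presentation over $R$ of the form $R(-3)^a\to R(-2)^b\to R\to A\to0$. *)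

(* Defs.v *)
From HB Require Import structures.
From mathcomp Require Import all_boot all_order all_algebra.
From mathcomp Require Import mxpoly fraction ring_quotient mpoly.

Set Implicit Arguments.
Unset Strict Implicit.
Unset Printing Implicit Defensive.

Import GRing.Theory.
Local Open Scope ring_scope.

(* Proj of S = F[x_0, ..., x_(n-1)] with deg x_i = w i.  As S is a domain, the *)
(* sheaf O(m) associated with S(m) is realised inside the constant sheaf       *)
(* Frac(S): its stalk at p is the set of f / g with f, g homogeneous, g not    *)
(* in p and deg f - deg g = m, and its sections over an open set are the       *)
(* fractions belonging to all stalks at points of that open set.               *)
Section Proj.

Variables (F : fieldType) (n : nat) (w : 'I_n -> nat).

Local Notation S := {mpoly F[n]}.
Local Notation K := {fraction {mpoly F[n]}}.

Definition wdeg (m : 'X_{1..n}) : nat := (\sum_i w i * m i)%N.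

Definition whomog (k : nat) (f : S) : bool :=
  all (fun m => wdeg m == k) (msupp f).

Definition wcomp (k : nat) (f : S) : S :=
  \sum_(m <- msupp f | wdeg m == k) f@_m *: 'X_[m].

(* homogeneous primes that do not contain the irrelevant ideal                 *)
Definition proj_point (p : {pred S}) : Prop :=
  [/\ idealr_closed p, prime_idealr_closed p,
      forall k, {in p, forall f, wcomp k f \in p}
    & exists i, 'X_i \notin p].

Definition twist_stalk (m : int) (p : {pred S}) (z : K) : Prop :=
  exists (f g : S) (i j : nat),
    [/\ whomog i f, whomog j g, g \notin p, i%:Z - j%:Z = m
      & z = tofrac f / tofrac g].

(* O(m) is locally free of rank one: every point has a neighbourhood D_+(h)    *)
(* with a section e such that u |-> u * e is an isomorphism from the structure *)
(* sheaf onto O(m) (injectivity is automatic in Frac(S) since e != 0).         *)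
Definition twist_invertible (m : int) : Prop :=
  forall p, proj_point p ->
  exists (h : S) (k : nat) (e : K),
    [/\ whomog k h, h \notin p, e != 0
      & forall q, proj_point q -> h \notin q ->
        forall z, twist_stalk m q z <->
                  exists2 u, twist_stalk 0 q u & z = u * e].

(* H^0(O(m))                                                                   *)
Definition global_section (m : int) (z : K) : Prop :=
  forall p, proj_point p -> twist_stalk m p z.

Definition const_frac (c : F) : K := tofrac (c%:MP_[n]).

Definition section_basis (m : int) (N : nat) (s : 'I_N -> K) : Prop :=
  (forall i, global_section m (s i)) /\
  (forall z, global_section m z ->
     exists! c : 'rV[F]_N, z = \sum_i const_frac (c 0 i) * s i).

(* h^0(O(m)) = N                                                               *)
Definition h0 (m : int) (N : nat) : Prop :=
  exists s : 'I_N -> K, section_basis m s.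

(* The self-intersection number L^r for the ample L = O(d) on the              *)
(* r-dimensional Proj S, r = n - 1, is r! times the coefficient of k^r in the  *)
(* polynomial that computes h^0(L^k) = chi(L^k) for k large.                   *)
Definition twist_top_power (d : nat) (D : rat) : Prop :=
  exists P : {poly rat},
    [/\ (size P <= n)%N, D = P`_n.-1 *+ (n.-1)`!
      & exists k0 : nat, forall k, (k0 <= k)%N ->
        exists2 N : nat, h0 (k * d)%N%:Z N & P.[k%:R] = N%:R].

(* chains of specialisations of length l starting at p                         *)
Definition prime_chain (p : {pred S}) (l : nat) : Prop :=
  exists q : nat -> {pred S},
    [/\ q 0%N =i p, forall i, (i <= l)%N -> proj_point (q i)
      & forall i, (i < l)%N ->
          {subset q i <= q i.+1} /\ ~ {subset q i.+1 <= q i}].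

(* the irreducible components of the closed subscheme defined by I             *)
Definition component (I p : {pred S}) : Prop :=
  [/\ proj_point p, {subset I <= p}
    & forall q, proj_point q -> {subset I <= q} -> {subset q <= p} ->
      {subset p <= q}].

Definition pure_dim_ge1 (I : {pred S}) : Prop :=
  (forall p, component I p -> prime_chain p 1) /\
  (forall p q l, component I p -> component I q ->
     prime_chain p l -> prime_chain q l).

End Proj.

(* Graded free modules over R = F[X_0, ..., X_(n-1)] are given by the list of  *)
(* their shifts: e : 'I_q -> nat stands for the sum of the R(- e j), with row  *)
(* vectors as elements; an 'M_(p, q) matrix acts by v |-> v *m M.              *)
Section Resolutions.

Variables (F : fieldType) (n : nat).

Local Notation R := {mpoly F[n]}.

Definition graded_map p q (e : 'I_p -> nat) (f : 'I_q -> nat)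
    (M : 'M[R]_(p, q)) : Prop :=
  forall i j, if (f j <= e i)%N then M i j \is (e i - f j)%N.-homog
              else M i j == 0.

(* v has all its entries in the irrelevant maximal ideal (X_0, ..., X_(n-1))   *)
Definition in_irrelevant p q (M : 'M[R]_(p, q)) : Prop :=
  forall i j, (M i j)@_0%MM = 0.

Definition exact_at p q r (M : 'M[R]_(p, q)) (N : 'M[R]_(q, r)) : Prop :=
  forall v : 'rV[R]_q, v *m N = 0 <-> exists u : 'rV[R]_p, v = u *m M.

(* The augmentation F_0 -> R / I is induced by v |-> v *m aug.                 *)
Record free_complex := FreeComplex {
  frank : nat -> nat;
  shift : forall i, 'I_(frank i) -> nat;
  aug : 'cV[R]_(frank 0);
  diff : forall i, 'M[R]_(frank i.+1, frank i)
}.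

Definition minimal_resolution (I : {pred R}) (C : free_complex) : Prop :=
  [/\ graded_map (@shift C 0) (fun _ : 'I_1 => 0%N) (aug C)
      /\ (forall i, graded_map (@shift C i.+1) (@shift C i) (diff C i)),
      forall f : R, exists v : 'rV[R]_(frank C 0), (v *m aug C) 0 0 - f \in I,
      forall v : 'rV[R]_(frank C 0), (v *m aug C) 0 0 \in I <->
        exists u : 'rV[R]_(frank C 1), v = u *m diff C 0,
      forall i, exact_at (diff C i.+1) (diff C i)
    & forall i, in_irrelevant (diff C i)].

(* ... -> R(-3)^b2 -> R(-2)^b1 -> R                                            *)
Definition resolution_starts (b1 b2 : nat) (C : free_complex) : Prop :=
  [/\ frank C 0 = 1%N /\ (forall j, @shift C 0 j = 0%N),
      frank C 1 = b1 /\ (forall j, @shift C 1 j = 2%N)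
    & frank C 2 = b2 /\ (forall j, @shift C 2 j = 3%N)].

(* Minimal graded presentation R(-3)^a -> R(-2)^b -> R -> R/I -> 0, where      *)
(* minimality means that each map has its kernel in (X_0, ..., X_(n-1)) times  *)
(* its source.                                                                 *)
Definition N2_presentation (I : {pred R}) : Prop :=
  exists (a b : nat) (M : 'M[R]_(a, b)) (Q : 'cV[R]_b),
    [/\ graded_map (fun _ => 3%N) (fun _ => 2%N) M
        /\ graded_map (fun _ => 2%N) (fun _ => 0%N) Q,
        forall f : R, f \in I <-> exists v : 'rV[R]_b, f = (v *m Q) 0 0,
        exact_at M Q,
        forall v : 'rV[R]_b, v *m Q = 0 -> in_irrelevant v
      & forall v : 'rV[R]_a, v *m M = 0 -> in_irrelevant v].

End Resolutions.

(* The map X = Proj S -> P^(N-1) given by sections s_0, ..., s_(N-1) of O(d).  *)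
Section Embedding.

Variables (F : fieldType) (n : nat) (w : 'I_n -> nat) (d N : nat).
Variable s : 'I_N -> {fraction {mpoly F[n]}}.

Local Notation R := {mpoly F[N]}.

Definition eval_at (f : R) : {fraction {mpoly F[n]}} :=
  mmap (@const_frac F n) s f.

(* The saturated ideal of the image: the kernel of R -> \bigoplus_k H^0(O(kd)).*)
(* All s_i having degree d, this kernel is homogeneous and is also the kernel  *)
(* of the evaluation in Frac(S).  Hence R / I is the domain eval_at(R).        *)
Definition coord_ideal : {pred R} := [pred f | eval_at f == 0].

(* The homogeneous coordinate ring eval_at(R) is integrally closed in its      *)
(* field of fractions, and R_k -> H^0(O(kd)) is onto for all k (for the normal *)
(* X, the two usual definitions of projective normality; the second one also   *)
(* makes the map a closed embedding when O(d) is ample).                       *)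
Definition projectively_normal : Prop :=
  (forall f g : R, eval_at g != 0 ->
     integralOver eval_at (eval_at f / eval_at g) ->
     exists h : R, eval_at f / eval_at g = eval_at h) /\
  (forall (k : nat) z, global_section w (k * d)%N%:Z z ->
     exists2 f : R, f \is k.-homog & eval_at f = z).

Definition nondegenerate : Prop :=
  forall f : R, f \is 1.-homog -> f \in coord_ideal -> f = 0.

Definition property_N2 : Prop :=
  [/\ nondegenerate, projectively_normal,
      pure_dim_ge1 (fun _ : 'I_N => 1%N) coord_ideal
    & N2_presentation coord_ideal].

End Embedding.

Section WeightedProjectiveSpace.

Variables (F : fieldType) (a : 4.-tuple nat).

Definition well_formed : Prop :=
  (forall i, 0 < tnth a i)%N /\
  (forall i, \big[gcdn/0]_(j | j != i) tnth a j = 1)%N.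

(* -K = O(anticanonical_twist)                                                 *)
Definition anticanonical_twist : nat := (\sum_i tnth a i)%N.

Definition gorenstein : Prop :=
  twist_invertible F (tnth a) (- anticanonical_twist%:Z).

(* 2 g - 2 = (-K)^3                                                            *)
Definition has_genus (g : nat) : Prop :=
  twist_top_power F (tnth a) anticanonical_twist (2 * g%:R - 2).

End WeightedProjectiveSpace.

(* rows (weights, g, beta_1, beta_2)                                           *)
Definition gorenstein_table : seq (seq nat * nat * nat * nat) := [::
  ([:: 1; 1; 1; 3],   37, 595, 13056);
  ([:: 1; 1; 4; 6],   37, 595, 13056);
  ([:: 1; 2; 2; 5],   26, 276, 4025);
  ([:: 1; 1; 1; 1],   33, 465, 8960);
  ([:: 1; 1; 2; 4],   33, 465, 8960);
  ([:: 1; 3; 4; 4],   19, 136, 1344);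
  ([:: 1; 1; 2; 2],   28, 325, 5175);
  ([:: 1; 2; 6; 9],   28, 325, 5175);
  ([:: 2; 3; 3; 4],   13, 55,  320);
  ([:: 1; 4; 5; 10],  21, 171, 1920);
  ([:: 1; 2; 3; 6],   25, 253, 3520);
  ([:: 1; 3; 8; 12],  25, 253, 3520);
  ([:: 2; 3; 10; 15], 16, 91,  715);
  ([:: 1; 6; 14; 21], 22, 190, 2261)]%N.

(* Main.v *)
Require Import Defs.
From HB Require Import structures.
From mathcomp Require Import all_boot all_order all_algebra.
From mathcomp Require Import mxpoly fraction complex reals mpoly.
From mathcomp Require Import fingroup perm ring zify.
From mathcomp Require boolp.

(** At the vertex where only x_i is non-zero, invertibility of the canonical
    sheaf forces w_i to divide d = w_0 + w_1 + w_2 + w_3.  With b_i = d / w_i the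
    b_i satisfy 1 = 1/b_0 + 1/b_1 + 1/b_2 + 1/b_3, which leaves the 14 rows.

    Let S = C[x_0, ..., x_3] be the graded Cox ring, A the subring of S of the
    degrees divisible by d, and L the space of its elements of degree d.  Euler's
    formula contracts the Koszul complex of R = Sym L.  Hence the homogeneous
    ideal I of A in R is generated by quadrics whose syzygies are generated by
    linear ones as soon as Koszul 1- and 2-cycles over A with coefficients of
    degree at least 2 lift to Koszul cycles over R: a form f of I of degree at
    least 3 is a sum of X_i v_i, and lifting the 1-cycle given by the images of
    the v_i corrects the v_i into elements of I; the 2-cycles do the same for
    syzygies.  The y_i = x_i^(b_i) form a regular sequence of elements of L, so
    that liftability descends from the artinian quotient A / (y), of Hilbert
    function 1, N, N, 1 with N = g - 2, where it becomes a finite verification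
    on monomials.  The Betti numbers follow by counting monomials, and the
    resolution is continued by Hilbert's basis theorem. *)

Set Implicit Arguments.
Unset Strict Implicit.
Unset Printing Implicit Defensive.

Import Order.TTheory GRing.Theory Num.Theory.
Local Open Scope ring_scope.

(** * Homogeneous components and monomial ideals *)

(** Koszul cycles over R are boundaries, so a cycle over A that lifts to a cycle over R vanishes in
    Koszul homology, that is in Tor^R(A, C). Liftability of 1- and 2-cycles is thus the vanishing of
    Tor_1 and Tor_2 off the linear strand; coefficients of degree 1 are left out because they carry
    the quadrics and the linear syzygies themselves. The obstacle is in the artinian quotient. Its
    top degree is spanned by sigma, the product of the x_i^(b_i - 1), of degree 4d - d = 3d. A chain
    x^mu e_u /\ e_v with mu of degree 2d may have sigma in its boundary, and then it is no cycle and
    cannot lift by itself. For each e_j one special chain is fixed whose boundary has -sigma e_j as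
    its only term in sigma; subtracting special chains removes sigma from every boundary, and they
    cancel in the sum over a cycle. Lifting thereby becomes a question about single monomials,
    generated by Koszul relations on three monomials of degree d, which a search of bounded depth
    settles. No second search is made for 1-cycles: modulo y_0 the wedge of e_(y_0) with a 1-cycle
    is a 2-cycle. *)

Section WeightedDegree.
Variables (n : nat) (w : 'I_n -> nat).

Lemma wdeg0 : wdeg w 0%MM = 0%N.
Proof. by rewrite /wdeg big1 // => i _; rewrite mnm0E muln0. Qed.

Lemma wdegD : {morph wdeg w : m1 m2 / (m1 + m2)%MM >-> (m1 + m2)%N}.
Proof.
by move=> m1 m2; rewrite /wdeg -big_split; apply: eq_bigr => i _; rewrite mnmDE mulnDr.
Qed.

HB.instance Definition _ := isMeasure.Build n (wdeg w) wdeg0 wdegD.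

Lemma whomogE (F : fieldType) k (f : {mpoly F[n]}) :
  whomog w k f = (f \is k.-homog for (wdeg w)).
Proof. by []. Qed.

Lemma wcompE (F : fieldType) k (f : {mpoly F[n]}) :
  wcomp w k f = pihomog (wdeg w) k f.
Proof. by []. Qed.

End WeightedDegree.

Section Homogeneous.
Variables (F : fieldType) (n : nat) (mf : measure n).
Local Notation S := {mpoly F[n]}.
Implicit Types p q f g u : S.

Lemma mcoeff_pihomog d p m :
  (pihomog mf d p)@_m = if mf m == d then p@_m else 0.
Proof.
case: ifP => [md|/negbT md]; last exact: (dhomog_nemf_coeff (pihomogP mf d p)).
(* The range is enlarged so that [d] is one of its indices. *)
have -> : p@_m = \sum_(i < maxn (mmeasure mf p) d.+1) (pihomog mf i p)@_m.
  by rewrite -raddf_sum -pihomog_partitionE ?leq_maxl.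
rewrite (bigD1 (Ordinal (leq_maxr (mmeasure mf p) d.+1))) //= big1 ?addr0 // => i.
rewrite -val_eqE /= => ne; apply: (dhomog_nemf_coeff (pihomogP mf i p)).
by rewrite (eqP md) eq_sym.
Qed.

Lemma pihomogMl e d p q : p \is e.-homog for mf ->
  pihomog mf d (p * q) = if (e <= d)%N then p * pihomog mf (d - e) q else 0.
Proof.
move=> hp; rewrite [in LHS](pihomog_partitionE (leqnn (mmeasure mf q))).
rewrite mulr_sumr raddf_sum /=.
have H c : pihomog mf d (p * pihomog mf c q)
    = if (c + e == d)%N then p * pihomog mf c q else 0.
  have hc := dhomogM hp (pihomogP mf c q).
  rewrite addnC; case: (altP (_ =P d)) => [<-|ne]; first exact: pihomog_dE.
  by rewrite (pihomog_ne0 _ hc).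
rewrite (eq_bigr _ (fun (c : 'I__) _ => H c)) -big_mkcond /=.
case: leqP => le_ed; last first.
  rewrite big_pred0 // => c; apply: contraTF le_ed => /eqP <-.
  by rewrite -leqNgt leq_addl.
case: (ltnP (d - e) (mmeasure mf q)) => [lt|ge].
  rewrite (big_pred1 (Ordinal lt)) // => c.
  by rewrite /= -[RHS]val_eqE /= -(eqn_add2r e c) subnK.
rewrite big_pred0; last first.
  move=> c; apply/negbTE/eqP => E; move: (ltn_ord c); rewrite ltnNge.
  by rewrite -(addnK e c) E ge.
suff -> : pihomog mf (d - e) q = 0 by rewrite mulr0.
rewrite pihomogE big_seq_cond big_pred0 // => m; apply/negbTE/negP => /andP[ms /eqP E].
by move: (mmeasure_mnm_lt mf ms); rewrite E ltnNge ge.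
Qed.

Lemma pihomogMr e d p q : q \is e.-homog for mf ->
  pihomog mf d (p * q) = if (e <= d)%N then pihomog mf (d - e) p * q else 0.
Proof. by move=> hq; rewrite mulrC (pihomogMl _ _ hq) mulrC. Qed.

Lemma dhomog_divr i j u g : u * g \is i.-homog for mf ->
  g \is j.-homog for mf -> g != 0 -> u != 0 ->
  (j <= i)%N /\ u \is (i - j).-homog for mf.
Proof.
move=> hug hg g0 u0.
have E : u * g = pihomog mf i (u * g) by rewrite pihomog_dE.
rewrite (pihomogMr _ _ hg) in E; case: leqP E => [le E|_ /eqP]; last first.
  by rewrite mulf_eq0 (negbTE g0) (negbTE u0).
split=> //; move/(mulIf g0): E ->; exact: pihomogP.
Qed.

End Homogeneous.

Section DivMonomial.
Variables (F : fieldType) (n : nat).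
Local Notation S := {mpoly F[n]}.
Implicit Types (f g : S) (m : 'X_{1..n}).

(** A total, linear left inverse of multiplication by ['X_[m0]]: the terms that [m0] does not divide
    are dropped. *)
Definition divX m0 f : S :=
  \sum_(m <- msupp f | (m0 <= m)%MM) f@_m *: 'X_[m - m0].

Lemma mcoeff_divX m0 f m : (divX m0 f)@_m = f@_(m + m0).
Proof.
rewrite raddf_sum /=.
under eq_bigr => m' _ do rewrite mcoeffZ mcoeffX.
have E m' : (m0 <= m')%MM -> ((m' - m0)%MM == m) = (m' == (m + m0)%MM).
  by move=> le; apply/eqP/eqP => [<-|->]; [rewrite submK | rewrite addmK].
under eq_bigr => m' le do rewrite (E _ le).
case: (boolP ((m + m0)%MM \in msupp f)) => [ms|/memN_msupp_eq0 z].
  rewrite big_mkcond (bigD1_seq _ ms (msupp_uniq f)) /= lem_addl eqxx mulr1.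
  by rewrite big1 ?addr0 // => m' /negbTE ->; rewrite mulr0 if_same.
rewrite z big1 // => m' _; case: eqP => [->|]; by rewrite ?z ?mul0r ?mulr0.
Qed.

Lemma mcoeffXM m0 f m :
  ('X_[m0] * f)@_m = if (m0 <= m)%MM then f@_(m - m0) else 0.
Proof.
case: ifP => [le|/negP nle].
  by rewrite -{1}(submK le) mulrC addmC mcoeffMX.
apply/eqP/negPn/negP => h; apply: nle; move: h; rewrite -mcoeff_msupp => /msuppM_le /allpairsP[[a b] /= [ha _ ->]].
by move: ha; rewrite msuppX inE => /eqP ->; rewrite lem_addr.
Qed.

Lemma divX_homog (mf : measure n) e k m0 f : mf m0 = e ->
  f \is (k + e).-homog for mf -> divX m0 f \is k.-homog for mf.
Proof.
move=> me hf; apply/dhomogP => m; rewrite mcoeff_msupp mcoeff_divX -mcoeff_msupp.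
by move/(dhomog_mf hf)/eqP; rewrite mfD me eqn_add2r => /eqP.
Qed.

End DivMonomial.

Section MonomialIdeal.
Variables (F : fieldType) (n : nat) (b : 'I_n -> nat).
Local Notation S := {mpoly F[n]}.
Implicit Types (f g : S) (m : 'X_{1..n}).

(** The standard monomials modulo y_0, ..., y_(j-1). The descent runs from the artinian case, where
    all variables are bounded, down to [j = 0], where there is no condition. *)
Definition box j m := [forall i : 'I_n, (i < j)%N ==> (m i < b i)%N].

Lemma boxP j m :
  reflect (forall i : 'I_n, (i < j)%N -> (m i < b i)%N) (box j m).
Proof. exact: 'forall_implyP. Qed.

Lemma box_le j m m' : (m <= m')%MM -> box j m' -> box j m.
Proof.
move=> /mnm_lepP le /boxP h; apply/boxP => i /h; exact: leq_ltn_trans (le i).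
Qed.

(* The ideal generated by the powers [x_i ^ b_i] with [i < j]. *)
Definition inJ j f := forall m, box j m -> f@_m = 0.

Lemma inJ0 j : inJ j 0.
Proof. by move=> m _; rewrite mcoeff0. Qed.

Lemma inJD j f g : inJ j f -> inJ j g -> inJ j (f + g).
Proof. by move=> hf hg m bm; rewrite mcoeffD hf ?hg ?addr0. Qed.

Lemma inJN j f : inJ j f -> inJ j (- f).
Proof. by move=> hf m bm; rewrite mcoeffN hf ?oppr0. Qed.

Lemma inJB j f g : inJ j f -> inJ j g -> inJ j (f - g).
Proof. by move=> hf hg; apply/inJD/inJN. Qed.

Lemma inJM j g f : inJ j f -> inJ j (g * f).
Proof.
move=> hf m bm; rewrite mcoeffM big1 // => -[m1 m2] /= /eqP e.
rewrite [f@_ _]hf ?mulr0 //; apply: box_le bm.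
by have := lem_addl (bmnm m1) (bmnm m2); rewrite -e.
Qed.

Lemma inJ_sum j (I : Type) (r : seq I) (P : pred I) (G : I -> S) :
  (forall i, P i -> inJ j (G i)) -> inJ j (\sum_(i <- r | P i) G i).
Proof. by move=> h; apply: big_ind => //; [exact: inJ0 | exact: inJD]. Qed.

Lemma inJ_zero f : inJ 0 f -> f = 0.
Proof. by move=> h; apply/mpolyP => m; rewrite mcoeff0 h //; apply/boxP. Qed.

Lemma inJS j f : inJ j f -> inJ j.+1 f.
Proof.
by move=> h m /boxP bm; apply: h; apply/boxP => i ij; apply/bm/ltnW.
Qed.

Lemma inJX j m g : ~~ box j m -> inJ j ('X_[m] * g).
Proof.
move=> nb m' bm'; rewrite mcoeffXM; case: ifP => // le.
by rewrite (box_le le bm') in nb.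
Qed.

Definition vpow (i : 'I_n) : 'X_{1..n} := (U_(i) *+ b i)%MM.

Lemma vpowE (i k : 'I_n) : vpow i k = if i == k then b i else 0%N.
Proof. by rewrite mulmnE mnm1E; case: eqP => _; rewrite ?mul1n ?mul0n. Qed.

Lemma vpow_le (i : 'I_n) m : (vpow i <= m)%MM = (b i <= m i)%N.
Proof.
apply/mnm_lepP/idP => [/(_ i)|h k]; first by rewrite vpowE eqxx.
by rewrite vpowE; case: eqP => // <-.
Qed.

Lemma vpowNbox (i : 'I_n) j : (i < j)%N -> ~~ box j (vpow i).
Proof. by move=> ij; apply/boxP => /(_ i ij); rewrite vpowE eqxx ltnn. Qed.

(* x_i ^ b_i is a non-zero divisor modulo the powers of the earlier variables. *)
Lemma inJ_cancel (i : 'I_n) g : inJ i ('X_[vpow i] * g) -> inJ i g.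
Proof.
move=> h m bm; have := h (m + vpow i)%MM.
rewrite mcoeffXM lem_addl addmK => -> //; apply/boxP => k ki.
rewrite mnmDE vpowE; case: eqP => [e|_]; first by rewrite e ltnn in ki.
by rewrite addn0; move/boxP: bm; apply.
Qed.

(** A monomial of [box i] is either divisible by y_i, and then the subtraction removes its
    coefficient, or it lies in [box i.+1], where [f] has no coefficient. *)
Lemma inJ_divX (i : 'I_n) f :
  inJ i.+1 f -> inJ i (f - 'X_[vpow i] * divX (vpow i) f).
Proof.
move=> h m bm; rewrite mcoeffB mcoeffXM mcoeff_divX; case: ifP => [le|].
  by rewrite submK // subrr.
rewrite vpow_le subr0 => /negbT; rewrite -ltnNge => lt; apply: h; apply/boxP => k.
rewrite ltnS leq_eqVlt => /orP[/eqP /val_inj -> //|]; exact/boxP.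
Qed.

End MonomialIdeal.

(** * Lifting Koszul cycles *)

(** The Koszul differential squares to zero on u /\ v /\ w. *)
Lemma koszul_cycle (K : comPzRingType) (V : lmodType K) (a b c : K) (u v w : V) :
  c *: (b *: u - a *: v) + a *: (c *: v - b *: w) + b *: (a *: w - c *: u) = 0.
Proof.
rewrite !scalerBr !scalerA [a * c]mulrC [b * a]mulrC [b * c]mulrC.
by rewrite !addrA !subrK subrr.
Qed.

(** This identity and the next one are the bookkeeping by which the correction terms [kappa] of a
    three-term Koszul relation cancel in [good_lifts]. *)
Lemma zmod_cancel (V : zmodType) (a b c x y : V) :
  a + b + c - ((b - x) + (c - y)) = a - (- (x + y)).
Proof.
apply/eqP; rewrite subr_eq opprK [X in _ == _ + X]addrACA -opprD.
by rewrite [X in _ == X]addrACA subrr addr0 addrA.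
Qed.

Lemma zmod_rotate (V : zmodType) (x y z : V) : - ((z - x) + (y - z)) = x - y.
Proof. by rewrite addrC addrA subrK opprB. Qed.

Lemma mx11_tr (T : Type) (A : 'M[T]_1) : A^T = A.
Proof. by apply/matrixP => i j; rewrite mxE !ord1. Qed.

Section Koszul.
Variables (F : fieldType) (n r N d : nat).
Hypothesis two_neq0 : 2%:R != 0 :> F.
Variables (mf : measure n.+1) (b : 'I_n.+1 -> nat).
Local Notation S := {mpoly F[n.+1]}.
Local Notation R := {mpoly F[r]}.
Variable ev : {rmorphism R -> S}.
Hypothesis evC : forall c, ev c%:MP = c%:MP.
Variables (m : 'I_N -> 'X_{1..n.+1}) (l : 'I_N -> R).
Hypothesis ev_l : forall k, ev (l k) = 'X_[m k].
Hypothesis mf_m : forall k, mf (m k) = d.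
Variable y : 'I_n.+1 -> 'I_N.
Hypothesis m_y : forall i, m (y i) = vpow b i.
(** The combinatorial form of the generation of A by its elements of degree [d]. *)
Hypothesis m_div : forall (q : nat) (mu : 'X_{1..n.+1}),
  mf mu = (q.+1 * d)%N -> exists k, (m k <= mu)%MM.
Hypothesis mf_eq0 : forall mu, mf mu = 0%N -> mu = 0%MM.

Let L : 'cV[R]_N := \col_k l k.
Let X : 'cV[S]_N := \col_k 'X_[m k].
Let ed k : 'cV[S]_N := delta_mx k 0.
Let eR k : 'cV[R]_N := delta_mx k 0.

Lemma ev_L : map_mx ev L = X.
Proof. by apply/matrixP => i j; rewrite !mxE ev_l. Qed.

Lemma ev_eR k : map_mx ev (eR k) = ed k.
Proof. by rewrite /eR map_delta_mx. Qed.

Lemma eR_L k : (eR k)^T *m L = (l k)%:M.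
Proof. by rewrite /eR trmx_delta -rowE; apply/matrixP => i j; rewrite !mxE !ord1. Qed.

Lemma ed_X k : (ed k)^T *m X = 'X_[m k]%:M.
Proof. by rewrite /ed trmx_delta -rowE; apply/matrixP => i j; rewrite !mxE !ord1. Qed.

Lemma addrr_eq0 n' (p : {mpoly F[n']}) : p + p = 0 -> p = 0.
Proof.
move/eqP; rewrite -mulr2n -scaler_nat -mul_mpolyC mulf_eq0 mpolyC_eq0.
by rewrite (negbTE two_neq0) => /eqP.
Qed.

(** The 1 x 1 matrix equals its transpose, which is its opposite, and 2 is invertible. Applied to a
    vector of coordinates, this says that a Koszul boundary of a 2-chain is a 1-cycle. *)
Lemma antisym_form n' p (A : 'M[{mpoly F[n']}]_p) (u : 'cV_p) :
  A^T = - A -> u^T *m A *m u = 0.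
Proof.
move=> hA; have := mx11_tr (u^T *m A *m u).
rewrite !trmx_mul trmxK hA mulNmx mulmxN -mulmxA => /eqP.
rewrite eq_sym -addr_eq0 => /eqP/matrixP h.
by apply/matrixP => i j; have := h i j; rewrite !mxE; exact: addrr_eq0.
Qed.

Lemma ev_onto k f : f \is (k * d).-homog for mf -> exists g, ev g = f.
Proof.
move=> hf; rewrite (mpolyE f) big_seq.
apply: (big_ind (fun f => exists g, ev g = f)) => [|_ _ [g1 <-] [g2 <-]|mu /(dhomog_mf hf) hmu].
- by exists 0; rewrite rmorph0.
- by exists (g1 + g2); rewrite rmorphD.
suff [g hg] : exists g, ev g = 'X_[mu].
  by exists ((f@_mu)%:MP * g); rewrite rmorphM /= evC hg mul_mpolyC.
elim: k mu hmu {hf} => [|k IH] mu hmu.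
  by exists 1; rewrite rmorph1 (mf_eq0 hmu) mpolyX0.
have [i hi] := m_div hmu.
have [|g hg] := IH (mu - m i)%MM.
  by apply/eqP; rewrite -(eqn_add2r d) -{1}(mf_m i) -mfD submK // hmu mulSn addnC.
by exists (g * l i); rewrite rmorphM /= hg ev_l -mpolyXD submK.
Qed.

Lemma ev_onto_mx p q (c : 'M[S]_(p, q)) k :
  (forall i j, c i j \is (k * d).-homog for mf) -> exists D, map_mx ev D = c.
Proof.
move=> hc.
have [G hG] : exists G : 'I_p * 'I_q -> R, forall x, ev (G x) = c x.1 x.2.
  apply: (@fin_all_exists ('I_p * 'I_q)%type (fun=> R) (fun x g => ev g = c x.1 x.2)) => x; exact: (ev_onto (hc x.1 x.2)).
by exists (\matrix_(i, j) G (i, j)); apply/matrixP => i j; rewrite !mxE hG.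
Qed.

(** Any lift is made antisymmetric by halving its difference with its transpose. *)
Lemma ev_onto_antisym p (c : 'M[S]_p) k : c^T = - c ->
  (forall i j, c i j \is (k * d).-homog for mf) ->
  exists D, map_mx ev D = c /\ D^T = - D.
Proof.
move=> hc /ev_onto_mx[D hD]; exists ((2%:R^-1 : F)%:MP *: (D - D^T)); split; last first.
  by rewrite linearZ linearB /= trmxK -scalerN opprB.
rewrite map_mxZ map_mxB -map_trmx hD hc opprK /= evC -mulr2n -scaler_nat scalerA.
have -> : 2%:R = (2%:R)%:MP :> S by rewrite mpolyC_nat.
by rewrite -mpolyCM mulVf // mpolyC1 scale1r.
Qed.

(* Modulo J_j, [c] is the image of a Koszul 2-cycle over R. *)
Definition lifts j q (c : 'M[S]_N) := exists D : 'M[R]_N,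
  [/\ D^T = - D, D *m L = 0,
      forall i k, ev (D i k) \is (q * d).-homog for mf
    & forall i k, inJ b j ((map_mx ev D - c) i k)].

(** Antisymmetric matrices are 2-chains and multiplication by [X] is the boundary. The matrix [c] is
    a cycle only modulo J_j, whereas its lift is a cycle over R on the nose; this asymmetry is what
    the induction on [j] needs. *)
Definition exact2 j := forall q (c : 'M[S]_N), c^T = - c ->
  (forall i k, c i k \is (q.+2 * d).-homog for mf) ->
  (forall i, inJ b j ((c *m X) i 0)) -> lifts j q.+2 c.

Definition exact1 j := forall q (c : 'rV[S]_N),
  (forall k, c 0 k \is (q.+2 * d).-homog for mf) ->
  inJ b j ((c *m X) 0 0) ->
  exists D : 'rV[R]_N, [/\ D *m L = 0,
      forall k, ev (D 0 k) \is (q.+2 * d).-homog for mf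
    & forall k, inJ b j ((map_mx ev D - c) 0 k)].

Lemma mf_y i : mf (vpow b i) = d.
Proof. by rewrite -m_y mf_m. Qed.

Lemma inJ_mulmx j p q u (A : 'M[S]_(p, q)) (B : 'M_(q, u)) i k :
  (forall i k, inJ b j (A i k)) -> inJ b j ((A *m B) i k).
Proof. by move=> h; rewrite mxE; apply: inJ_sum => z _; rewrite mulrC; exact: inJM. Qed.

(* y_j is a non-zero divisor modulo J_j, and multiplication by it is
   null-homotopic on the Koszul complex: exactness descends from J_(j+1). *)
Lemma exact2_step (i : 'I_n.+1) : exact2 i.+1 -> exact2 i.
Proof.
move=> ex q c antic hc cX.
have [D1 [antiD1 D1L hD1 JD1]] := ex q c antic hc (fun k => inJS (cX k)).
pose r0 := c - map_mx ev D1.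
have antir : r0^T = - r0.
  by rewrite linearB /= antic map_trmx antiD1 map_mxN opprB opprK addrC.
have hr k k' : r0 k k' \is (q.+2 * d).-homog for mf.
  by rewrite !mxE rpredB // hc.
have Jr k k' : inJ b i.+1 (r0 k k').
  by rewrite /r0 -opprB mxE; apply: inJN.
pose c1 := map_mx (divX (vpow b i)) r0.
have c1E k k' mu : (c1 k k')@_mu = (r0 k k')@_(mu + vpow b i) by rewrite mxE mcoeff_divX.
have antic1 : c1^T = - c1.
  apply/matrixP => k k'; apply/mpolyP => mu.
  rewrite mxE c1E [(- c1) _ _]mxE mcoeffN c1E.
  by have /matrixP/(_ k k') := antir; rewrite mxE [RHS]mxE => ->; rewrite mcoeffN.
have hc1 k k' : c1 k k' \is (q.+1 * d).-homog for mf.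
  by rewrite mxE; apply: (divX_homog (mf_y i)); rewrite addnC -mulSn hr.
have [C1 [evC1 antiC1]] := ev_onto_antisym antic1 hc1.
pose u := r0 - 'X_[vpow b i] *: c1.
have Ju k k' : inJ b i (u k k').
  by rewrite mxE [(- _ : matrix _ _ _) _ _]mxE [(_ *: _ : matrix _ _ _) _ _]mxE [c1 _ _]mxE; apply: inJ_divX (Jr _ _).
pose v := C1 *m L.
have evv : map_mx ev v = c1 *m X by rewrite map_mxM evC1 ev_L.
have yc1X : 'X_[vpow b i] *: (c1 *m X) = c *m X - u *m X.
    rewrite scalemxAl -mulmxBl; have -> : 'X_[vpow b i] *: c1 = c - map_mx ev D1 - u.
      by rewrite /u opprB addrC subrK.
    by rewrite !mulmxBl -ev_L -(map_mxM ev D1) D1L map_mx0 subr0.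
have Jv k : inJ b i ((c1 *m X) k 0).
  apply: inJ_cancel.
  have /matrixP/(_ k 0) := yc1X; rewrite mxE => ->.
  by rewrite mxE [(- _ : matrix _ _ _) _ _]mxE; apply/inJB/inJ_mulmx/Ju/cX.
pose e := eR (y i).
(* Up to sign this is the boundary of e /\ C1, hence an exact cycle although [C1] is none. Its image
   is y_i c1 up to terms in J_i, as the image of [v] lies there. *)
pose D2 := l (y i) *: C1 + e *m v^T - v *m e^T.
have antiD2 : D2^T = - D2.
  rewrite /D2 linearB linearD /= linearZ /= antiC1 (trmx_mul e) (trmx_mul v) !trmxK.
  by rewrite scalerN !opprD opprK [LHS]addrAC.
have vL : v^T *m L = 0.
  by rewrite trmx_mul antiC1 mulmxN mulNmx antisym_form // oppr0.
have D2L : D2 *m L = 0.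
  rewrite mulmxBl mulmxDl -scalemxAl -(mulmxA e) vL mulmx0 addr0 -(mulmxA v) eR_L.
  by rewrite mul_mx_scalar subrr.
have evD2 : map_mx ev D2 = 'X_[vpow b i] *: c1
    + (ed (y i) *m (c1 *m X)^T - (c1 *m X) *m (ed (y i))^T).
  rewrite /D2 map_mxB map_mxD map_mxZ evC1 (map_mxM ev e) (map_mxM ev v).
  rewrite -!map_trmx evv ev_eR.
  by rewrite ev_l m_y [RHS]addrA.
clearbody D2; exists (D1 + D2); split.
- by rewrite linearD /= antiD1 antiD2 opprD.
- by rewrite mulmxDl D1L D2L addr0.
- move=> k k'; rewrite mxE rmorphD /= rpredD //.
  have -> : ev (D2 k k') = map_mx ev D2 k k' by rewrite mxE.
  have hcX k0 : (c1 *m X) k0 0 \is (q.+2 * d).-homog for mf.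
    rewrite mxE rpred_sum // => z _; rewrite [X _ _]mxE mulSnr.
    by apply: dhomogM => //; rewrite dhomogX mf_m.
  rewrite evD2 mxE [(_ *: _ : matrix _ _ _) _ _]mxE [(_ - _ : matrix _ _ _) _ _]mxE [(- _ : matrix _ _ _) _ _]mxE.
  rewrite rpredD ?rpredB //.
  + by rewrite mulSn; apply: dhomogM => //; rewrite dhomogX mf_y.
  + rewrite mxE big_ord1 [_^T _ _]mxE mxE.
    by case: (_ && _); rewrite ?mul1r ?mul0r ?rpred0.
  + rewrite mxE big_ord1 [_^T _ _]mxE [ed _ _ _]mxE.
    by case: (_ && _); rewrite ?mulr1 ?mulr0 ?rpred0.
- move=> k k'; have -> : map_mx ev (D1 + D2) - c = map_mx ev D2 - r0.
    by rewrite map_mxD /r0 opprB addrCA addrA.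
  rewrite evD2 addrAC; have -> : 'X_[vpow b i] *: c1 - r0 = - u by rewrite /u [RHS]opprB.
  rewrite mxE [(- _ : matrix _ _ _) _ _]mxE; apply: inJD; first exact: inJN.
  rewrite mxE [(- _ : matrix _ _ _) _ _]mxE; apply: inJB.
    by rewrite mxE big_ord1 [_^T _ _]mxE; apply: inJM.
  by rewrite mxE big_ord1 mulrC; apply: inJM.
Qed.

(** The homotopy of [exact2_step] one degree lower: the correction [D2] is, up to sign, the boundary
    of e /\ C1 for a row [C1]. *)
Lemma exact1_step (i : 'I_n.+1) : exact1 i.+1 -> exact1 i.
Proof.
move=> ex q c hc cX.
have [D1 [D1L hD1 JD1]] := ex q c hc (inJS cX).
pose r0 := c - map_mx ev D1.
have hr k : r0 0 k \is (q.+2 * d).-homog for mf.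
  by rewrite !mxE rpredB // hc.
have Jr k : inJ b i.+1 (r0 0 k).
  by rewrite /r0 -opprB mxE; apply: inJN.
pose c1 := map_mx (divX (vpow b i)) r0.
have hc1 k' k : c1 k' k \is (q.+1 * d).-homog for mf.
  by rewrite ord1 mxE; apply: (divX_homog (mf_y i)); rewrite addnC -mulSn hr.
have [C1 evC1] := ev_onto_mx hc1.
pose u := r0 - 'X_[vpow b i] *: c1.
have Ju k : inJ b i (u 0 k).
  by rewrite mxE [(- _ : matrix _ _ _) _ _]mxE [(_ *: _ : matrix _ _ _) _ _]mxE [c1 _ _]mxE; apply: inJ_divX (Jr _).
have yc1X : 'X_[vpow b i] *: (c1 *m X) = c *m X - u *m X.
    rewrite scalemxAl -mulmxBl; have -> : 'X_[vpow b i] *: c1 = c - map_mx ev D1 - u.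
      by rewrite /u opprB addrC subrK.
    by rewrite !mulmxBl -ev_L -(map_mxM ev D1) D1L map_mx0 subr0.
have Jv : inJ b i ((c1 *m X) 0 0).
  apply: inJ_cancel.
  have /matrixP/(_ 0 0) := yc1X; rewrite mxE => ->.
  rewrite mxE [(- _ : matrix _ _ _) _ _]mxE; apply: inJB => //.
  by apply: inJ_mulmx => k k'; rewrite ord1.
pose e := eR (y i).
pose D2 := l (y i) *: C1 - C1 *m L *m e^T.
have D2L : D2 *m L = 0.
  by rewrite mulmxBl -scalemxAl -!mulmxA eR_L !mulmxA mul_mx_scalar subrr.
have evD2 : map_mx ev D2 = 'X_[vpow b i] *: c1 - c1 *m X *m (ed (y i))^T.
  by rewrite /D2 map_mxB map_mxZ !map_mxM evC1 -!map_trmx ev_eR ev_L ev_l m_y.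
clearbody D2; exists (D1 + D2); split.
- by rewrite mulmxDl D1L D2L addr0.
- move=> k; rewrite mxE rmorphD /= rpredD //.
  have -> : ev (D2 0 k) = map_mx ev D2 0 k by rewrite mxE.
  have hcX : (c1 *m X) 0 0 \is (q.+2 * d).-homog for mf.
    rewrite mxE rpred_sum // => z _; rewrite [X _ _]mxE mulSnr.
    by apply: dhomogM => //; rewrite dhomogX mf_m.
  rewrite evD2 mxE [(_ *: _ : matrix _ _ _) _ _]mxE [(- _ : matrix _ _ _) _ _]mxE.
  rewrite rpredB //.
  + by rewrite mulSn; apply: dhomogM => //; rewrite dhomogX mf_y.
  + rewrite mxE big_ord1 [_^T _ _]mxE [ed _ _ _]mxE.
    by case: (_ && _); rewrite ?mulr1 ?mulr0 ?rpred0.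
- move=> k; have -> : map_mx ev (D1 + D2) - c = map_mx ev D2 - r0.
    by rewrite map_mxD /r0 opprB addrCA addrA.
  rewrite evD2 addrAC; have -> : 'X_[vpow b i] *: c1 - r0 = - u by rewrite /u [RHS]opprB.
  rewrite mxE [(- _ : matrix _ _ _) _ _]mxE [(- _ : matrix _ _ _) 0 k]mxE; apply: inJB; first exact: inJN.
  by rewrite mxE big_ord1 mulrC; apply: inJM.
Qed.

Lemma homog_split q f : f \is (q.+2 * d).-homog for mf ->
  exists t : 'rV[S]_N,
    (forall k, t 0 k \is (q.+1 * d).-homog for mf) /\ (t *m X) 0 0 = f.
Proof.
move=> hf; rewrite (mpolyE f) big_seq.
apply: (big_ind (fun f => exists t : 'rV[S]_N,
    (forall k, t 0 k \is (q.+1 * d).-homog for mf) /\ (t *m X) 0 0 = f)).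
- by exists 0; split=> [k|]; rewrite ?mul0mx mxE ?rpred0.
- move=> _ _ [t1 [h1 <-]] [t2 [h2 <-]]; exists (t1 + t2).
  by split=> [k|]; rewrite ?mulmxDl mxE ?rpredD.
move=> mu /(dhomog_mf hf) hmu; have [k hk] := m_div hmu.
exists ((f@_mu *: 'X_[mu - m k]) *: delta_mx 0 k); split=> [k'|].
  rewrite !mxE; case: (_ && _); rewrite ?mulr1 ?mulr0 ?rpred0 // rpredZ // dhomogX.
  by rewrite -(eqn_add2r d) -{1}(mf_m k) -mfD submK // hmu addnC -mulSn.
by rewrite -scalemxAl -rowE !mxE -scalerAl -mpolyXD submK.
Qed.

(** Since y_0 vanishes modulo J_j, the wedge of e_(y_0) with a 1-cycle [c] is a 2-cycle [A]. Each
    row of a lift of [A] is a 1-cycle over R, and the row of index [k0] reproduces [c] except in the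
    entry [k0], which antisymmetry forces to be 0. *)
Lemma exact1_of_exact2 j : (0 < j)%N -> exact2 j -> exact1 j.
Proof.
move=> j0 ex q c hc cX.
pose i0 : 'I_n.+1 := ord0; pose k0 := y i0.
pose A := ed k0 *m c - c^T *m (ed k0)^T.
have AE i k : A i k = (i == k0)%:R * c 0 k - c 0 i * (k == k0)%:R.
  by rewrite /A mxE [(- _ : matrix _ _ _) _ _]mxE !mxE !big_ord1 !mxE !eqxx !andbT.
have antiA : A^T = - A.
  by apply/matrixP => i k; rewrite mxE [RHS]mxE !AE opprB mulrC [X in _ - X]mulrC.
have hA i k : A i k \is (q.+2 * d).-homog for mf.
  by rewrite AE; do 2!case: eqP => _; rewrite ?mul1r ?mul0r ?mulr1 ?mulr0 rpredB ?rpred0.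
have Jy (g : S) : inJ b j ('X_[vpow b i0] * g) by apply: inJX; apply: vpowNbox.
have JAX i : inJ b j ((A *m X) i 0).
  rewrite mulmxBl -!mulmxA ed_X mul_mx_scalar m_y mxE [(- _ : matrix _ _ _) _ _]mxE.
  apply: inJB; first by rewrite mxE big_ord1; apply: inJM.
  by rewrite mxE; apply: Jy.
have [D [antiD DL hD JD]] := ex q A antiA hA JAX.
have [t [ht tX]] := homog_split (hc k0).
have [|T evT] := @ev_onto_mx _ _ t q.+1; first by move=> i k; rewrite ord1.
(* The lost entry is restored by a Koszul boundary whose image is y_0 t - c_(k0) e_(k0), and y_0 t
   lies in J_j. *)
exists (row k0 D - (l k0 *: T - (T *m L) *m (eR k0)^T)).
have E k : ev ((row k0 D - (l k0 *: T - (T *m L) *m (eR k0)^T)) 0 k)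
    = ev (D k0 k) - ('X_[vpow b i0] * t 0 k - c 0 k0 * (k == k0)%:R).
  have : ev ((T *m L) 0 0) = c 0 k0.
    by rewrite -tX -evT -ev_L -(map_mxM ev T) [RHS]mxE.
  move=> <-; rewrite -m_y -ev_l -evT !mxE !rmorphB /= !rmorphM /= big_ord1 !mxE.
  by rewrite rmorphM /= rmorph_nat eqxx andbT.
split.
- rewrite !mulmxBl -row_mul DL -scalemxAl -(mulmxA _ _ L) eR_L mul_mx_scalar subrr subr0.
  by rewrite row0.
- move=> k; rewrite E !rpredB //.
    by rewrite mulSn; apply: dhomogM => //; rewrite dhomogX mf_y.
  by case: eqP => _; rewrite ?mulr1 ?mulr0 ?rpred0.
- move=> k; rewrite mxE [map_mx _ _ _ _]mxE [(- _ : matrix _ _ _) _ _]mxE E.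
  have /(inJB (g := 'X_[vpow b i0] * t 0 k)) := JD k0 k.
  move=> /(_ (Jy _)); rewrite mxE [map_mx _ _ _ _]mxE [(- _ : matrix _ _ _) _ _]mxE AE.
  by congr (inJ _ _ _); rewrite eqxx mul1r; ring.
Qed.

Lemma m_full mu : mf mu = d -> exists k, m k = mu.
Proof.
move=> e; have [k le] := @m_div 0 mu (etrans e (esym (mul1n d))).
exists k; have z : (mu - m k)%MM = 0%MM.
  by apply: mf_eq0; apply/eqP; rewrite -(eqn_add2r d) -{1}(mf_m k) -mfD submK // e.
by rewrite -(submK le) z add0m.
Qed.

Lemma lifts0 j q (c : 'M[S]_N) : (forall i k, inJ b j (c i k)) -> lifts j q c.
Proof.
move=> h; exists 0; split; rewrite ?mul0mx ?linear0 ?oppr0 //.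
  by move=> i k; rewrite mxE rmorph0 rpred0.
by move=> i k; rewrite map_mx0 sub0r mxE; apply: inJN.
Qed.

Lemma liftsD j q c c' : lifts j q c -> lifts j q c' -> lifts j q (c + c').
Proof.
move=> [D [a1 a2 a3 a4]] [D' [b1 b2 b3 b4]]; exists (D + D'); split.
- by rewrite linearD /= a1 b1 opprD.
- by rewrite mulmxDl a2 b2 addr0.
- by move=> i k; rewrite mxE rmorphD /= rpredD.
- by move=> i k; rewrite map_mxD opprD addrACA mxE; apply: inJD.
Qed.

Lemma liftsZ j q a c : lifts j q c -> lifts j q (a%:MP *: c).
Proof.
move=> [D [a1 a2 a3 a4]]; exists (a%:MP *: D); split.
- by rewrite linearZ /= a1 scalerN.
- by rewrite -scalemxAl a2 scaler0.
- by move=> i k; rewrite mxE rmorphM /= evC mul_mpolyC rpredZ.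
- by move=> i k; rewrite map_mxZ /= evC -scalerBr mxE; apply: inJM.
Qed.

Lemma liftsN j q c : lifts j q c -> lifts j q (- c).
Proof. by move/(@liftsZ _ _ (-1)); rewrite mpolyCN mpolyC1 scaleN1r. Qed.

Lemma lifts_sum j q (I : finType) (c : I -> 'M[S]_N) :
  (forall i, lifts j q (c i)) -> lifts j q (\sum_i c i).
Proof.
move=> h; apply: big_ind => //; last exact: liftsD.
by apply: lifts0 => i k; rewrite mxE; apply: inJ0.
Qed.

Definition wedge (K : pzRingType) (i j : 'I_N) : 'M[K]_N := delta_mx i j - delta_mx j i.

Lemma wedge_anti (K : pzRingType) i j : (wedge K i j)^T = - wedge K i j.
Proof. by rewrite linearB /= !trmx_delta opprB. Qed.

Lemma wedgeC (K : pzRingType) i j : wedge K i j = - wedge K j i.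
Proof. by rewrite opprB. Qed.

Lemma wedge_L i j : wedge R i j *m L = l j *: eR i - l i *: eR j.
Proof.
have E u v : delta_mx u v *m L = l v *: eR u.
  by rewrite -(mul_delta_mx (0 : 'I_1)) -mulmxA -[delta_mx 0 v]trmx_delta eR_L mul_mx_scalar.
by rewrite mulmxBl !E.
Qed.

Lemma antisymZ (K : pzRingType) p a (A : 'M[K]_p) : A^T = - A -> (a *: A)^T = - (a *: A).
Proof.
by move=> h; apply/matrixP => i k; move/matrixP/(_ i k): h; rewrite !mxE => ->; rewrite mulrN.
Qed.

Lemma antisymD (K : pzRingType) p (A B : 'M[K]_p) :
  A^T = - A -> B^T = - B -> (A + B)^T = - (A + B).
Proof.
move=> h h'; apply/matrixP => i k; move/matrixP/(_ i k): h; move/matrixP/(_ i k): h'.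
by rewrite !mxE => -> ->; rewrite opprD.
Qed.

Definition elem2 i j mu : 'M[S]_N := 'X_[mu] *: wedge S i j.

Lemma elem2E i j mu k k' : elem2 i j mu k k'
  = 'X_[mu] * (((k == i) && (k' == j))%:R - ((k == j) && (k' == i))%:R).
Proof. by rewrite !mxE. Qed.

Lemma elem2C i j mu : elem2 i j mu = - elem2 j i mu.
Proof. by rewrite /elem2 wedgeC scalerN. Qed.

(** The sum is the image of the Koszul boundary of T e_i /\ e_j /\ e_k, where [T] is a preimage of
    x^t. *)
Lemma elem2_triple q i j k t : mf t = (q.+1 * d)%N -> lifts n.+1 q.+2
  (elem2 i j (m k + t) + elem2 j k (m i + t) + elem2 k i (m j + t)).
Proof.
move=> ht; have [T evT] : exists T, ev T = 'X_[t].
  by apply: (@ev_onto q.+1); rewrite dhomogX ht.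
pose D := T *: (l k *: wedge R i j + l i *: wedge R j k + l j *: wedge R k i).
have evD : map_mx ev D =
   elem2 i j (m k + t) + elem2 j k (m i + t) + elem2 k i (m j + t).
  apply/matrixP => u v; rewrite !mxE rmorphM !rmorphD !rmorphM !rmorphB /=.
  by rewrite !rmorph_nat !ev_l evT !mpolyXD; ring.
exists D; split.
- by apply: antisymZ; do !apply: antisymD; apply: antisymZ; apply: wedge_anti.
- rewrite -scalemxAl !mulmxDl -!scalemxAl !wedge_L.
  by rewrite koszul_cycle scaler0.
- have h u v w k0 k1 : elem2 u v (m w + t) k0 k1 \is (q.+2 * d).-homog for mf.
    rewrite elem2E; do 2!case: (_ && _);
    rewrite ?subrr ?subr0 ?sub0r ?mulrN ?mulr0 ?mulr1 ?rpredN ?rpred0 // dhomogX;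
    by rewrite mfD mf_m ht -mulSn.
  move=> u v; have -> : ev (D u v) = map_mx ev D u v by rewrite [RHS]mxE.
  rewrite evD; move: (h i j k u v) (h j k i u v) (h k i j u v).
  move: (elem2 i j _) (elem2 j k _) (elem2 k i _) => A1 A2 A3 h1 h2 h3.
  by rewrite mxE rpredD // mxE rpredD.
- by move=> u v; rewrite evD subrr mxE; apply: inJ0.
Qed.

Variables (sigma : 'X_{1..n.+1}) (root : 'X_{1..n.+1} -> 'X_{1..n.+1}).

(* [good u v mu] means that the basis element x^mu e_u /\ e_v of the artinian
   reduction is a combination of images of Koszul boundaries and of the elements
   x^(sigma - root u) e_(root u) /\ e_u.  The latter drop out of a cycle because
   its image has coefficient 0 at the socle monomial sigma.  [good_step] is the
   Koszul relation for the triple (u, v, k). *)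
Inductive good : 'X_{1..n.+1} -> 'X_{1..n.+1} -> 'X_{1..n.+1} -> Prop :=
| good_diag u mu : good u u mu
| good_out u v mu : ~~ box b n.+1 mu -> good u v mu
| good_root u : good (root u) u (sigma - root u)
| good_sym u v mu : good v u mu -> good u v mu
| good_step u v k t : mf k = d ->
    good v k (u + t) -> good k u (v + t) -> good u v (k + t).

Hypothesis m_inj : injective m.
Hypothesis root_deg : forall u, mf (root u) = d.
Hypothesis root_neq : forall u, root u != u.
Hypothesis root_le : forall u, (root u <= sigma)%MM.
Hypothesis sigma_box : box b n.+1 sigma.

Section Special.
Variable rt : 'I_N -> 'I_N.
Hypothesis m_rt : forall j, m (rt j) = root (m j).

Let s j := elem2 (rt j) j (sigma - m (rt j)).
(** The combination of special chains [s] whose boundary has the same coefficients at sigma as that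
    of x^mu e_i /\ e_j. The boundary of [s j] contributes -1 at e_j and nothing at e_(rt j), because
    a monomial differs from its root. *)
Let kappa i j mu : 'M[S]_N :=
  (if (m i + mu)%MM == sigma then s j else 0)
  - (if (m j + mu)%MM == sigma then s i else 0).

(** Induction on the derivation. For [good_root] the chain and its correction coincide. For
    [good_step] the chains satisfy the relation of [elem2_triple] modulo lifts, and the three
    corrections add up to zero, so the lift passes from two terms to the third. *)
Lemma good_lifts u v mu : good u v mu -> forall q i j, m i = u -> m j = v ->
  mf mu = (q.+2 * d)%N -> lifts n.+1 q.+2 (elem2 i j mu - kappa i j mu).
Proof.
elim=> {u v mu} [u mu|u v mu nb|u|u v mu _ IH|u v k t hk _ IH1 _ IH2] q i j ei ej hmu.
- have -> : j = i by apply: m_inj; rewrite ej.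
  apply: lifts0 => k k'; rewrite /kappa subrr subr0 elem2E subrr mulr0.
  exact: inJ0.
- have ne w : ((w + mu)%MM == sigma) = false.
    apply/negP => /eqP e; move/negP: nb; apply.
    by apply: (box_le _ sigma_box); rewrite -e; exact: lem_addl.
  rewrite /kappa !ne subrr subr0; apply: lifts0 => k k'.
  by rewrite elem2E; apply: inJX.
- have eir : i = rt j by apply: m_inj; rewrite m_rt ej.
  have e1 : (m i + (sigma - root u))%MM = sigma.
    by rewrite addmC ei submK.
  have e2 : ((m j + (sigma - root u))%MM == sigma) = false.
    apply/negP => /eqP e; move: (root_neq u); rewrite -ei -ej => /eqP; apply.
    by move: e; rewrite -{2}e1 => /addIm ->.
  rewrite /kappa e1 eqxx e2 subr0 /s m_rt ej -eir subrr.
  by apply: lifts0 => k k'; rewrite mxE; exact: inJ0.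
- have -> : elem2 i j mu - kappa i j mu = - (elem2 j i mu - kappa j i mu).
    by rewrite opprB elem2C /kappa opprB [RHS]addrC.
  exact/liftsN/IH.
- have [kk ek] := m_full hk; rewrite -ek in hmu IH1 IH2 *.
  have ht : mf t = (q.+1 * d)%N.
    by apply/eqP; rewrite -(eqn_add2l d) -{1}(mf_m kk) -mfD hmu -mulSn.
  have hs k0 : mf (m k0 + t)%MM = (q.+2 * d)%N by rewrite mfD mf_m ht -mulSn.
  rewrite -ei -ej in IH1 IH2.
  have h1 := IH1 q j kk erefl erefl (hs i).
  have h2 := IH2 q kk i erefl erefl (hs j).
  have h3 := elem2_triple i j kk ht.
  have := liftsD h3 (liftsN (liftsD h1 h2)).
  rewrite zmod_cancel; congr (lifts _ _ (_ - _)); rewrite /kappa.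
  rewrite ![(_ + (_ + t))%MM]addmA ![(m kk + m _)%MM]addmC [(m j + m i)%MM]addmC.
  exact: zmod_rotate.
Qed.

(** The cycle is expanded into monomial chains, each of which lifts after subtraction of its
    [kappa]. In the sum, the coefficient of [s j] is the coefficient of sigma in an entry of the
    boundary of [c], which vanishes because sigma lies in the box. *)
Lemma exact2_top_of_good :
  (forall u v mu q, mf u = d -> mf v = d -> mf mu = (q.+2 * d)%N -> good u v mu) ->
  exact2 n.+1.
Proof.
move=> hgood q c antic hc cX.
pose B := \max_(ij : 'I_N * 'I_N) msize (c ij.1 ij.2).
have cE i j : c i j = \sum_(mu : 'X_{1..n.+1 < B}) (c i j)@_mu *: 'X_[mu].
  by apply: mpolywE; exact: (leq_bigmax (i, j)).
have coef_sigma k i j : ('X_[m k] * c i j)@_sigma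
    = \sum_(mu : 'X_{1..n.+1 < B}) if (m k + mu)%MM == sigma then (c i j)@_mu else 0.
  rewrite {1}(cE i j) mulr_sumr raddf_sum /=; apply: eq_bigr => mu _.
  rewrite -scalerAr -mpolyXD mcoeffZ mcoeffX; case: ifP => _; by rewrite ?mulr1 ?mulr0.
have sum0 j : \sum_i ('X_[m i] * c i j)@_sigma = 0.
  have := cX j sigma sigma_box; rewrite mxE raddf_sum /= => e.
  apply/eqP; rewrite -oppr_eq0 -sumrN -[X in _ == X]e; apply/eqP/eq_bigr => i _.
  have /matrixP/(_ i j) := antic; rewrite mxE [RHS]mxE => ->.
  by rewrite [X _ _]mxE mulNr mcoeffN mulrC.
have sum0' i : \sum_j ('X_[m j] * c i j)@_sigma = 0.
  have := cX i sigma sigma_box; rewrite mxE raddf_sum /= => e.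
  rewrite -[RHS]e; apply: eq_bigr => j _; by rewrite [X _ _]mxE mulrC.
have lift_term i j (mu : 'X_{1..n.+1 < B}) :
    lifts n.+1 q.+2 (((c i j)@_mu)%:MP *: (elem2 i j mu - kappa i j mu)).
  case: (eqVneq (c i j)@_mu 0) => [->|].
    by rewrite mpolyC0 scale0r; apply: lifts0 => k k'; rewrite mxE; exact: inJ0.
  rewrite -mcoeff_msupp => /(dhomog_mf (hc i j)) hmu.
  by apply/liftsZ/good_lifts; [apply: (hgood _ _ _ q) | | | exact: hmu].
have := lifts_sum (fun i => lifts_sum (fun j => lifts_sum (lift_term i j))).
(* The sum runs over ordered pairs, so it gives c - c^T, twice the cycle. *)
have -> : \sum_i \sum_j \sum_(mu : 'X_{1..n.+1 < B})
   ((c i j)@_mu)%:MP *: (elem2 i j mu - kappa i j mu) = c + c.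
  have split_term i j : \sum_(mu : 'X_{1..n.+1 < B})
      ((c i j)@_mu)%:MP *: (elem2 i j mu - kappa i j mu)
    = c i j *: wedge S i j - ((('X_[m i] * c i j)@_sigma)%:MP *: s j
                            - (('X_[m j] * c i j)@_sigma)%:MP *: s i).
    under eq_bigr => mu _ do rewrite scalerBr.
    rewrite sumrB; congr (_ - _).
      rewrite [in RHS](cE i j) scaler_suml; apply: eq_bigr => mu _.
      by rewrite /elem2 scalerA mul_mpolyC.
    rewrite !coef_sigma !rmorph_sum /= !scaler_suml -sumrB; apply: eq_bigr => mu _.
    rewrite /kappa scalerBr; congr (_ - _); case: ifP => _ //;
    by rewrite ?scaler0 ?mpolyC0 ?scale0r.
  under eq_bigr => i _ do under eq_bigr => j _ do rewrite split_term.
  under eq_bigr => i _ do rewrite sumrB sumrB.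
  rewrite sumrB sumrB [X in _ - (X - _)]exchange_big /=.
  rewrite [X in _ - (X - _)]big1 ?sub0r => [|j _]; last first.
    by rewrite -scaler_suml -rmorph_sum /= sum0 mpolyC0 scale0r.
  rewrite [X in _ - - X]big1 ?oppr0 ?subr0 => [|i _]; last first.
    by rewrite -scaler_suml -rmorph_sum /= sum0' mpolyC0 scale0r.
  under eq_bigr => i _ do under eq_bigr => j _ do rewrite scalerBr.
  under eq_bigr => i _ do rewrite sumrB.
  rewrite sumrB -matrix_sum_delta exchange_big /=.
  have -> : \sum_j \sum_i c i j *: delta_mx j i = c^T.
    rewrite [RHS]matrix_sum_delta.
    by apply: eq_bigr => i _; apply: eq_bigr => j _; rewrite mxE.
  by rewrite antic opprK addr0.
move=> h2; have := liftsZ (2%:R^-1) h2; congr (lifts _ _ _).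
by rewrite -mulr2n -scaler_nat scalerA -mpolyC_nat -mpolyCM mulVf // mpolyC1 scale1r.
Qed.
End Special.

Hypothesis all_good : forall u v mu q,
  mf u = d -> mf v = d -> mf mu = (q.+2 * d)%N -> good u v mu.

Lemma exact2_top : exact2 n.+1.
Proof.
have [rt hrt] : exists rt : 'I_N -> 'I_N, forall j, m (rt j) = root (m j).
  apply: (@fin_all_exists _ (fun=> 'I_N) (fun j k => m k = root (m j))) => j.
  exact/m_full/root_deg.
exact: (exact2_top_of_good hrt all_good).
Qed.

Lemma exact2_all j : (j <= n.+1)%N -> exact2 j.
Proof.
move=> le; rewrite -(subKn le); elim: (n.+1 - j)%N (leq_subr j n.+1) => [|k IH] hk.
  by rewrite subn0; exact: exact2_top.
have lt : (n.+1 - k.+1 < n.+1)%N by rewrite subSS ltnS leq_subr.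
apply: (exact2_step (i := Ordinal lt)) => /=.
by rewrite -subSn //; apply/IH/ltnW.
Qed.

Lemma koszul2_lift q (c : 'M[S]_N) : c^T = - c ->
  (forall i k, c i k \is (q.+2 * d).-homog for mf) -> c *m X = 0 ->
  exists D : 'M[R]_N, [/\ D^T = - D, D *m L = 0 & map_mx ev D = c].
Proof.
move=> antic hc cX; have [|D [aD DL _ JD]] := exact2_all (leq0n _) antic hc.
  by move=> i; rewrite cX mxE; exact: inJ0.
exists D; split=> //; apply/matrixP => i k; apply/eqP; rewrite -subr_eq0.
by have := inJ_zero (JD i k); rewrite mxE [(- _ : matrix _ _ _) _ _]mxE => ->.
Qed.

Lemma koszul1_lift q (c : 'rV[S]_N) :
  (forall k, c 0 k \is (q.+2 * d).-homog for mf) -> c *m X = 0 ->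
  exists D : 'rV[R]_N, D *m L = 0 /\ map_mx ev D = c.
Proof.
move=> hc cX.
(* The passage from 2-cycles to 1-cycles needs one y_i to be zero; it is made modulo y_0 and
   followed by a single descent. *)
have ex1 : exact1 0.
  exact: (exact1_step (i := ord0) (exact1_of_exact2 (ltn0Sn 0) (exact2_all (ltn0Sn _)))).
have [|D [DL _ JD]] := ex1 q c hc; first by rewrite cX mxE; exact: inJ0.
exists D; split=> //; apply/matrixP => i k; rewrite ord1; apply/eqP; rewrite -subr_eq0.
by have := inJ_zero (JD k); rewrite mxE [(- _ : matrix _ _ _) _ _]mxE => ->.
Qed.

End Koszul.

(** * Computations with monomials in four variables *)

Section QuadComputation.
Local Open Scope nat_scope.

(** Multinomials do not reduce well, so the search runs on plain tuples with the standard operations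
    on [nat]; [decode] carries its results back. *)
Definition quad := (nat * nat * nat * nat)%type.

Definition qadd (u v : quad) : quad :=
  let: (u0, u1, u2, u3) := u in let: (v0, v1, v2, v3) := v in
  (Nat.add u0 v0, Nat.add u1 v1, Nat.add u2 v2, Nat.add u3 v3).

Definition qsub (u v : quad) : quad :=
  let: (u0, u1, u2, u3) := u in let: (v0, v1, v2, v3) := v in
  (Nat.sub u0 v0, Nat.sub u1 v1, Nat.sub u2 v2, Nat.sub u3 v3).

Definition qle (u v : quad) : bool :=
  let: (u0, u1, u2, u3) := u in let: (v0, v1, v2, v3) := v in
  if Nat.leb u0 v0 then if Nat.leb u1 v1 then if Nat.leb u2 v2 then Nat.leb u3 v3
  else false else false else false.

Definition qeq (u v : quad) : bool := if qle u v then qle v u else false.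

Definition qdeg (u w : quad) : nat :=
  let: (u0, u1, u2, u3) := u in let: (w0, w1, w2, w3) := w in
  Nat.add (Nat.mul w0 u0) (Nat.add (Nat.mul w1 u1)
    (Nat.add (Nat.mul w2 u2) (Nat.mul w3 u3))).

Fixpoint qhas (p : quad -> bool) (s : seq quad) : bool :=
  if s is x :: s' then if p x then true else qhas p s' else false.

Variables (sigma : quad) (verts : seq quad) (r0 r1 : quad).

(** One fixed monomial serves as root of all the others; a second one is its own root, so that no
    monomial is the root of itself. *)
Definition qroot (v : quad) : quad := if qeq v r0 then r1 else r0.

(* Nested conditionals instead of boolean connectives make call-by-value
   evaluation lazy. *)
Fixpoint derivable (fuel : nat) (u v mu : quad) : bool :=
  (* The diagonal is good, but it is reached with k equal to u or v, where the Koszul relation only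
     reproduces the pair it started from; the answer false prunes these branches. *)
  if qeq u v then false else
  let umu := qadd u mu in
  let vmu := qadd v mu in
  if (if qeq umu sigma then qeq u (qroot v) else false) then true else
  if (if qeq vmu sigma then qeq v (qroot u) else false) then true else
  if fuel is fuel'.+1 then
    let e := qsub umu sigma in
    let f := qsub vmu sigma in
    qhas (fun k => if qle k mu then
      if (if qle e k then derivable fuel' v k (qsub umu k) else true) then
      (if qle f k then derivable fuel' k u (qsub vmu k) else true) else false
      else false) verts
  else false.

Fixpoint has2 (s t : seq bool) : bool :=
  match s, t with
  | x :: s', y :: t' => if (if x then y else false) then true else has2 s' t'
  | _, _ => false
  end.

(** Marks the k for which the Koszul term with monomial u + mu - k leaves the box. A k marked for
    both u and v makes both remaining terms of the relation vanish, so comparing masks that are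
    computed once for each u settles such pairs without any recursion. *)
Definition excess_mask (mu : quad) (ks : seq quad) (u : quad) : seq bool :=
  let e := qsub (qadd u mu) sigma in [seq ~~ qle e k | k <- ks].

(** The tests come in increasing order of cost, the mask comparison first and the deepest search
    last. *)
Definition pair_check (mu : quad) (x y : quad * seq bool) : bool :=
  if has2 x.2 y.2 then true else
  if derivable 2 x.1 y.1 mu then true else derivable 3 x.1 y.1 mu.

Definition mu_check (mu : quad) : bool :=
  let ks := [seq k <- verts | qle k mu] in
  pairwise (pair_check mu) [seq (u, excess_mask mu ks u) | u <- verts].

End QuadComputation.

Definition quads_below (b : quad) : seq quad :=
  let: (b0, b1, b2, b3) := b in
  let: ps := [seq (x, y) | x <- iota 0 b0, y <- iota 0 b1] in
  [seq (p, t) | p <- [seq (p, z) | p <- ps, z <- iota 0 b2], t <- iota 0 b3].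

Definition box_deg (w b : quad) (k : nat) : seq quad :=
  [seq u <- quads_below b | Nat.eqb (qdeg u w) k].

(** The exponents of the y_i, which are the only monomials of degree d outside the box. *)
Definition corner (b : quad) : seq quad :=
  let: (b0, b1, b2, b3) := b in
  [:: (b0, 0, 0, 0); (0, b1, 0, 0); (0, 0, b2, 0); (0, 0, 0, b3)]%N.

Definition qpred (b : quad) : quad :=
  let: (b0, b1, b2, b3) := b in (b0.-1, b1.-1, b2.-1, b3.-1).

(** Degrees 2d and 3d suffice: a monomial in the box has degree at most 3d, and one outside the box
    is zero in the quotient and divisible by some y_i. *)
Definition row_check (w b : quad) (d N : nat) : bool :=
  let: (w0, w1, w2, w3) := w in let: (b0, b1, b2, b3) := b in
  let: B1 := box_deg w b d in
  let: B2 := box_deg w b (2 * d) in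
  let: B3 := box_deg w b (3 * d) in
  let: vs := rev (B1 ++ corner b) in
  let: r0 := nth (0, 0, 0, 0)%N B1 0 in
  let: r1 := nth (0, 0, 0, 0)%N B1 1 in
  [&& [&& 0 < d, w0 * b0 == d, w1 * b1 == d, w2 * b2 == d & w3 * b3 == d],
      d == w0 + w1 + w2 + w3,
      [&& 1 < N, size B1 == N, size B2 == N & size B3 == 1],
      ~~ qeq r0 r1,
      all (fun mu => has (fun k => qle k mu) B1) (B2 ++ B3)
    & all (mu_check (qpred b) vs r0 r1) (B2 ++ B3)]%N.

(** * Soundness of the search on monomials *)

Section QuadMonomial.
Local Open Scope nat_scope.

Definition qnth (u : quad) (i : nat) : nat :=
  let: (u0, u1, u2, u3) := u in nth 0 [:: u0; u1; u2; u3] i.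

Lemma qnth_inj u v : (forall i : 'I_4, qnth u i = qnth v i) -> u = v.
Proof.
case: u v => [[[a b] c] d] [[[a' b'] c'] d'] h.
have := h (@Ordinal 4 0 isT); have := h (@Ordinal 4 1 isT).
by have := h (@Ordinal 4 2 isT); have := h (@Ordinal 4 3 isT) => /= -> -> -> ->.
Qed.

Lemma qnth_add u v i : qnth (qadd u v) i = qnth u i + qnth v i.
Proof.
case: u v => [[[a b] c] d] [[[a' b'] c'] d'] /=.
by case: i => [|[|[|[|i]]]] //=; rewrite nth_nil.
Qed.

Lemma qnth_sub u v i : qnth (qsub u v) i = qnth u i - qnth v i.
Proof.
case: u v => [[[a b] c] d] [[[a' b'] c'] d'] /=.
by case: i => [|[|[|[|i]]]] //=; rewrite nth_nil.
Qed.

Lemma qleP u v : reflect (forall i : 'I_4, qnth u i <= qnth v i) (qle u v).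
Proof.
have lebE : forall x z, Nat.leb x z = (x <= z) by elim=> [|x IH] [|z] //=; rewrite IH.
case: u v => [[[a b] c] d] [[[a' b'] c'] d']; rewrite /qle (lebE a) (lebE b) (lebE c) (lebE d).
have -> : (if a <= a' then if b <= b' then if c <= c' then d <= d' else false else false
  else false) = [&& a <= a', b <= b', c <= c' & d <= d'] by case: (a <= a'); case: (b <= b'); case: (c <= c').
apply: (iffP and4P) => [[ha hb hc hd] [[|[|[|[|i]]]]] //|h]; split;
[exact: (h (@Ordinal 4 0 isT))|exact: (h (@Ordinal 4 1 isT))
|exact: (h (@Ordinal 4 2 isT))|exact: (h (@Ordinal 4 3 isT))].
Qed.

Lemma qeqP u v : reflect (u = v) (qeq u v).
Proof.
rewrite /qeq; apply: (iffP idP) => [|->].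
  case: qleP => // h1 /qleP h2; apply: qnth_inj => i.
  by apply/eqP; rewrite eqn_leq h1 h2.
by case: qleP => // -[].
Qed.

Lemma qhasE p s : qhas p s = has p s.
Proof. by elim: s => //= x s ->; case: (p x). Qed.

Lemma qdegE u w : qdeg u w = \sum_(i < 4) qnth w i * qnth u i.
Proof.
case: u w => [[[a b] c] d] [[[a' b'] c'] d'].
by rewrite !big_ord_recr big_ord0 /= add0n -!addnA.
Qed.

Lemma mem_quads_below b u :
  (u \in quads_below b) = [forall i : 'I_4, qnth u i < qnth b i].
Proof.
case: b u => [[[b0 b1] b2] b3] [[[x y] z] t]; rewrite /quads_below.
apply/allpairsP/forallP => /= [[[[[p1 p2] p3] p4] /= []]|h].
  move=> /allpairsP [[[q1 q2] q3] /= [/allpairsP [[o1 o2] /= [i1 i2 [-> ->]]] i3 [-> -> ->]]] i4.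
  move: i1 i2 i3 i4; rewrite !mem_iota !add0n /= => i1 i2 i3 i4 [-> -> -> ->].
  by case=> [[|[|[|[|i]]]]].
exists ((x, y, z), t); split=> //=; last by rewrite mem_iota; exact: (h (@Ordinal 4 3 isT)).
apply/allpairsP; exists ((x, y), z); split=> //=;
  last by rewrite mem_iota; exact: (h (@Ordinal 4 2 isT)).
apply/allpairsP; exists (x, y); split=> //=; rewrite mem_iota.
  exact: (h (@Ordinal 4 0 isT)).
exact: (h (@Ordinal 4 1 isT)).
Qed.

Lemma uniq_quads_below b : uniq (quads_below b).
Proof.
case: b => [[[b0 b1] b2] b3]; rewrite /quads_below.
do !(apply: allpairs_uniq; rewrite ?iota_uniq //).
all: by move=> [? ?] [? ?] _ _ /= [-> ->].
Qed.

Lemma mem_box_deg w b k u : (u \in box_deg w b k)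
  = (\sum_(i < 4) qnth w i * qnth u i == k) && [forall i : 'I_4, qnth u i < qnth b i].
Proof.
by rewrite mem_filter mem_quads_below -qdegE.
Qed.

End QuadMonomial.

Section Decode.
Local Open Scope nat_scope.
Variable p : 'S_4.

(** The permutation matches the order of the given weights with that of the table row, so each row
    is searched once for all its orderings. *)
Definition decode (u : quad) : 'X_{1..4} := [multinom qnth u (p i) | i < 4].

Definition encode (m : 'X_{1..4}) : quad :=
  let q i := m ((p^-1)%g i) in
  (q (@Ordinal 4 0 isT), q (@Ordinal 4 1 isT), q (@Ordinal 4 2 isT), q (@Ordinal 4 3 isT)).

Lemma decodeE u i : decode u i = qnth u (p i).
Proof. exact: mnmE. Qed.

Lemma qnth_encode m (i : 'I_4) : qnth (encode m) i = m ((p^-1)%g i).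
Proof.
by case: i => [[|[|[|[|i]]]] hi] //=; congr (m ((p^-1)%g _)); apply: val_inj.
Qed.

Lemma encodeK : cancel encode decode.
Proof. by move=> m; apply/mnmP => i; rewrite decodeE qnth_encode permK. Qed.

Lemma decodeK : cancel decode encode.
Proof. by move=> u; apply: qnth_inj => i; rewrite qnth_encode decodeE permKV. Qed.

Lemma decodeD u v : decode (qadd u v) = (decode u + decode v)%MM.
Proof. by apply/mnmP => i; rewrite mnmDE !decodeE qnth_add. Qed.

Lemma decodeB u v : decode (qsub u v) = (decode u - decode v)%MM.
Proof. by apply/mnmP => i; rewrite mnmBE !decodeE qnth_sub. Qed.

Lemma decode_le u v : (decode u <= decode v)%MM = qle u v.
Proof.
apply/mnm_lepP/qleP => h i; last by rewrite !decodeE.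
by have := h ((p^-1)%g i); rewrite !decodeE permKV.
Qed.

Variables (w b : quad).
Let wt (i : 'I_4) := qnth w (p i).
Let bt (i : 'I_4) := qnth b (p i).

Lemma wdeg_decode u : wdeg wt (decode u) = \sum_(i < 4) qnth w i * qnth u i.
Proof.
rewrite /wdeg [RHS](reindex_inj (@perm_inj _ p)); apply: eq_bigr => i _.
by rewrite decodeE.
Qed.

Lemma box_decode u : box bt 4 (decode u) = [forall i : 'I_4, qnth u i < qnth b i].
Proof.
apply/boxP/forallP => h i; last by rewrite decodeE h.
by have := h ((p^-1)%g i) (ltn_ord _); rewrite decodeE /bt permKV.
Qed.

Lemma mem_decode_box_deg k m :
  (m \in map decode (box_deg w b k)) = (wdeg wt m == k) && box bt 4 m.
Proof.
rewrite -{1}(encodeK m) (mem_map (can_inj decodeK)) mem_box_deg.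
by rewrite -wdeg_decode -box_decode encodeK.
Qed.

Hypothesis b_pos : forall i : 'I_4, 0 < qnth b i.

Lemma qnth_pred i : qnth (qpred b) i = (qnth b i).-1.
Proof. by case: b => [[[b0 b1] b2] b3]; case: i => [|[|[|[|i]]]] //=; rewrite nth_nil. Qed.

Lemma box_qle u : box bt 4 (decode u) = qle u (qpred b).
Proof.
rewrite box_decode; apply/forallP/qleP => h i; have := h i; rewrite qnth_pred;
by rewrite -[X in _ < X]prednK ?ltnS.
Qed.

Section Soundness.
Variables (d : nat) (verts : seq quad) (r0 r1 : quad).
Hypothesis verts_deg : forall u, u \in verts -> wdeg wt (decode u) = d.

Definition root_mnm m := decode (qroot r0 r1 (encode m)).

Local Notation gd := (good d (wdeg wt) bt (decode (qpred b)) root_mnm).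
Local Notation derivable := (derivable (qpred b) verts r0 r1).

Lemma root_rule_good u v mu :
  (if qeq (qadd u mu) (qpred b) then qeq u (qroot r0 r1 v) else false) ->
  gd (decode u) (decode v) (decode mu).
Proof.
case: qeqP => // e /qeqP eu.
have -> : decode mu = (decode (qpred b) - decode u)%MM.
  by rewrite -e decodeD addmC addmK.
have -> : decode u = root_mnm (decode v) by rewrite /root_mnm decodeK -eu.
exact: good_root.
Qed.

(* [qsub (qadd u mu) (qpred b)] is the excess of u + mu over the corner of the box. *)
Lemma excess_good u v mu k : qle k mu -> ~~ qle (qsub (qadd u mu) (qpred b)) k ->
  gd (decode v) (decode k) (decode u + (decode mu - decode k))%MM.
Proof.
move=> hk he; apply: good_out; rewrite -decodeB -decodeD box_qle.
apply: contra he => /qleP h; apply/qleP => i; have := h i; move/qleP/(_ i): hk.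
rewrite !(qnth_add, qnth_sub); lia.
Qed.

Lemma step_good u v mu k : k \in verts -> qle k mu ->
  gd (decode v) (decode k) (decode u + (decode mu - decode k))%MM ->
  gd (decode u) (decode k) (decode v + (decode mu - decode k))%MM ->
  gd (decode u) (decode v) (decode mu).
Proof.
move=> kv hk h1 h2.
have -> : decode mu = (decode k + (decode mu - decode k))%MM.
  by rewrite addmC submK // decode_le.
by apply: good_step (verts_deg kv) h1 _; apply: good_sym.
Qed.

Lemma derivable_good fuel u v mu : derivable fuel u v mu ->
  gd (decode u) (decode v) (decode mu).
Proof.
elim: fuel u v mu => [|fuel IH] u v mu /=; case: qeqP => // _.
  case: ifP => [/root_rule_good //|_].
  by case: ifP => [/root_rule_good /good_sym //|].
case: ifP => [/root_rule_good //|_].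
case: ifP => [/root_rule_good /good_sym //|_].
rewrite qhasE => /hasP[k kv]; case: ifP => // hk.
have subE x : decode (qsub (qadd x mu) k) = (decode x + (decode mu - decode k))%MM.
  rewrite -decodeB -decodeD; congr decode; apply: qnth_inj => i; move/qleP/(_ i): hk.
  by rewrite !(qnth_sub, qnth_add) => /addnBA ->.
case: ifP => // h1 h2; apply: (step_good kv hk).
  by move: h1; case: ifP => [_ /IH|/negbT he _]; [rewrite subE|exact: excess_good].
move: h2; case: ifP => [_ /IH|/negbT he _]; last exact: excess_good.
by rewrite subE; exact: good_sym.
Qed.

Lemma has2P s t : has2 s t -> exists2 i, i < minn (size s) (size t) & nth false s i && nth false t i.
Proof.
elim: s t => [|x s IH] [|z t] //=; case: ifP => [|_ /IH[i hi e]].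
  by case: x z => [] // [] // _ _; exists 0; rewrite ?minnSS.
by exists i.+1; rewrite ?minnSS.
Qed.

Lemma mu_check_good mu u v : mu_check (qpred b) verts r0 r1 mu ->
  u \in verts -> v \in verts -> gd (decode u) (decode v) (decode mu).
Proof.
rewrite /mu_check; set ks := [seq k <- _ | _]; move=> hmu hu hv.
have ok x z : pair_check (qpred b) verts r0 r1 mu
    (x, excess_mask (qpred b) mu ks x) (z, excess_mask (qpred b) mu ks z) ->
    gd (decode x) (decode z) (decode mu).
  rewrite /pair_check; case: ifP => [h|_]; last first.
    by case: ifP => [h2 _|_ h2]; exact: (derivable_good h2).
  have [i hi] := has2P h; move: hi; rewrite /excess_mask !size_map minnn => hi.
  rewrite !(nth_map (0, 0, 0, 0)) // => /andP[hx hz] _.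
  have := mem_nth (0, 0, 0, 0) hi; rewrite mem_filter => /andP[hk kv].
  by apply: (step_good kv hk); apply: excess_good.
have [->|neq] := eqVneq u v; first exact: good_diag.
move/(pairwiseP (mu, [::])): hmu => hmu.
have sz x : x \in verts -> index x verts < size [seq (u, excess_mask (qpred b) mu ks u) | u <- verts].
  by rewrite size_map index_mem.
have nthE x : x \in verts -> nth (mu, [::]) [seq (u, excess_mask (qpred b) mu ks u) | u <- verts]
    (index x verts) = (x, excess_mask (qpred b) mu ks x).
  by move=> hx; rewrite (nth_map mu) ?index_mem // nth_index.
have [lt|lt|/index_inj e] := ltngtP (index u verts) (index v verts).
- by apply: ok; rewrite -!nthE //; apply: hmu; rewrite ?inE ?sz.
- by apply/good_sym/ok; rewrite -!nthE //; apply: hmu; rewrite ?inE ?sz.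
by rewrite e ?eqxx in neq.
Qed.

End Soundness.
End Decode.

(** * Hilbert function of the ring from that of its artinian quotient *)

Section Relaxation.
Variables (n : nat) (w b : 'I_n -> nat) (d : nat).
Hypothesis d_pos : (0 < d)%N.
Hypothesis wb : forall i, (w i * b i = d)%N.

Lemma wdeg_vpow i : wdeg w (vpow b i) = d.
Proof.
rewrite /wdeg (bigD1 i) //= vpowE eqxx wb big1 ?addn0 // => k /negbTE ne.
by rewrite vpowE eq_sym ne muln0.
Qed.

(* Lifting the bound on one variable: a monomial either satisfies it or is
   divisible by y. *)
Fixpoint relax (f : nat -> seq 'X_{1..n}) (y : 'X_{1..n}) (k : nat) : seq 'X_{1..n} :=
  f k ++ (if k is k'.+1 then [seq (m + y)%MM | m <- relax f y k'] else [::]).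

Definition lists j (f : nat -> seq 'X_{1..n}) := forall k,
  uniq (f k) /\ forall m, (m \in f k) = (wdeg w m == (k * d)%N) && box b j m.

Lemma relax_lists (i : 'I_n) f : lists i.+1 f -> lists i (relax f (vpow b i)).
Proof.
move=> hf k; elim: k => [|k [IHu IHm]].
  have [fu fm] := hf 0; rewrite /= cats0; split=> [|m]; first exact: fu.
  rewrite fm mul0n; case: eqP => //= e; apply/boxP/boxP => h l li.
    by apply: h; rewrite ltnS ltnW.
  move: (li); rewrite ltnS leq_eqVlt => /orP[/eqP /val_inj el|]; last exact: h.
  rewrite el; have : (vpow b i <= m)%MM = false.
    apply/negP => le; have := wdegD w (m - vpow b i)%MM (vpow b i).
    rewrite submK // e wdeg_vpow; lia.
  by rewrite vpow_le ltnNge => ->.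
have [fuS fmS] := hf k.+1; rewrite [relax _ _ _]/=; split=> [|m].
  rewrite cat_uniq fuS map_inj_uniq ?IHu ?andbT //=; last by move=> x z /addIm.
  apply/hasPn => _ /mapP[m _ ->]; rewrite /= fmS negb_and; apply/orP; right.
  by apply/boxP => /(_ i (ltnSn _)); rewrite mnmDE vpowE eqxx ltnNge leq_addl.
rewrite mem_cat fmS; case: (leqP (b i) (m i)) => [le|lt].
  have -> : box b i.+1 m = false.
    by apply/negbTE/boxP => /(_ i (ltnSn _)); rewrite ltnNge le.
  rewrite andbF orFb -{1 2}[m](submK (m := vpow b i)) ?vpow_le //.
  rewrite (mem_map (@addIm _ _)) IHm wdegD wdeg_vpow mulSnr eqn_add2r.
  congr (_ && _); apply/boxP/boxP => h l li; have := h l li;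
  by rewrite mnmBE vpowE; case: eqP => [e|_]; [rewrite -e ltnn in li | rewrite subn0].
have -> : box b i.+1 m = box b i m.
  apply/boxP/boxP => h l li; first by apply: h; rewrite ltnS ltnW.
  by move: li; rewrite ltnS leq_eqVlt => /orP[/eqP /val_inj -> //|]; exact: h.
rewrite orbC; case: mapP => // -[m' _ e]; move: lt; rewrite e mnmDE vpowE eqxx.
by rewrite ltnNge leq_addl.
Qed.

(** Relaxing one bound multiplies the Hilbert series by 1 / (1 - t). *)
Lemma size_relax f y k : size (relax f y k) = (\sum_(0 <= i < k.+1) size (f i))%N.
Proof.
elim: k => [|k IH]; first by rewrite /= cats0 big_nat1.
by rewrite big_nat_recr //= size_cat size_map IH addnC.
Qed.

End Relaxation.

(** All that the algebra needs to know about one choice of weights. In [wd_size] stands the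
    coefficient of t^k in (1 + N t + N t^2 + t^3) / (1 - t)^4, multiplied by 6 to remain in
    [nat]. *)
Record weight_data (w b : 'I_4 -> nat) (d N : nat) (mons : nat -> seq 'X_{1..4})
    (sigma : 'X_{1..4}) (root : 'X_{1..4} -> 'X_{1..4}) : Prop := WeightData {
  wd_pos : (0 < d)%N;
  wd_sum : d = (\sum_i w i)%N;
  wd_wb : forall i, (w i * b i)%N = d;
  wd_uniq : forall k, uniq (mons k);
  wd_mem : forall k m, (m \in mons k) = (wdeg w m == (k * d)%N);
  wd_size : forall k, (6 * size (mons k)
      = N.+1 * (k * k.+1 * k.*2.+1) + 12 * k + 6)%N;
  wd_div : forall q mu, wdeg w mu = (q.+1 * d)%N ->
      exists2 m, m \in mons 1 & (m <= mu)%MM;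
  wd_root_deg : forall u, wdeg w (root u) = d;
  wd_root_neq : forall u, root u != u;
  wd_root_le : forall u, (root u <= sigma)%MM;
  wd_sigma : box b 4 sigma;
  wd_good : forall u v mu q, wdeg w u = d -> wdeg w v = d ->
      wdeg w mu = (q.+2 * d)%N -> good d (wdeg w) b sigma root u v mu }.

Section Row.
Local Open Scope nat_scope.
Variables (p : 'S_4) (wq bq : quad) (d N : nat).
Hypothesis row : row_check wq bq d N.
Let w (i : 'I_4) := qnth wq (p i).
Let b (i : 'I_4) := qnth bq (p i).
Let B k := map (decode p) (box_deg wq bq (k * d)).

Let B1 := box_deg wq bq d.
Let verts := rev (B1 ++ corner bq).
Let r0 := nth (0, 0, 0, 0) B1 0.
Let r1 := nth (0, 0, 0, 0) B1 1.

Lemma row_checkP :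
  [/\ 0 < d, forall i : 'I_4, qnth wq i * qnth bq i = d, d = \sum_(i < 4) qnth wq i
    & [/\ 1 < N, size B1 = N, size (box_deg wq bq (2 * d)) = N
        & size (box_deg wq bq (3 * d)) = 1]] /\
  [/\ r0 != r1,
      {in box_deg wq bq (2 * d) ++ box_deg wq bq (3 * d), forall mu,
        exists2 k, k \in B1 & qle k mu}
    & {in box_deg wq bq (2 * d) ++ box_deg wq bq (3 * d), forall mu,
        mu_check (qpred bq) verts r0 r1 mu}].
Proof.
move: row; rewrite /row_check /verts /r0 /r1 /B1.
case: wq bq => [[[w0 w1] w2] w3] [[[b0 b1] b2] b3].
case/and5P => /and5P[d0 /eqP e0 /eqP e1 /eqP e2 /eqP e3] /eqP es.
case/and4P => N1 /eqP s1 /eqP s2 /eqP s3 ne /andP[/allP hdiv /allP hgood].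
split; split=> //; first by case=> [[|[|[|[|i]]]]].
- by rewrite !big_ord_recr big_ord0.
- by apply: contraNneq ne => ->; apply/qeqP.
- by move=> mu /hdiv /hasP.
Qed.

Lemma row_wb i : w i * b i = d.
Proof. by have [[_ h _ _] _] := row_checkP; exact: h. Qed.

Lemma row_bq_pos (i : 'I_4) : 0 < qnth bq i.
Proof.
have [[d0 h _ _] _] := row_checkP.
by move: d0; rewrite -(h i) muln_gt0 => /andP[].
Qed.

Lemma row_mem_B k m : (m \in B k) = (wdeg w m == k * d) && box b 4 m.
Proof. exact: mem_decode_box_deg. Qed.

Lemma row_uniq_B k : uniq (B k).
Proof.
by rewrite (map_inj_uniq (can_inj (decodeK p))) filter_uniq // uniq_quads_below.
Qed.

Lemma row_sum_w : d = \sum_i w i.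
Proof.
have [[_ _ -> _] _] := row_checkP.
by rewrite (reindex_inj (@perm_inj _ p)).
Qed.

(** Raising every exponent by one adds d, the sum of the weights, and still leaves the i-th exponent
    at most b_i, for a total of at most 4d. *)
Lemma row_box_deg m : box b 4 m -> wdeg w m <= 3 * d.
Proof.
move/boxP => hm; have : wdeg w m + d <= 4 * d; last by lia.
have -> : 4 * d = \sum_(i < 4) w i * b i.
  by under eq_bigr => i _ do rewrite row_wb; rewrite sum_nat_const card_ord.
rewrite {1}row_sum_w /wdeg -big_split; apply: leq_sum => i _ /=.
by rewrite -mulnSr leq_mul2l hm ?orbT.
Qed.

Lemma row_w_pos i : 0 < w i.
Proof.
have [[d0 _ _ _] _] := row_checkP.
by move: d0; rewrite -(row_wb i) muln_gt0 => /andP[].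
Qed.

Lemma row_wdeg_eq0 m : wdeg w m = 0 -> m = 0%MM.
Proof.
move/eqP; rewrite sum_nat_eq0 => /forallP h; apply/mnmP => i; rewrite mnm0E.
by have /implyP/(_ isT) := h i; rewrite muln_eq0 gtn_eqF ?row_w_pos //= => /eqP.
Qed.

Lemma row_size_B k : size (B k) = nth 0 [:: 1; N; N; 1] k.
Proof.
have [[d0 _ _ [_ s1 s2 s3]] _] := row_checkP.
case: k => [|[|[|[|k]]]]; last first.
- rewrite /= nth_nil; case E: (B k.+4) => [//|m s].
  have : m \in B k.+4 by rewrite E mem_head.
  rewrite row_mem_B => /andP[/eqP e /row_box_deg]; rewrite e leq_mul2r.
  by rewrite gtn_eqF.
- by rewrite size_map.
- by rewrite size_map.
- by rewrite size_map mul1n.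
rewrite (perm_size (uniq_perm (row_uniq_B 0) (_ : uniq [:: 0%MM]) _)) // => m.
rewrite row_mem_B inE mul0n; apply/andP/eqP => [[/eqP /row_wdeg_eq0 -> //]|->].
by rewrite wdeg0; split=> //; apply/boxP => i _; rewrite mnm0E row_bq_pos.
Qed.

Let y (i : nat) := vpow b (inord i).
Definition row_monos := relax (relax (relax (relax B (y 3)) (y 2)) (y 1)) (y 0).

Lemma row_monos_lists : lists w b d 0 row_monos.
Proof.
have [[d0 _ _ _] _] := row_checkP.
have step i f : i < 4 -> lists w b d i.+1 f -> lists w b d i (relax f (y i)).
  by move=> hi; rewrite -{1 2}(inordK hi); apply: relax_lists => //; exact: row_wb.
do 4!apply/step => //; move=> k; split; first exact: row_uniq_B.
exact: row_mem_B.
Qed.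

Lemma row_monos_size k :
  6 * size (row_monos k) = N.+1 * (k * k.+1 * k.*2.+1) + 12 * k + 6.
Proof.
have s3 l : size (relax B (y 3) l) = nth (2 * N + 2) [:: 1; N.+1; (2 * N).+1] l.
  rewrite size_relax; elim: l => [|l IH]; first by rewrite big_nat1 row_size_B.
  rewrite big_nat_recr // IH row_size_B.
  by case: l {IH} => [|[|[|[|l]]]]; rewrite /= ?nth_nil; lia.
(* The summand on the left replaces a subtraction in the closed form. *)
have s2 l : size (relax (relax B (y 3)) (y 2) l) + (1 < l) * N.+1
    = if l is 0 then 1 else if l is 1 then N.+2 else (2 * N + 2) * l.
  rewrite size_relax; elim: l => [|l IH]; first by rewrite big_nat1 s3.
  by rewrite big_nat_recr // s3; case: l IH => [|[|l]] /=; rewrite ?nth_nil; lia.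
have s1 l : size (relax (relax (relax B (y 3)) (y 2)) (y 1) l)
    = if l is 0 then 1 else N.+1 * (l * l) + 2.
  rewrite size_relax; elim: l => [|l IH].
    by rewrite big_nat1; have := s2 0; move: (size _) => z /=; lia.
  rewrite big_nat_recr // IH; have := s2 l.+1; move: (size _) => z.
  by case: l {IH} => [|l] /=; nia.
rewrite size_relax; elim: k => [|k IH]; first by rewrite big_nat1 s1; lia.
by rewrite big_nat_recr // mulnDr IH s1; nia.
Qed.

Lemma row_weight_data : weight_data w b d N row_monos (decode p (qpred bq))
  (root_mnm p r0 r1).
Proof.
have [[d0 _ _ [N1 s1 _ _]] [ne hdiv hgood]] := row_checkP.
have monos_mem k m : (m \in row_monos k) = (wdeg w m == k * d).
  have [_ ->] := row_monos_lists k; rewrite -[RHS]andbT; congr (_ && _).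
  exact/boxP.
have in_B1 u : u \in B1 -> wdeg w (decode p u) = d /\ qle u (qpred bq).
  move=> hu; have : decode p u \in B 1.
    by rewrite /B mul1n (mem_map (can_inj (decodeK p))).
  rewrite row_mem_B mul1n => /andP[/eqP -> hb]; split=> //.
  by rewrite -(box_qle p) //; exact: row_bq_pos.
have r0B : r0 \in B1 by rewrite mem_nth // s1 ltnW.
have r1B : r1 \in B1 by rewrite mem_nth // s1.
have rootB u : qroot r0 r1 u \in B1 by rewrite /qroot; case: ifP.
have corner_deg u : u \in corner bq -> exists i, decode p u = vpow b i.
  move=> hu; have [j hj] : exists j : 'I_4, forall i : 'I_4,
      qnth u i = if j == i then qnth bq j else 0.
    move: hu; case: bq => [[[b0 b1] b2] b3]; rewrite !inE => /or4P[] /eqP ->;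
    [exists (@Ordinal 4 0 isT)|exists (@Ordinal 4 1 isT)
    |exists (@Ordinal 4 2 isT)|exists (@Ordinal 4 3 isT)];
    by case=> [[|[|[|[|i]]]]].
  exists ((p^-1)%g j); apply/mnmP => i; rewrite decodeE hj vpowE /b permKV.
  by rewrite -(inj_eq (@perm_inj _ p) _ i) permKV.
have verts_deg u : u \in verts -> wdeg w (decode p u) = d.
  rewrite mem_rev mem_cat => /orP[/in_B1[] //|/corner_deg[i ->]].
  by apply: wdeg_vpow; exact: row_wb.
have mem_verts u : wdeg w u = d -> encode p u \in verts.
  move=> hu; have [hb|nb] := boolP (box b 4 u).
    have : u \in B 1 by rewrite row_mem_B mul1n hu eqxx.
    rewrite /B mul1n -{1}(encodeK p u) (mem_map (can_inj (decodeK p))) mem_rev mem_cat.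
    by move=> ->.
  have [i hi] : exists i, b i <= u i.
    have : ~~ [forall i : 'I_4, u i < b i] by apply: contra nb => /forallP h; apply/boxP.
    by rewrite negb_forall => /existsP [] i; rewrite -leqNgt; exists i.
  have le : (vpow b i <= u)%MM by rewrite vpow_le.
  (* Both monomials have degree d, so the divisibility is an equality. *)
  have eu : u = vpow b i.
    rewrite -(submK le) [X in (X + _)%MM]row_wdeg_eq0 ?add0m //; apply/eqP.
    by rewrite -(eqn_add2r d) -{1}(wdeg_vpow row_wb i) -wdegD submK // hu.
  have [c hc cE] : exists2 c, c \in corner bq &
      forall k : 'I_4, qnth c k = if p i == k then qnth bq (p i) else 0.
    move: (p i) => j; case: bq => [[[b0 b1] b2] b3].
    case: j => [[|[|[|[|j]]]] hj] //;
    [exists (b0, 0, 0, 0)|exists (0, b1, 0, 0)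
    |exists (0, 0, b2, 0)|exists (0, 0, 0, b3)]; rewrite ?inE ?eqxx ?orbT //;
    by case=> [[|[|[|[|k]]]]].
  suff -> : encode p u = c by rewrite mem_rev mem_cat hc orbT.
  apply: qnth_inj => k; rewrite qnth_encode eu vpowE cE /b.
  by rewrite (canF_eq (permK p)).
have box23 q mu : wdeg w mu = q.+2 * d -> box b 4 mu ->
    encode p mu \in box_deg wq bq (2 * d) ++ box_deg wq bq (3 * d).
  move=> hmu hb; rewrite mem_cat -!(mem_map (can_inj (decodeK p))) !encodeK.
  rewrite !mem_decode_box_deg -/w -/b hb !andbT hmu.
  have := row_box_deg hb; rewrite hmu leq_mul2r gtn_eqF //= !ltnS.
  by case: q {hmu} => [|[|q]] //; rewrite eqxx ?orbT.
have nbox mu : ~~ box b 4 mu -> exists i, (vpow b i <= mu)%MM.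
  move=> nb; have : ~~ [forall i : 'I_4, mu i < b i].
    by apply: contra nb => /forallP h; apply/boxP.
  by rewrite negb_forall => /existsP [] i; rewrite -leqNgt -vpow_le; exists i.
split=> //; try exact: row_wb.
- exact: row_sum_w.
- by move=> k; have [] := row_monos_lists k.
- exact: row_monos_size.
- move=> [|q] mu hmu; first by exists mu; rewrite ?monos_mem ?hmu // lepm_refl.
  have [hb|/nbox[i le]] := boolP (box b 4 mu); last first.
    by exists (vpow b i) => //; rewrite monos_mem mul1n (wdeg_vpow row_wb).
  have [k hk le] := hdiv _ (box23 q mu hmu hb).
  exists (decode p k); first by rewrite monos_mem mul1n (in_B1 _ hk).1.
  by rewrite -[mu](encodeK p) decode_le.
- by move=> u; have [] := in_B1 _ (rootB (encode p u)).
- move=> u; apply/eqP => e; have := decodeK p (qroot r0 r1 (encode p u)).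
  rewrite -/(root_mnm p r0 r1 u) e /qroot; case: qeqP => [-> e1|ne1 e1].
    by rewrite e1 eqxx in ne.
  by rewrite e1 in ne1.
- by move=> u; rewrite /root_mnm decode_le; have [] := in_B1 _ (rootB (encode p u)).
- by rewrite (box_qle p) //; [apply/qleP | exact: row_bq_pos].
move=> u v mu q hu hv hmu; have [hb|nb] := boolP (box b 4 mu); last exact: good_out.
have h := hgood _ (box23 q mu hmu hb).
have := mu_check_good row_bq_pos verts_deg h (mem_verts u hu) (mem_verts v hv).
by rewrite !encodeK.
Qed.

End Row.

(** * The fourteen weights *)

(** The rows are (w, b, d, N) with d the sum of the weights, b_i = d / w_i, and N the number of
    monomials of degree d in the box. *)
Definition gorenstein_rows : seq (quad * quad * nat * nat) := [::
  ((1, 1, 1, 3), (6, 6, 6, 2), 6, 35);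
  ((1, 1, 4, 6), (12, 12, 3, 2), 12, 35);
  ((1, 2, 2, 5), (10, 5, 5, 2), 10, 24);
  ((1, 1, 1, 1), (4, 4, 4, 4), 4, 31);
  ((1, 1, 2, 4), (8, 8, 4, 2), 8, 31);
  ((1, 3, 4, 4), (12, 4, 3, 3), 12, 17);
  ((1, 1, 2, 2), (6, 6, 3, 3), 6, 26);
  ((1, 2, 6, 9), (18, 9, 3, 2), 18, 26);
  ((2, 3, 3, 4), (6, 4, 4, 3), 12, 11);
  ((1, 4, 5, 10), (20, 5, 4, 2), 20, 19);
  ((1, 2, 3, 6), (12, 6, 4, 2), 12, 23);
  ((1, 3, 8, 12), (24, 8, 3, 2), 24, 23);
  ((2, 3, 10, 15), (15, 10, 3, 2), 30, 14);
  ((1, 6, 14, 21), (42, 7, 3, 2), 42, 20)]%N.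

Lemma gorenstein_rows_check :
  all (fun r : quad * quad * nat * nat => let: (w, b, d, N) := r in row_check w b d N)
    gorenstein_rows.
Proof. by vm_compute. Qed.

Definition quad_seq (u : quad) : seq nat := let: (u0, u1, u2, u3) := u in [:: u0; u1; u2; u3].

Section UnitFractions.
Local Open Scope nat_scope.

(* The decompositions 1 = 1/c0 + 1/c1 + 1/c2 + 1/c3 with c0 >= c1 >= c2 >= c3. *)
Definition unit_fraction_search : bool :=
  all (fun c3 => all (fun c2 => all (fun c1 =>
    let e := c1 * c2 * c3 - (c2 * c3 + c1 * c3 + c1 * c2) in
    let c0 := c1 * c2 * c3 %/ e in
    if (0 < e) && (c3 <= c2 <= c1) && (c1 <= c0) && (c0 * e == c1 * c2 * c3) then
      has (fun r : quad * quad * nat * nat => r.1.1.2 == (c0, c1, c2, c3)) gorenstein_rows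
    else true)
  (iota 2 47)) (iota 2 5)) (iota 2 3).

Lemma unit_fraction_searchP : unit_fraction_search.
Proof. by vm_compute. Qed.

(** The largest of four fractions of sum 1 is at least 1/4, so c3 <= 4. The remaining ones are
    bounded likewise: c2 <= 3 c3 / (c3 - 1) <= 6 and c1 <= 2 c2 c3 / (c2 c3 - c2 - c3) <= 48. Then
    c0 is determined by the others. *)
Lemma unit_fractions c0 c1 c2 c3 :
  0 < c3 <= c2 -> c2 <= c1 <= c0 ->
  c1 * c2 * c3 + c0 * c2 * c3 + c0 * c1 * c3 + c0 * c1 * c2 = c0 * c1 * c2 * c3 ->
  exists w d N, (w, (c0, c1, c2, c3), d, N) \in gorenstein_rows.
Proof.
move=> /andP[p3 h32] /andP[h21 h10] e.
have p2 := leq_trans p3 h32; have p1 := leq_trans p2 h21; have p0 := leq_trans p1 h10.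
have b3 : 2 <= c3 <= 4.
  apply/andP; split; first by rewrite ltn_neqAle p3 andbT; apply/eqP => z; subst c3; nia.
  rewrite leqNgt; apply/negP => h.
  have : 4 * (c0 * c1 * c2) < c3 * (c0 * c1 * c2) by rewrite ltn_pmul2r ?muln_gt0 ?p0 ?p1.
  suff : c3 * (c0 * c1 * c2) <= 4 * (c0 * c1 * c2) by lia.
  have : c1 * c2 * c3 <= c1 * c2 * c0 by rewrite leq_mul2l (leq_trans h32) ?orbT // (leq_trans h21).
  have : c0 * c2 * c3 <= c0 * c2 * c1 by rewrite leq_mul2l (leq_trans h32) ?orbT.
  have : c0 * c1 * c3 <= c0 * c1 * c2 by rewrite leq_mul2l h32 orbT.
  lia.
have b2 : 2 <= c2 <= 6.
  apply/andP; split; first by case/andP: b3; lia.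
  rewrite leqNgt; apply/negP => h.
  have h1 : c0 * c1 * c2 * (c3 - 1) <= 3 * (c0 * c1 * c3).
    have : c1 * c2 * c3 <= c1 * c0 * c3 by rewrite leq_mul2r leq_mul2l (leq_trans h21) ?orbT.
    have : c0 * c2 * c3 <= c0 * c1 * c3 by rewrite leq_mul2r leq_mul2l h21 !orbT.
    rewrite mulnBr muln1; lia.
  have : c2 * (c3 - 1) <= 3 * c3.
    rewrite -(leq_pmul2l (m := c0 * c1)) ?muln_gt0 ?p0 //.
    by move: h1; congr (_ <= _); lia.
  by case/andP: b3 => b3 _; nia.
have b1 : c1 * (c2 * c3 - c2 - c3) <= 2 * (c2 * c3).
  rewrite -(leq_pmul2l (m := c0)) //.
  have : c1 * c2 * c3 <= c0 * c2 * c3 by rewrite !leq_mul2r h10 !orbT.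
  rewrite !mulnBr; lia.
have pe : c2 + c3 < c2 * c3.
  rewrite -(ltn_pmul2l (m := c0 * c1)) ?muln_gt0 ?p0 //.
  have : 0 < c1 * c2 * c3 by rewrite !muln_gt0 p1 p2.
  rewrite mulnDr; lia.
have b1' : 2 <= c1 <= 48.
  case/andP: b3 b2 => b3 b3' /andP[b2 b2']; apply/andP; split; first exact: leq_trans h21.
  have : c1 * 1 <= c1 * (c2 * c3 - c2 - c3) by rewrite leq_mul2l; lia.
  have : c2 * c3 <= 6 * 4 by apply: leq_mul.
  lia.
have ee : c0 * (c1 * c2 * c3 - (c2 * c3 + c1 * c3 + c1 * c2)) = c1 * c2 * c3.
  by rewrite mulnBr !mulnDr; lia.
have e0 : 0 < c1 * c2 * c3 - (c2 * c3 + c1 * c3 + c1 * c2).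
  have : 0 < c1 * c2 * c3 by rewrite !muln_gt0 p1 p2.
  by rewrite -{1}ee muln_gt0 => /andP[].
have := unit_fraction_searchP; rewrite /unit_fraction_search.
move=> /allP/(_ c3); rewrite mem_iota => /(_ b3).
move=> /allP/(_ c2); rewrite mem_iota => /(_ b2).
move=> /allP/(_ c1); rewrite mem_iota => /(_ b1').
have qe : c1 * c2 * c3 %/ (c1 * c2 * c3 - (c2 * c3 + c1 * c3 + c1 * c2)) = c0.
  by rewrite -[X in X %/ _]ee mulnK.
rewrite qe; case: ifP; last by rewrite e0 h32 h21 h10 ee eqxx.
by move=> _ /hasP [[[[w c] d] N] hr /eqP /= e4]; exists w, d, N; rewrite -e4.
Qed.

(** The quotients d / x_i decompose 1 into unit fractions. They determine the weights up to a common
    factor, and both the x_i and the weights of the row have no common divisor. *)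
Lemma unit_fraction_weights x0 x1 x2 x3 :
  (forall t, t %| x0 -> t %| x1 -> t %| x2 -> t %| x3 -> t = 1) ->
  0 < x0 -> x0 <= x1 <= x2 -> x2 <= x3 ->
  [/\ x0 %| x0 + x1 + x2 + x3, x1 %| x0 + x1 + x2 + x3, x2 %| x0 + x1 + x2 + x3
    & x3 %| x0 + x1 + x2 + x3] ->
  exists b d N, ((x0, x1, x2, x3), b, d, N) \in gorenstein_rows.
Proof.
set d := x0 + x1 + x2 + x3 => cop p0 /andP[h01 h12] h23.
have p1 := leq_trans p0 h01; have p2 := leq_trans p1 h12; have p3 := leq_trans p2 h23.
have pd : 0 < d by rewrite /d !addn_gt0 p0.
case=> /dvdnP [c0 e0] /dvdnP [c1 e1] /dvdnP [c2 e2] /dvdnP [c3 e3].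
have q0 : 0 < c0 by move: pd; rewrite e0 muln_gt0 => /andP[].
have q1 : 0 < c1 by move: pd; rewrite e1 muln_gt0 => /andP[].
have q2 : 0 < c2 by move: pd; rewrite e2 muln_gt0 => /andP[].
have q3 : 0 < c3 by move: pd; rewrite e3 muln_gt0 => /andP[].
have mono x z c c' : 0 < z -> z <= x -> d = c * x -> d = c' * z -> c <= c'.
  move=> pz le e e'; rewrite -(leq_pmul2r pz) -e' e; exact: leq_mul.
have [|||w [D [N hr]]] := @unit_fractions c0 c1 c2 c3.
- by rewrite q3 (mono _ _ _ _ p2 h23 e3 e2).
- by rewrite (mono _ _ _ _ p1 h12 e2 e1) (mono _ _ _ _ p0 h01 e1 e0).
- apply/eqP; rewrite -(eqn_pmul2l pd); apply/eqP.
  have -> : d * (c0 * c1 * c2 * c3) = x0 * (c0 * c1 * c2 * c3) + x1 * (c0 * c1 * c2 * c3)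
      + x2 * (c0 * c1 * c2 * c3) + x3 * (c0 * c1 * c2 * c3) by rewrite {1}/d !mulnDl.
  have m0 : d * (c1 * c2 * c3) = x0 * (c0 * c1 * c2 * c3) by rewrite e0; ring.
  have m1 : d * (c0 * c2 * c3) = x1 * (c0 * c1 * c2 * c3) by rewrite e1; ring.
  have m2 : d * (c0 * c1 * c3) = x2 * (c0 * c1 * c2 * c3) by rewrite e2; ring.
  have m3 : d * (c0 * c1 * c2) = x3 * (c0 * c1 * c2 * c3) by rewrite e3; ring.
  by rewrite !mulnDr m0 m1 m2 m3.
have hw : [/\ D %| gcdn w.1.1.1 (gcdn w.1.1.2 (gcdn w.1.2 w.2)) * D,
   gcdn w.1.1.1 (gcdn w.1.1.2 (gcdn w.1.2 w.2)) = 1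
  & [/\ w.1.1.1 * c0 = D, w.1.1.2 * c1 = D, w.1.2 * c2 = D & w.2 * c3 = D]].
  have /allP/(_ _ hr) : all (fun r : quad * quad * nat * nat =>
    let: (w0, w1, w2, w3, (b0, b1, b2, b3), D, _) := r in
    [&& gcdn w0 (gcdn w1 (gcdn w2 w3)) == 1, w0 * b0 == D, w1 * b1 == D,
      w2 * b2 == D & w3 * b3 == D]) gorenstein_rows by vm_compute.
  case: w hr => [[[w0 w1] w2] w3] hr /= /and5P[/eqP g /eqP f0 /eqP f1 /eqP f2 /eqP f3].
  by rewrite g mul1n dvdnn.
case: w hr hw => [[[w0 w1] w2] w3] hr /= [_ g [f0 f1 f2 f3]].
have cross x wi c : d = c * x -> wi * c = D -> x * D = d * wi by move=> -> <-; ring.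
have k0 := cross _ _ _ e0 f0; have k1 := cross _ _ _ e1 f1.
have k2 := cross _ _ _ e2 f2; have k3 := cross _ _ _ e3 f3.
(* [D] divides every d w_i = x_i D, and the w_i have greatest common divisor 1. *)
have Dd : D %| d.
  rewrite -[d]muln1 -g !muln_gcdr !dvdn_gcd -k0 -k1 -k2 -k3.
  by rewrite !dvdn_mull.
have [t dt] := dvdnP Dd.
have pD : 0 < D by move: pd; rewrite dt muln_gt0 => /andP[].
have xt x wi : x * D = d * wi -> x = t * wi.
  by rewrite dt => e; apply/eqP; rewrite -(eqn_pmul2r pD) e; apply/eqP; ring.
have t1 : t = 1.
  by apply: cop; rewrite ?(xt _ _ k0) ?(xt _ _ k1) ?(xt _ _ k2) ?(xt _ _ k3) dvdn_mulr.
exists (c0, c1, c2, c3), D, N.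
by rewrite (xt _ _ k0) (xt _ _ k1) (xt _ _ k2) (xt _ _ k3) t1 !mul1n.
Qed.

Lemma gorenstein_classification (a : 4.-tuple nat) :
  well_formed a -> (forall i, tnth a i %| anticanonical_twist a) ->
  exists w b d N, (w, b, d, N) \in gorenstein_rows /\ perm_eq a (quad_seq w).
Proof.
case=> apos agcd adiv; pose s := sort leq a.
have ps : perm_eq a s by rewrite perm_sym perm_sort.
have ss : sorted leq s by apply: sort_sorted leq_total _.
have cop t : (forall x, x \in s -> t %| x) -> t = 1.
  move=> h; apply/eqP; rewrite -dvdn1 -(agcd ord0); apply/dvdn_biggcdP => j _.
  by apply: h; rewrite -(perm_mem ps) mem_tnth.
have spos x : x \in s -> 0 < x.
  by rewrite -(perm_mem ps) => /tnthP [i ->].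
have sdiv x : x \in s -> x %| \sum_(z <- s) z.
  rewrite -(perm_big _ ps) -(perm_mem ps) => /tnthP [i ->].
  by rewrite big_tuple; exact: adiv.
have : size s = 4 by rewrite -(perm_size ps) size_tuple.
case: s ps ss cop spos sdiv => [|x0 [|x1 [|x2 [|x3 [|? ?]]]]] //.
move=> ps /and4P[h01 h12 h23 _] cop spos sdiv _.
have [|||||b [d [N hr]]] := @unit_fraction_weights x0 x1 x2 x3.
- move=> t t0 t1 t2 t3; apply: cop => x; rewrite !inE.
  by case/or4P => /eqP ->.
- by apply: spos; rewrite mem_head.
- by rewrite h01.
- by [].
- move: sdiv; rewrite !big_cons big_nil addn0 !addnA => sdiv.
  by split; apply: sdiv; rewrite !inE eqxx ?orbT.
by exists (x0, x1, x2, x3), b, d, N.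
Qed.

End UnitFractions.

(** * Points, twisting sheaves and global sections *)

Section PrimeIdeals.
Variable S : comNzRingType.

Definition avoiding_ideal (x : S) (P : S -> Prop) : Prop :=
  [/\ P 0, forall a b, P a -> P b -> P (a + b), forall r a, P a -> P (r * a)
    & forall k, ~ P (x ^+ k)].

(** An ideal maximal among those that avoid the powers of [x] is prime: if a and b lie outside, the
    ideal enlarged by either one contains a power of [x], and the product of these two powers shows
    that ab lies outside. *)
Lemma exists_prime_avoiding x (I : S -> Prop) : avoiding_ideal x I ->
  exists P : S -> Prop, [/\ avoiding_ideal x P, forall a, I a -> P a
    & forall a b, P (a * b) -> P a \/ P b].
Proof.
case=> I0 ID IM Ix.
(* The union with [I] makes the empty chain of sets admissible in Zorn's lemma. *)
pose Q (A : classical_sets.set S) := avoiding_ideal x (fun a => A a \/ I a).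
have [F hF chain|A [[A0 AD AM Ax] maxA]] := @classical_sets.Zorn_bigcup S Q.
  split=> [|a b|r a|k]; first by right.
  - case=> [[X FX Xa]|Ia] [[Y FY Yb]|Ib]; last by right; exact: ID.
    + have [XY|YX] := chain _ _ FX FY.
        have [_ D _ _] := hF _ FY.
        by case: (D a b (or_introl (XY _ Xa)) (or_introl Yb)) => h; [left; exists Y | right].
      have [_ D _ _] := hF _ FX.
      by case: (D a b (or_introl Xa) (or_introl (YX _ Yb))) => h; [left; exists X | right].
    + have [_ D _ _] := hF _ FX.
      by case: (D a b (or_introl Xa) (or_intror Ib)) => h; [left; exists X | right].
    + have [_ D _ _] := hF _ FY.
      by case: (D a b (or_intror Ia) (or_introl Yb)) => h; [left; exists Y | right].
  - case=> [[X FX Xa]|Ia]; last by right; exact: IM.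
    have [_ _ M _] := hF _ FX.
    by case: (M r a (or_introl Xa)) => h; [left; exists X | right].
  - case=> [[X FX Xk]|]; last exact: Ix.
    by have [_ _ _ h] := hF _ FX; apply: (h k); left.
pose P a := A a \/ I a.
have extend a : ~ P a -> exists k p r, P p /\ x ^+ k = p + r * a.
  move=> nPa; apply: boolp.contrapT => no.
  pose P' c := exists p r, P p /\ c = p + r * a.
  have PP' c : P c -> P' c by move=> Pc; exists c, 0; rewrite mul0r addr0.
  apply: (maxA P').
    split=> [c Ac|sub]; first by apply: PP'; left.
    apply: nPa; left; apply: sub; exists 0, 1; split; first exact: A0.
    by rewrite add0r mul1r.
  split=> [|c e|r c|k].
  - by left; apply: PP'.
  - move=> hc he; left.
    have {}hc : P' c by case: hc => // Ic; apply: PP'; right.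
    have {}he : P' e by case: he => // Ie; apply: PP'; right.
    have [p [r [Pp ->]]] := hc; have [p' [r' [Pp' ->]]] := he.
    by exists (p + p'), (r + r'); split; [exact: AD | rewrite mulrDl addrACA].
  - move=> hc; left; have {}hc : P' c by case: hc => // Ic; apply: PP'; right.
    have [p [r' [Pp ->]]] := hc; exists (r * p), (r * r').
    by split; [exact: AM | rewrite mulrDr mulrA].
  - by case=> [[p [r [Pp e]]]|/Ix //]; apply: no; exists k, p, r.
exists P; split=> [//|a Ia|a b Pab]; first by right.
apply: boolp.contrapT => /boolp.not_orP[/extend [k [p [r [Pp ek]]]] /extend [l [p' [r' [Pp' el]]]]].
apply: (Ax (k + l)%N); rewrite exprD ek el mulrDl; apply: (AD).
  by rewrite mulrC; apply: AM.
rewrite mulrDr; apply: AD; first exact: AM.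
have -> : r * a * (r' * b) = r * r' * (a * b) by ring.
exact: AM.
Qed.

End PrimeIdeals.

Section GlobalSections.
Variables (F : fieldType) (n : nat) (w : 'I_n -> nat).
Local Notation S := {mpoly F[n]}.
Local Notation K := {fraction {mpoly F[n]}}.

Lemma tofrac_inj : injective (@tofrac S).
Proof. by move=> x y /eqP; rewrite tofrac_eq => /eqP. Qed.

(** The elements with all their homogeneous components in a prime [P] form the largest homogeneous
    ideal inside [P]. It is again prime, and it contains [I] because [I] is closed under taking
    components. *)
Lemma exists_proj_point_avoiding (i : 'I_n) (I : S -> Prop) :
  avoiding_ideal 'X_i I -> (forall k f, I f -> I (pihomog (wdeg w) k f)) ->
  exists p : {pred S}, [/\ proj_point w p, 'X_i \notin p & forall f, I f -> f \in p].
Proof.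
move=> /exists_prime_avoiding [P [[P0 PD PM Px] IP prP]] hI.
have PS (T : Type) (r : seq T) (c : pred T) (G : T -> S) :
    (forall t, c t -> P (G t)) -> P (\sum_(t <- r | c t) G t).
  by move=> h; apply: big_ind.
pose p : {pred S} := fun f => boolp.asbool (forall k, P (pihomog (wdeg w) k f)).
have pE f : (f \in p) <-> forall k, P (pihomog (wdeg w) k f).
  by split=> [/boolp.asboolP|h] //; apply/boolp.asboolP.
have pP f : f \in p -> P f.
  move/pE => h; rewrite (pihomog_partitionE (leqnn (mmeasure (wdeg w) f))).
  exact: PS.
have Xnp : 'X_i \notin p by apply/negP => /pP h; apply: (Px 1%N); rewrite expr1.
have pM g f : f \in p -> g * f \in p.
  move/pE => hf; apply/pE => k.
  rewrite (pihomog_partitionE (leqnn (mmeasure (wdeg w) g))) mulr_suml raddf_sum /=.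
  apply: PS => j _; rewrite (pihomogMl _ _ (pihomogP _ _ _)); case: ifP => // _.
  exact: PM.
exists p; split=> //; last by move=> f If; apply/pE => k; apply/IP/hI.
split=> //; last by exists i.
- split; first by apply/pE => k; rewrite raddf0.
    by apply/negP => /pP h; apply: (Px 0).
  move=> a u v hu hv; apply/pE => k; rewrite raddfD /=; apply: PD.
    exact/(pE _).1/pM.
  exact/(pE _).1.
- (* the product of the top components outside P of two polynomials is outside P *)
  move=> u v; apply: contraTT; rewrite negb_or => /andP[nu nv].
  have top f : f \notin p -> exists k, ~ P (pihomog (wdeg w) k f)
      /\ forall j, (k < j)%N -> P (pihomog (wdeg w) j f).
    move=> nf; have [k0 hk0] : exists k, ~ P (pihomog (wdeg w) k f).
      by apply/boolp.existsNP => /pE; rewrite (negbTE nf).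
    have ex : exists k, boolp.asbool (~ P (pihomog (wdeg w) k f)) by exists k0; apply/boolp.asboolP.
    have bd k : boolp.asbool (~ P (pihomog (wdeg w) k f)) -> (k <= mmeasure (wdeg w) f)%N.
      move/boolp.asboolP => nP; rewrite leqNgt; apply/negP => lt; apply: nP.
      suff -> : pihomog (wdeg w) k f = 0 by [].
      apply/mpolyP => m; rewrite mcoeff_pihomog mcoeff0; case: eqP => // e.
      by apply/memN_msupp_eq0/(mmeasure_mnm_ge (mf := wdeg w)); rewrite e ltnW.
    case: (ex_maxnP ex bd) => k /boolp.asboolP nP maxk; exists k; split=> // j lt.
    apply: boolp.contrapT => nPj; have := maxk j; rewrite leqNgt lt => h.
    by have := h (introT (boolp.asboolP _) nPj).
  have [k [nPk hk]] := top u nu; have [l [nPl hl]] := top v nv.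
  apply/negP => /pE/(_ (k + l)%N) => Puv.
  suff : P (pihomog (wdeg w) k u * pihomog (wdeg w) l v) by case/prP.
  pose B := (mmeasure (wdeg w) u + k.+1)%N.
  have kB : (k < B)%N by rewrite /B addnS ltnS leq_addl.
  have : P (pihomog (wdeg w) (k + l) (u * v)
      - \sum_(j < B | j != Ordinal kB) pihomog (wdeg w) (k + l) (pihomog (wdeg w) j u * v)).
    rewrite -sumrN; apply: PD => //; apply: PS => j; rewrite -val_eqE /= => ne.
    rewrite (pihomogMl _ _ (pihomogP _ _ _)); case: ifP => [le|_]; last by rewrite oppr0.
    have [lt|lt|e] := ltngtP j k; last by rewrite e eqxx in ne.
      by rewrite -mulNr; apply/PM/hl; rewrite ltn_subRL ltn_add2r.
    by rewrite mulrC -mulNr; apply/PM/hk.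
  rewrite [in X in X - _](pihomog_partitionE (leq_addr k.+1 (mmeasure (wdeg w) u))).
  rewrite mulr_suml raddf_sum /= (bigD1 (Ordinal kB)) //= addrK.
  by rewrite (pihomogMl _ _ (pihomogP _ _ _)) leq_addr addKn.
- move=> k f /pE hf; apply/pE => j; rewrite wcompE.
  have [->|ne] := eqVneq j k; first by rewrite pihomog_id.
  by rewrite (pihomog_ne0 _ (pihomogP _ _ _)) // eq_sym.
Qed.

Lemma zero_proj_point (i : 'I_n) : proj_point w [pred f : S | f == 0].
Proof.
split.
- split; rewrite ?inE ?oner_eq0 // => a u v; rewrite !inE => /eqP -> /eqP ->.
  by rewrite mulr0 addr0.
- by move=> u v; rewrite !inE mulf_eq0.
- by move=> k f; rewrite !inE => /eqP ->; rewrite wcompE raddf0.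
- exists i; rewrite inE; apply/eqP => /(congr1 (mcoeff U_(i))).
  by rewrite mcoeffXU eqxx mcoeff0 => /eqP; rewrite oner_eq0.
Qed.

(** The denominators [D] of a section form a homogeneous ideal. It contains a power of each
    variable: otherwise some point would contain [D] and miss that variable, yet the section has a
    denominator outside that point. Powers of two different variables are coprime, so the section is
    a polynomial. *)
Lemma global_sectionP (i0 i1 : 'I_n) (m : nat) (z : K) : i0 != i1 ->
  global_section w m%:Z z <->
  exists2 u : S, u \is m.-homog for (wdeg w) & z = tofrac u.
Proof.
move=> ne01; split; last first.
  case=> u hu -> p [[p0 p1 _] _ _ _]; exists u, 1, m, 0%N; split=> //.
  - by rewrite whomogE; exact: dhomog1.
  - by rewrite subr0.
  - by rewrite rmorph1 divr1.
(* At the generic point, the zero ideal, the section is a quotient of homogeneous polynomials. *)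
move=> hz; have [f [g [i [j [hf hg g0 hij hzfg]]]]] := hz _ (zero_proj_point i0).
rewrite !whomogE in hf hg; rewrite inE in g0.
have F0 (h : S) : h != 0 -> tofrac h != 0 by rewrite tofrac_eq0.
pose D h := exists u : S, tofrac h * z = tofrac u.
have DE h u : tofrac h * z = tofrac u <-> h * f = u * g.
  rewrite hzfg mulrA; split=> [e|e].
    by apply: tofrac_inj; rewrite !rmorphM /= -e divfK ?F0.
  by apply: (mulIf (F0 _ g0)); rewrite divfK ?F0 // -!rmorphM e.
have Dhom k h : D h -> D (pihomog (wdeg w) k h).
  case=> u /DE e; exists (if (j <= k + i)%N then pihomog (wdeg w) (k + i - j) u else 0).
  apply/DE; have := congr1 (pihomog (wdeg w) (k + i)) e.
  rewrite (pihomogMr _ _ hf) leq_addl addnK (pihomogMr _ _ hg) => ->.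
  by case: ifP; rewrite ?mul0r.
have Dpow l : exists k, D ('X_l ^+ k).
  apply: boolp.contrapT => no.
  have [||p [pp Xp Dp]] := @exists_proj_point_avoiding l D.
  - split=> [|a b [u hu] [v hv]|r a [u hu]|k].
    + by exists 0; rewrite rmorph0 mul0r.
    + by exists (u + v); rewrite !rmorphD mulrDl /= hu hv.
    + by exists (r * u); rewrite !rmorphM -mulrA /= hu.
    + by move=> Dk; apply: no; exists k.
  - by move=> k h; exact: Dhom.
  have [f' [g' [i' [j' [_ _ g'p _ e]]]]] := hz _ pp.
  move: (g'p); rewrite Dp //; exists f'; rewrite e mulrC divfK // F0 //.
  by apply: contraNneq g'p => ->; case: pp => [[]].
have [k [u0 e0]] := Dpow i0; have [l [u1 e1]] := Dpow i1.
have e01 : 'X_[U_(i1) *+ l] * u0 = 'X_[U_(i0) *+ k] * u1.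
  rewrite -!mpolyXn; apply: tofrac_inj; rewrite !rmorphM /= -e0 -e1.
  by rewrite mulrCA.
pose a : 'X_{1..n} := (U_(i0) *+ k)%MM; pose c : 'X_{1..n} := (U_(i1) *+ l)%MM.
have u0E : u0 = 'X_[a] * divX a u0.
  apply/mpolyP => x; rewrite mcoeffXM mcoeff_divX; case: ifP => [le|nle].
    by rewrite submK.
  have -> : u0@_x = ('X_[c] * u0)@_(x + c) by rewrite mcoeffXM lem_addl addmK.
  rewrite e01 mcoeffXM; case: ifP => // le; move/negP: nle; case.
  apply/mnm_lepP => t; move/mnm_lepP/(_ t): le; rewrite mnmDE !mulmnE !mnm1E.
  case: (eqVneq i0 t) => [<-|_]; last by rewrite mul0n.
  by rewrite eq_sym (negbTE ne01) mul0n addn0.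
have X0 : tofrac ('X_[a] : S) != 0.
  by rewrite F0 // -msupp_eq0 msuppX.
have zE : z = tofrac (divX a u0).
  apply: (mulfI X0); transitivity (tofrac u0); first by rewrite -e0 mpolyXn.
  by rewrite {1}u0E rmorphM.
exists (divX a u0) => //; set u := divX a u0 in zE *.
have [->|u_neq0] := eqVneq u 0; first exact: rpred0.
have ug : u * g = f.
  have /DE : tofrac 1 * z = tofrac u by rewrite rmorph1 mul1r.
  by rewrite mul1r.
have [] := @dhomog_divr _ _ (wdeg w) i j u g; rewrite ?ug // => le hu.
suff -> : m = (i - j)%N by [].
by move: hij; lia.
Qed.

End GlobalSections.

(** * Integral closedness of polynomial rings *)

Section IntegrallyClosed.
Variables (F : fieldType) (n : nat).
Local Notation S := {mpoly F[n]}.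
Local Notation K := {fraction {mpoly F[n]}}.
Implicit Types (f g q : S) (z : K).

Definition almost_integral q z := forall k, exists u, tofrac q * z ^+ k = tofrac u.

Lemma almost_integral_sub q z t : almost_integral q z ->
  almost_integral q (z - tofrac t).
Proof.
move=> h k; rewrite exprBn mulr_sumr.
apply: (big_ind (fun x => exists u, x = tofrac u)) => [|_ _ [u ->] [v ->]|i _].
- by exists 0; rewrite rmorph0.
- by exists (u + v); rewrite rmorphD.
have [u hu] := h (k - i)%N; exists (((-1) ^+ i * u * t ^+ i) *+ 'C(k, i)).
rewrite rmorphMn !rmorphM /= !rmorphXn rmorphN rmorph1 -hu mulrnAr; congr (_ *+ _).
by ring.
Qed.

(** The exponents of leading monomials grow linearly with the power, so the fixed summand from [q]
    cannot make up for a smaller exponent in [f]; the power one above the exponent of [q] already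
    gives a contradiction. *)
Lemma mlead_mnm_le f g q : f != 0 -> q != 0 ->
  (forall k, exists u, q * f ^+ k = u * g ^+ k) -> (mlead g <= mlead f)%MM.
Proof.
move=> f0 q0 h; apply/mnm_lepP => i; rewrite leqNgt; apply/negP => lt.
have [u e] := h (mlead q i).+1.
have nz : q * f ^+ (mlead q i).+1 != 0 by rewrite mulf_neq0 ?expf_neq0.
have : u * g ^+ (mlead q i).+1 != 0 by rewrite -e.
rewrite mulf_eq0 negb_or expf_eq0 /= => /andP[u0 g0].
have := congr1 (fun p => mlead p i) e.
rewrite !mleadM ?expf_neq0 // !mleadX // !mnmDE !mulmnE.
move: (mlead u i) (mlead q i) (mlead g i) (mlead f i) lt => a b c d lt.
by nia.
Qed.

(* Leading terms of the numerator are divisible by that of the denominator, so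
   the numerator can be reduced without losing almost integrality. *)
Lemma almost_integral_fraction_poly q f g : q != 0 -> g != 0 ->
  almost_integral q (tofrac f / tofrac g) -> exists u, tofrac f / tofrac g = tofrac u.
Proof.
move=> q0 g0; elim/mleadrect: f => f IH hf.
have F0 (h : S) : h != 0 -> tofrac h != 0 by rewrite tofrac_eq0.
have [->|f0] := eqVneq f 0; first by exists 0; rewrite rmorph0 mul0r.
have le : (mlead g <= mlead f)%MM.
  apply: mlead_mnm_le f0 q0 _ => k; have [u hu] := hf k; exists u; apply: tofrac_inj.
  rewrite !rmorphM !rmorphXn /= -hu expr_div_n -mulrA divfK //.
  by rewrite expf_neq0 // F0.
pose t : S := (mleadc f / mleadc g) *: 'X_[mlead f - mlead g].
have E : tofrac (f - t * g) / tofrac g = tofrac f / tofrac g - tofrac t.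
  by rewrite rmorphB rmorphM /= mulrBl mulfK ?F0.
suff [u hu] : exists u, tofrac (f - t * g) / tofrac g = tofrac u.
  by exists (u + t); rewrite rmorphD /= -hu E subrK.
have [->|f'0] := eqVneq (f - t * g) 0; first by exists 0; rewrite rmorph0 mul0r.
apply: IH; last by rewrite E; exact: almost_integral_sub.
have coef m : (mlead f <= m)%O -> (f - t * g)@_m = 0.
  rewrite le_eqVlt mcoeffB -scalerAl mcoeffZ mcoeffXM => /orP[/eqP <-|lt].
    rewrite lem_subr; have -> : (mlead f - (mlead f - mlead g))%MM = mlead g.
      by rewrite -{1}(submK le) addmC addmK.
    by rewrite divfK ?mleadc_eq0 // subrr.
  rewrite (mcoeff_gt_mlead lt); case: ifP => [le'|]; last by rewrite mulr0 subr0.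
  rewrite [g@_(m - _)]mcoeff_gt_mlead ?mulr0 ?subr0 //.
  by rewrite -(ltmc_add2r (mlead f - mlead g)%MM) submK // addmC submK.
by rewrite ltNge; apply/negP => /coef /eqP; rewrite mleadc_eq0 (negbTE f'0).
Qed.

(** If the equation has degree D, then g^D clears the denominators of z^j for j < D, and the
    equation itself reduces all higher powers to lower ones. So the fraction is almost integral. *)
Lemma integral_fraction_poly (R : nzRingType) (ev : {rmorphism R -> S}) (f g : R) :
  ev g != 0 ->
  integralOver (@tofrac S \o ev) (tofrac (ev f) / tofrac (ev g)) ->
  exists u, tofrac (ev f) / tofrac (ev g) = tofrac u.
Proof.
move=> g0 [P Pmon]; set z := _ / _ => Pz; pose D := (size P).-1.
have F0 : tofrac (ev g) != 0 by rewrite tofrac_eq0.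
apply: (almost_integral_fraction_poly (q := ev g ^+ D)) => //; first by rewrite expf_neq0.
have zD : z ^+ D = - \sum_(i < D) tofrac (ev P`_i) * z ^+ i.
  have sP : size P = D.+1 by rewrite prednK // lt0n size_poly_eq0 monic_neq0.
  move: Pz; rewrite /root (@horner_coef_wide _ D.+1); last first.
    by rewrite -sP; exact: size_poly.
  rewrite big_ord_recr /= coef_map_id0 ?rmorph0 //= -[P`_D]/(lead_coef P).
  rewrite (monicP Pmon) !rmorph1 mul1r addrC addr_eq0 => /eqP ->; congr (- _).
  by apply: eq_bigr => i _; rewrite coef_map_id0 ?rmorph0.
suff : forall k j, (j <= k)%N -> exists u, tofrac (ev g ^+ D) * z ^+ j = tofrac u.
  by move=> h k; exact: (h k).
elim=> [|k IH] j.
  rewrite leqn0 => /eqP ->; exists (ev g ^+ D).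
  by rewrite expr0 mulr1.
rewrite leq_eqVlt => /orP[/eqP ->|]; last exact: IH.
case: (leqP D k.+1) => [le|lt]; last first.
  exists (ev f ^+ k.+1 * ev g ^+ (D - k.+1)).
  rewrite rmorphM !rmorphXn /= /z expr_div_n -{1}(subnK (ltnW lt)) exprD.
  rewrite mulrC mulrA mulrAC.
  by rewrite divfK ?expf_neq0 // mulrC [in RHS]mulrC.
rewrite -(subnK le) exprD zD mulrN mulrN mulr_sumr mulr_sumr.
apply: (big_ind (fun x => exists u, - x = tofrac u)) => [|x y [u hu] [v hv]|i _].
- by exists 0; rewrite rmorph0 oppr0.
- by exists (u + v); rewrite opprD hu hv rmorphD.
have [|u hu] := IH (k.+1 - D + i)%N.
  by have hi : (i < D)%N := ltn_ord i; clear -hi le; lia.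
exists (- (ev P`_i * u)); rewrite rmorphN rmorphM /= -hu exprD.
by congr (- _); ring.
Qed.

End IntegrallyClosed.

Section GradedHom.
Variables (F : fieldType) (n n' : nat) (mf : measure n) (mf' : measure n') (c : nat).
Variable phi : {rmorphism {mpoly F[n]} -> {mpoly F[n']}}.
Hypothesis c_pos : (0 < c)%N.
Hypothesis phiC : forall a, phi a%:MP = a%:MP.
Hypothesis phiX : forall i, phi 'X_i \is (c * mf U_(i)%MM).-homog for mf'.

Lemma graded_homX m : phi 'X_[m] \is (c * mf m).-homog for mf'.
Proof.
rewrite mpolyXE_id rmorph_prod mfE big_distrr /=.
apply: (big_rec2 (fun p k => p \is k.-homog for mf')); first exact: dhomog1.
move=> i k p _ hp; apply: dhomogM hp; rewrite rmorphXn mulnCA mulnC.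
exact: dhomogMn.
Qed.

Lemma graded_homZ a f : phi (a *: f) = a *: phi f.
Proof. by rewrite -mul_mpolyC rmorphM /= phiC mul_mpolyC. Qed.

Lemma graded_pihomog k f : pihomog mf' (c * k) (phi f) = phi (pihomog mf k f).
Proof.
rewrite [in LHS](mpolyE f) [in RHS]pihomogE !raddf_sum /= [RHS]big_mkcond /=.
apply: eq_bigr => m _; rewrite !graded_homZ linearZ /=.
case: eqP => [<-|/eqP ne]; first by rewrite pihomog_dE // graded_homX.
by rewrite (pihomog_ne0 _ (graded_homX m)) ?scaler0 // eqn_pmul2l.
Qed.

Lemma graded_hom_dhomog k f : f \is k.-homog for mf -> phi f \is (c * k).-homog for mf'.
Proof. by move=> hf; rewrite -(pihomog_dE hf) -graded_pihomog pihomogP. Qed.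

End GradedHom.

Section KernelPoint.
Variables (F : fieldType) (n n' : nat) (w : 'I_n -> nat) (mf' : measure n') (c : nat).
Variable phi : {rmorphism {mpoly F[n]} -> {mpoly F[n']}}.
Hypothesis c_pos : (0 < c)%N.
Hypothesis phiC : forall a, phi a%:MP = a%:MP.
Hypothesis phiX : forall i, phi 'X_i \is (c * w i).-homog for mf'.

Lemma wdegU i : wdeg w U_(i)%MM = w i.
Proof.
rewrite /wdeg (bigD1 i) //= mnm1E eqxx muln1 big1 ?addn0 // => j /negbTE ne.
by rewrite mnm1E eq_sym ne muln0.
Qed.

Lemma kernel_proj_point i : phi 'X_i != 0 -> proj_point w [pred f | phi f == 0].
Proof.
move=> hi; have phiX' j : phi 'X_j \is (c * wdeg w U_(j)%MM).-homog for mf'.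
  by rewrite wdegU.
split; last by exists i.
- split; rewrite ?inE ?rmorph0 // ?rmorph1 ?oner_eq0 // => a u v.
  by rewrite !inE rmorphD rmorphM /= => /eqP -> /eqP ->; rewrite mulr0 addr0.
- by move=> u v; rewrite !inE rmorphM mulf_eq0.
- move=> k f; rewrite !inE wcompE => /eqP e.
  by rewrite -(graded_pihomog (mf := wdeg w) c_pos phiC phiX') e raddf0.
Qed.

End KernelPoint.

(** * Invertible twists at the vertices of Proj *)

Section VertexPoint.
Variables (F : fieldType) (n : nat) (w : 'I_n -> nat) (i : 'I_n).
Local Notation S := {mpoly F[n]}.

Definition vertex_eval : S -> S := mmap (@mpolyC n F) (fun j => if j == i then 'X_j else 0).
HB.instance Definition _ := GRing.RMorphism.on vertex_eval.

Lemma vertex_evalC a : vertex_eval a%:MP = a%:MP.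
Proof. exact: mmapC. Qed.

Lemma vertex_evalXU j : vertex_eval 'X_j = if j == i then 'X_j else 0.
Proof. by rewrite /vertex_eval mmapX mmap1U. Qed.

Lemma vertex_evalX m : vertex_eval 'X_[m] =
  if m == (U_(i) *+ m i)%MM then 'X_[m] else 0.
Proof.
case: eqP => [->|ne].
  by rewrite -mpolyXn rmorphXn /= vertex_evalXU eqxx.
have [j nj mj] : exists2 j, j != i & m j != 0%N.
  apply: boolp.contrapT => no; apply: ne; apply/mnmP => j; rewrite mulmnE mnm1E.
  have [<-|ne] := eqVneq i j; first by rewrite mul1n.
  rewrite mul0n; apply/eqP; apply: boolp.contrapT => /negP nz.
  by apply: no; exists j => //; rewrite eq_sym.
rewrite mpolyXE_id rmorph_prod (bigD1 j) //= rmorphXn /= vertex_evalXU (negbTE nj).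
by rewrite expr0n (negbTE mj) mul0r.
Qed.

Lemma mcoeff_vertex_eval f k : (vertex_eval f)@_(U_(i) *+ k) = f@_(U_(i) *+ k).
Proof.
transitivity (\sum_(m <- msupp f) f@_m * (vertex_eval 'X_[m])@_(U_(i) *+ k)).
  rewrite {1}(mpolyE f) rmorph_sum raddf_sum /=; apply: eq_bigr => m _.
  by rewrite (graded_homZ (phi := vertex_eval) vertex_evalC) mcoeffZ.
rewrite [in RHS](mpolyE f) raddf_sum /=; apply: eq_bigr => m _.
rewrite mcoeffZ vertex_evalX.
case: eqP => // ne; rewrite mcoeff0 mcoeffX; case: eqP => // e; case: ne.
by rewrite e mulmnE mnm1E eqxx mul1n.
Qed.

Definition vertex_point : {pred S} := [pred f | vertex_eval f == 0].

Lemma vertex_proj_point : proj_point w vertex_point.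
Proof.
apply: (@kernel_proj_point _ _ _ w (wdeg w) 1 vertex_eval _ vertex_evalC _ i) => //.
  move=> j; rewrite /= vertex_evalXU mul1n; case: eqP => _; last exact: rpred0.
  by rewrite dhomogX /= wdegU.
by rewrite /= vertex_evalXU eqxx -msupp_eq0 msuppX.
Qed.

Lemma notin_vertex_point f : f \notin vertex_point -> exists k, f@_(U_(i) *+ k) != 0.
Proof.
rewrite inE => nz; apply: boolp.contrapT => no; move/negP: nz; apply.
rewrite (mpolyE f) raddf_sum /= big_seq big1 // => m; rewrite mcoeff_msupp => hm.
rewrite (graded_homZ (phi := vertex_eval) vertex_evalC) /= vertex_evalX.
case: eqP => [e|]; last by rewrite scaler0.
by case: no; exists (m i); rewrite -e.
Qed.

Lemma vertex_point_homog f k : f \is k.-homog for (wdeg w) -> f \notin vertex_point ->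
  exists2 l, k = (w i * l)%N & f@_(U_(i) *+ l) != 0.
Proof.
move=> hf /notin_vertex_point [l hl]; exists l => //.
have := dhomog_mf hf; move/(_ (U_(i) *+ l)%MM); rewrite mcoeff_msupp => /(_ hl) <- /=.
rewrite /wdeg (bigD1 i) //= big1 => [|j /negbTE ne].
  by rewrite mulmnE mnm1E eqxx mul1n addn0.
by rewrite mulmnE mnm1E eq_sym ne muln0.
Qed.

End VertexPoint.

Section DominantVariable.
Variables (F : fieldType) (n : nat) (w : 'I_n -> nat) (i : 'I_n).
Hypothesis w_pos : forall j, (0 < w j)%N.
Local Notation S := {mpoly F[n]}.

(* Substituting a high power of x_i for x_i makes x_i^l the leading monomial of
   every w-homogeneous polynomial in which it occurs. *)
Definition stretch (m : 'X_{1..n}) : 'X_{1..n} := (m + U_(i) *+ (w i * m i))%MM.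

Lemma stretchE m j : stretch m j = (m j + (i == j) * (w i * m i))%N.
Proof. by rewrite mnmDE mulmnE mnm1E. Qed.

Lemma stretch_inj : injective stretch.
Proof.
move=> m m' e; have ei : m i = m' i.
  have := congr1 (fun x : 'X_{1..n} => x i) e; rewrite !stretchE eqxx !mul1n -!mulSn.
  by move/eqP; rewrite eqn_pmul2l // => /eqP.
by move: e; rewrite /stretch ei => /addIm.
Qed.

Definition stretch_poly : S -> S :=
  mmap (@mpolyC n F) (fun j => 'X_[stretch U_(j)%MM]).
HB.instance Definition _ := GRing.RMorphism.on stretch_poly.

Lemma stretch_polyX m : stretch_poly 'X_[m] = 'X_[stretch m].
Proof.
have stretchD : {morph stretch : m1 m2 / (m1 + m2)%MM}.
  by move=> m1 m2; apply/mnmP => j; rewrite mnmDE !stretchE !mnmDE; lia.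
have stretch0 : stretch 0%MM = 0%MM.
  by apply/mnmP => j; rewrite stretchE !mnm0E !muln0.
rewrite /stretch_poly mmapX /mmap1 [in RHS](multinomUE_id m).
rewrite (big_morph stretch stretchD stretch0) -mprodXE; apply: eq_bigr => j _.
elim: (m j) => [|k IH]; first by rewrite mulm0n stretch0 mpolyX0.
by rewrite exprS IH mulmS stretchD mpolyXD.
Qed.

Lemma stretch_polyC a : stretch_poly a%:MP = a%:MP.
Proof. exact: mmapC. Qed.

Lemma stretch_polyE f : stretch_poly f = \sum_(m <- msupp f) f@_m *: 'X_[stretch m].
Proof.
rewrite {1}(mpolyE f) rmorph_sum; apply: eq_bigr => m _.
by rewrite /= (graded_homZ (phi := stretch_poly) stretch_polyC) /= stretch_polyX.
Qed.

Lemma mcoeff_stretch f m : (stretch_poly f)@_(stretch m) = f@_m.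
Proof.
rewrite stretch_polyE {3}(mpolyE f) !raddf_sum; apply: eq_bigr => m' _ /=.
by rewrite !mcoeffZ !mcoeffX (inj_eq stretch_inj).
Qed.

Lemma msupp_stretch f m : m \in msupp (stretch_poly f) ->
  exists2 m', m' \in msupp f & m = stretch m'.
Proof.
rewrite mcoeff_msupp => nz; apply: boolp.contrapT => no; move/negP: nz; apply.
rewrite stretch_polyE raddf_sum big_seq big1 // => m' hm' /=.
rewrite mcoeffZ mcoeffX; case: eqP => [e|]; last by rewrite mulr0.
by case: no; exists m'.
Qed.

Lemma stretch_neq0 f : f != 0 -> stretch_poly f != 0.
Proof.
move=> f0; apply: contraNneq f0 => z; rewrite -mleadc_eq0 -mcoeff_stretch z mcoeff0.
exact: eqxx.
Qed.

(** Another monomial m of the same weighted degree has m_i < l, and its other exponents add up to at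
    most w_i (l - m_i) since weights are positive. After stretching, its degree is at most m_i + w_i
    l, below that of x_i^l. *)
Lemma mlead_stretch f k : f \is k.-homog for (wdeg w) -> f \notin vertex_point i ->
  exists l, mlead (stretch_poly f) = (U_(i) *+ l)%MM.
Proof.
move=> hf hv; have [l kl hl] := vertex_point_homog hf hv.
exists (l + w i * l)%N.
have sE : stretch (U_(i) *+ l) = (U_(i) *+ (l + w i * l))%MM.
  apply/mnmP => j; rewrite stretchE !mulmnE !mnm1E eqxx mul1n.
  by case: (i == j); rewrite ?mul1n ?mul0n.
have f0 : f != 0 by apply: contraNneq hl => ->; rewrite mcoeff0.
apply/eqP; rewrite eq_le; apply/andP; split; last first.
  by apply: msupp_le_mlead; rewrite -sE mcoeff_msupp mcoeff_stretch.
have [m hm ->] := msupp_stretch (mlead_supp (stretch_neq0 f0)).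
have [->|ne] := eqVneq m (U_(i) *+ l)%MM; first by rewrite sE.
apply/ltW/lt_mdeg_ltmc; rewrite mdegMn mdeg1 mul1n mdegD mdegMn mdeg1 mul1n.
have e : wdeg w m = (w i * l)%N by rewrite -kl; exact: dhomog_mf hf _ hm.
have mdeg_split : mdeg m = (m i + \sum_(j | j != i) m j)%N by rewrite mdegE (bigD1 i).
have rest : (\sum_(j | j != i) m j <= \sum_(j | j != i) w j * m j)%N.
  by apply: leq_sum => j _; rewrite leq_pmull.
have wsplit : wdeg w m = (w i * m i + \sum_(j | j != i) w j * m j)%N.
  by rewrite /wdeg (bigD1 i).
have lt : (m i < l)%N.
  have : (w i * m i <= w i * l)%N by rewrite -e wsplit leq_addr.
  rewrite leq_pmul2l // leq_eqVlt => /orP[/eqP ei|//]; case/eqP: ne.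
  have z : (\sum_(j | j != i) w j * m j = 0)%N by move: e; rewrite wsplit ei; lia.
  apply/mnmP => j; rewrite mulmnE mnm1E; have [<-|nj] := eqVneq i j; first by rewrite mul1n.
  move/eqP: z; rewrite sum_nat_eq0 => /forallP/(_ j).
  by rewrite eq_sym nj /= muln_eq0 gtn_eqF //= => /eqP.
rewrite mdeg_split; move: rest; rewrite -(leq_add2l (w i * m i)) -wsplit e.
move: (\sum_(j | j != i) m j)%N => s; have := w_pos i; nia.
Qed.

End DominantVariable.

Lemma frac_cross (K : fieldType) (x y a b c e : K) :
  y != 0 -> b != 0 -> e != 0 -> x / y = a / b * (c / e) -> x * (b * e) = a * c * y.
Proof.
move=> y0 b0 e0 h; have -> : x = x / y * y by rewrite divfK.
by rewrite h; field; rewrite b0 e0.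
Qed.

Section InvertibleTwist.
Variables (F : fieldType) (n : nat) (w : 'I_n -> nat) (i : 'I_n).
Hypothesis w_pos : forall j, (0 < w j)%N.
Hypothesis w_gcd : forall j, (\big[gcdn/0]_(l | l != j) w l = 1)%N.
Local Notation S := {mpoly F[n]}.

(** Well-formedness with index [j] omitted says that the remaining weights generate Z, hence all
    residues modulo w_i. *)
Lemma monomial_residue j t : j != i ->
  exists m : 'X_{1..n}, m j = 0%N /\ wdeg w m = t %[mod w i].
Proof.
move=> nji; pose G x := exists m : 'X_{1..n}, m j = 0%N /\ wdeg w m = x %[mod w i].
have G0 : G 0%N by exists 0%MM; rewrite mnm0E wdeg0.
have GD x z : G x -> G z -> G (x + z)%N.
  move=> [m [m0 hm]] [m' [m'0 hm']]; exists (m + m')%MM; split.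
    by rewrite mnmDE m0 m'0.
  by rewrite wdegD -modnDm hm hm' modnDm.
have GM x k : G x -> G (k * x)%N.
  by move=> Gx; elim: k => [|k IH]; rewrite ?mul0n ?mulSn //; apply: GD.
have Gmod x z : x = z %[mod w i] -> G x -> G z.
  by move=> e [m [m0 hm]]; exists m; rewrite hm.
have Ggcd x z : G x -> G z -> G (gcdn x z).
  case: (posnP x) => [->|x0] Gx Gz; first by rewrite gcd0n.
  have [km kn e _] := egcdnP z x0.
  (* The factor w_i - 1 stands for -1 modulo w_i, which keeps the Bezout combination
     non-negative. *)
  apply: (Gmod (km * x + (w i).-1 * (kn * z))%N).
    rewrite e -[RHS](modnMDl (kn * z)); congr (_ %% _)%N.
    by case: (w i) (w_pos i) => // w' _ /=; lia.
  by apply: GD; [apply: GM | apply/GM/GM].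
have G1 : G 1%N.
  rewrite -(w_gcd j); apply: (big_ind G) => // l nlj.
  have [->|nli] := eqVneq l i; first by exists 0%MM; rewrite mnm0E wdeg0 modnn mod0n.
  by exists U_(l)%MM; rewrite wdegU mnm1E (negbTE nlj).
by have := GM _ t G1; rewrite muln1.
Qed.

(** Let f / g generate O(-d) at the vertex. For each j other than i there is a monomial without x_j
    that, divided by a power of x_i, has degree -d, hence is a multiple of f / g. Comparing leading
    monomials after stretching shows that x_j is absent from that of f. So f contains a pure power
    of x_i, and the degrees of f and g are both multiples of w_i. *)
Lemma twist_invertible_dvd d : twist_invertible F w (- d%:Z) -> (w i %| d)%N.
Proof.
pose p := vertex_point (F := F) i; have pp : proj_point w p by exact: vertex_proj_point.
move=> /(_ p pp) [h [k [e [_ hp e0 /(_ p pp hp) stalkE]]]].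
have F0 (q : S) : q != 0 -> tofrac q != 0 by rewrite tofrac_eq0.
have p0 q : q \notin p -> q != 0.
  by apply: contraNneq => ->; case: pp => [[]].
have oneS : twist_stalk w 0 p (1 : {fraction S}).
  exists 1, 1, 0%N, 0%N; split; rewrite ?whomogE ?dhomog1 //.
    by case: pp => [[]].
  by rewrite rmorph1 divr1.
have [f [g [df [dg [hf hg gp edeg ee]]]]] : twist_stalk w (- d%:Z) p e.
  by apply/stalkE; exists 1; rewrite ?mul1r.
have f0 : f != 0 by apply: contraNneq e0 => f0; rewrite ee f0 rmorph0 mul0r.
have Xp c : 'X_i ^+ c \notin p.
  by rewrite inE rmorphXn /= vertex_evalXU eqxx expf_neq0 // -msupp_eq0 msuppX.
have lead_f j : j != i -> mlead (stretch_poly w i f) j = 0%N.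
  move=> nji; have [m [mj hm]] := monomial_residue (d * (w i).-1) nji.
  have /dvdnP [c hc] : (w i %| wdeg w m + d)%N.
    rewrite /dvdn -modnDml hm modnDml -{2}[d]muln1 -mulnDr addn1 prednK //.
    by rewrite modnMl.
  have : twist_stalk w (- d%:Z) p (tofrac ('X_[m] : S) / tofrac ('X_i ^+ c)).
    exists 'X_[m], ('X_i ^+ c), (wdeg w m), (w i * c)%N; split=> //.
    - by rewrite whomogE dhomogX.
    - by rewrite whomogE dhomogMn // dhomogX /= wdegU.
    - by move: hc; lia.
  case/stalkE => u [q1 [q2 [d1 [d2 [_ hq2 q2p _ ->]]]]]; rewrite ee => E.
  have {}E : 'X_[m] * (q2 * g) = q1 * f * 'X_i ^+ c.
    have {}E := frac_cross (F0 _ (p0 _ (Xp c))) (F0 _ (p0 _ q2p)) (F0 _ (p0 _ gp)) E.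
    apply: tofrac_inj.
    rewrite [LHS]tofracM (tofracM q2 g) [RHS]tofracM (tofracM q1 f).
    exact: E.
  have q10 : q1 != 0.
    apply: contraTneq isT => z; move/eqP: E; rewrite z !mul0r !mulf_eq0.
    by rewrite -msupp_eq0 msuppX /= (negbTE (p0 _ q2p)) (negbTE (p0 _ gp)).
  have Xc0 : 'X_i ^+ c != 0 :> S by apply: p0.
  have Xm0 : 'X_[m] != 0 :> S by rewrite -msupp_eq0 msuppX.
  have sn := @stretch_neq0 F n w i.
  have := congr1 (fun x => mlead (stretch_poly w i x) j) E.
  rewrite !rmorphM /= !mleadM ?mulf_neq0 ?sn ?(p0 _ q2p) ?(p0 _ gp) // !mnmDE.
  have [l2 ->] := mlead_stretch w_pos hq2 q2p.
  have [lg ->] := mlead_stretch w_pos hg gp.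
  have nij : (i == j) = false by rewrite eq_sym (negbTE nji).
  rewrite stretch_polyX mleadXm stretchE mj !mulmnE !mnm1E nij !mul0n => /esym/eqP.
  by rewrite !addn_eq0 => /andP[/andP[_ /eqP]].
have fp : f \notin p.
  have [m hm em] := msupp_stretch (mlead_supp (stretch_neq0 w i f0)).
  have em' : m = (U_(i) *+ m i)%MM.
    apply/mnmP => j; rewrite mulmnE mnm1E; have [<-|ne] := eqVneq i j; first by rewrite mul1n.
    by have := lead_f j; rewrite eq_sym em stretchE (negbTE ne) mul0n addn0 => ->.
  rewrite inE; apply/eqP => /(congr1 (mcoeff (U_(i) *+ m i))).
  by rewrite mcoeff_vertex_eval -em' mcoeff0; apply/eqP; rewrite -mcoeff_msupp.
have [l el _] := vertex_point_homog hf fp; have [l' el' _] := vertex_point_homog hg gp.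
have -> : d = (w i * l' - w i * l)%N by move: edeg; rewrite el el'; lia.
by rewrite -mulnBr dvdn_mulr.
Qed.

End InvertibleTwist.

(** * Minimal resolutions *)

Section Generation.
Variables (R : comNzRingType) (V : lmodType R).
Implicit Types (s t : seq V) (x y : V).

Fixpoint gen s x : Prop :=
  if s is a :: s' then exists c y, gen s' y /\ x = c *: a + y else x = 0.

Lemma gen0 s : gen s 0.
Proof. by elim: s => //= a s IH; exists 0, 0; rewrite scale0r addr0. Qed.

Lemma genD s x y : gen s x -> gen s y -> gen s (x + y).
Proof.
elim: s x y => [|a s IH] x y /=; first by move=> -> ->; rewrite addr0.
move=> [c [z [gz ->]]] [d [u [gu ->]]]; exists (c + d), (z + u).
by split; [exact: IH | rewrite scalerDl addrACA].
Qed.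

Lemma genZ s r x : gen s x -> gen s (r *: x).
Proof.
elim: s x => [|a s IH] x /=; first by move=> ->; rewrite scaler0.
move=> [c [z [gz ->]]]; exists (r * c), (r *: z).
by split; [exact: IH | rewrite scalerDr scalerA].
Qed.

Lemma genN s x : gen s x -> gen s (- x).
Proof. by move/(genZ (-1)); rewrite scaleN1r. Qed.

Lemma gen_sum s (I : Type) (r : seq I) (P : pred I) (G : I -> V) :
  (forall i, P i -> gen s (G i)) -> gen s (\sum_(i <- r | P i) G i).
Proof. by move=> h; apply: big_ind => //; [exact: gen0 | exact: genD]. Qed.

Lemma gen_mem s x : x \in s -> gen s x.
Proof.
elim: s => //= a s IH; rewrite inE => /orP[/eqP ->|/IH h].
  by exists 1, 0; rewrite scale1r addr0; split=> //; exact: gen0.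
by exists 0, x; rewrite scale0r add0r.
Qed.

Lemma gen_trans s t x : (forall y, y \in s -> gen t y) -> gen s x -> gen t x.
Proof.
elim: s x => [|a s IH] x h /=; first by move=> ->; exact: gen0.
move=> [c [z [gz ->]]]; apply: genD; first by apply/genZ/h/mem_head.
by apply: IH gz => y ys; apply: h; rewrite inE ys orbT.
Qed.

Lemma gen_nthP s x : gen s x <->
  exists u : 'I_(size s) -> R, x = \sum_i u i *: s`_i.
Proof.
split=> [|[u ->]]; last first.
  by apply: gen_sum => i _; apply/genZ/gen_mem/mem_nth.
elim: s x => [|a s IH] x /=; first by move=> ->; exists (fun=> 0); rewrite big_ord0.
move=> [c [y [/IH [u ->] ->]]].
exists (fun i => if unlift ord0 i is Some j then u j else c).
by rewrite big_ord_recl unlift_none; congr (_ + _); apply: eq_bigr => i _; rewrite liftK.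
Qed.

Definition submodule (U : V -> Prop) : Prop :=
  [/\ U 0, forall x y, U x -> U y -> U (x + y) & forall r x, U x -> U (r *: x)].

Definition noetherian : Prop := forall U, submodule U ->
  exists s, (forall x, x \in s -> U x) /\ forall x, U x -> gen s x.

Lemma submodule_gen U s x : submodule U -> (forall y, y \in s -> U y) -> gen s x -> U x.
Proof.
case=> U0 UD UZ; elim: s x => [|a s IH] x h /=; first by move=> ->.
move=> [c [y [gy ->]]]; apply: UD; first by apply/UZ/h/mem_head.
by apply: IH gy => z zs; apply: h; rewrite inE zs orbT.
Qed.

End Generation.

Section HilbertBasis.
Variable R : comNzRingType.

Lemma lift_generators (V W : lmodType R) (U : V -> Prop) (f : V -> W) (s : seq W) :
  (forall y, y \in s -> exists2 x, U x & f x = y) ->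
  exists2 t, (forall x, x \in t -> U x) & map f t = s.
Proof.
elim: s => [|a s IH] h; first by exists [::].
have [t ht e] := IH (fun y hy => h y (mem_behead (s := a :: s) hy)).
have [x Ux ex] := h a (mem_head _ _); exists (x :: t); last by rewrite /= ex e.
by move=> y; rewrite inE => /orP[/eqP ->|/ht].
Qed.

Lemma gen_map (V W : lmodType R) (f : V -> W) (t : seq V) y :
  linear f -> gen (map f t) y -> exists2 x, gen t x & f x = y.
Proof.
move=> hf; have f0 : f 0 = 0 by have := hf (-1) 0 0; rewrite scaler0 addr0 scaleN1r addNr.
elim: t y => [|a t IH] y /=; first by move=> ->; exists 0.
move=> [c [z [/IH [x gx <-] ->]]]; exists (c *: a + x); last by rewrite hf.
by exists c, x.
Qed.

Lemma map_gen (V W : lmodType R) (f : V -> W) (t : seq V) x :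
  linear f -> gen t x -> gen (map f t) (f x).
Proof.
move=> hf; have f0 : f 0 = 0 by have := hf (-1) 0 0; rewrite scaler0 addr0 scaleN1r addNr.
elim: t x => [|a t IH] x /=; first by move=> ->.
by move=> [c [z [/IH g ->]]]; exists c, (f z); rewrite hf.
Qed.

(** Induction on the rank: lifts of generators of the ideal of first coordinates, together with
    generators of the elements whose first coordinate is zero. *)
Lemma noetherian_rV p : noetherian R^o -> noetherian 'rV[R]_p.
Proof.
move=> nR; elim: p => [|p IH] U [U0 UD UZ].
  by exists [::]; split=> // x _ /=; rewrite [x]thinmx0.
pose f (v : 'rV[R]_p.+1) : R^o := v 0 0.
have [|s [hs gs]] := nR (fun a => exists2 v, U v & f v = a).
  split=> [|x y [u hu <-] [v hv <-]|r x [u hu <-]].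
  - by exists 0; rewrite // /f mxE.
  - by exists (u + v); [exact: UD | rewrite /f mxE].
  - by exists (r *: u); [exact: UZ | rewrite /f mxE].
have [t ht et] := lift_generators hs.
have [|s' [hs' gs']] := IH (fun v : 'rV[R]_p => U (row_mx (0 : 'rV_1) v)).
  split=> [|x y hx hy|r x hx].
  - by rewrite row_mx0.
  - by rewrite -[0]addr0 -add_row_mx; exact: UD.
  - by rewrite -[0](scaler0 _ r) -scale_row_mx; exact: UZ.
pose g (v : 'rV[R]_p) : 'rV[R]_(1 + p) := row_mx (0 : 'rV[R]_1) v.
have glin : linear g.
  by move=> c x y; rewrite /g scale_row_mx add_row_mx scaler0 addr0.
have flin : linear f by move=> c x y; rewrite /f !mxE.
exists (t ++ map g s'); split=> [x|x Ux].
  by rewrite mem_cat => /orP[/ht //|/mapP [y /hs' hy ->]].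
have [y gy fy] : exists2 y, gen t y & f y = f x.
  by apply: gen_map => //; rewrite et; apply: gs; exists x.
have Uy : U y by apply: submodule_gen gy; [split | exact: ht].
have sub_cat (z : 'rV[R]_p.+1) : gen t z -> gen (t ++ map g s') z.
  by apply: gen_trans => w wt; apply: gen_mem; rewrite mem_cat wt.
rewrite -(subrK y x); apply: genD; last exact: sub_cat.
have [z ez] : exists z, x - y = g z.
  exists (rsubmx (x - y : 'rV_(1 + p))).
  apply: etrans (esym (hsubmxK (x - y : 'rV_(1 + p)))) _; congr row_mx.
  apply/matrixP => i j; rewrite !ord1 [LHS]mxE [RHS]mxE.
  have -> : lshift p 0 = 0 :> 'I_(1 + p) by apply: val_inj.
  by move: fy; rewrite /f => fy; rewrite mxE [(- y) _ _]mxE fy subrr.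
  rewrite ez; apply: gen_trans (map_gen glin (gs' z _)).
  by move=> w wt; apply: gen_mem; rewrite mem_cat wt orbT.
rewrite -/(g z) -ez; apply: UD => //; by rewrite -scaleN1r; apply: UZ.
Qed.

(* Leading coefficients: the ideals of coefficients in degree d of elements of
   degree at most d eventually coincide. *)
Lemma noetherian_poly : noetherian R^o -> noetherian {poly R}^o.
Proof.
move=> nR I [I0 ID IZ].
pose T := {poly R}^o.
pose lift d (a : R^o) := exists2 f : T, I f & (size (f : {poly R}) <= d.+1)%N /\ (f : {poly R})`_d = a.
have lift_sub d : submodule (lift d).
  split=> [|x y [f hf [sf <-]] [g hg [sg <-]]|r x [f hf [sf <-]]].
  - by exists 0 => //; rewrite size_poly0 coef0.
  - exists (f + g); first exact: ID.
    rewrite coefD; split=> //; apply: leq_trans (size_polyD _ _) _.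
    by rewrite geq_max sf.
  - exists (r%:P *: f : T); first exact: IZ.
    rewrite /GRing.scale /= mul_polyC coefZ; split=> //.
    exact: leq_trans (size_scale_leq _ _) sf.
have level d (J : R^o -> Prop) : submodule J -> (forall a, J a -> lift d a) ->
    exists2 t : seq T, (forall f, f \in t -> I f /\ (size (f : {poly R}) <= d.+1)%N)
      & forall a, J a -> gen [seq (f : {poly R})`_d : R^o | f : T <- t] a.
  move=> sJ hJ; have [s [hs gs]] := nR J sJ.
  have [t ht et] : exists2 t : seq T, (forall f, f \in t -> I f /\ (size (f : {poly R}) <= d.+1)%N)
      & map (fun f : T => (f : {poly R})`_d : R^o) t = s.
    apply: (lift_generators (U := fun f : T => I f /\ (size (f : {poly R}) <= d.+1)%N)) => a /hs/hJ.
    by case=> f If [sf ef]; exists f.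
  by exists t => // a /gs; rewrite et.
pose J (a : R^o) := exists d, lift d a.
have lift_up d k a : lift d a -> lift (d + k)%N a.
  case=> f If [sf <-]; exists ('X^k * f); first by apply: (IZ ('X^k)).
  rewrite coefXnM ltnNge leq_addl addnK /=; split=> //.
  apply: leq_trans (size_polyMleq _ _) _; rewrite size_polyXn addSn /= addnC -addSn.
  by rewrite leq_add2r.
have sJ : submodule J.
  split=> [|x y [d hx] [e hy]|r x [d hx]].
  - by exists 0%N; have [] := lift_sub 0%N.
  - exists (d + e)%N; have [_ D _] := lift_sub (d + e)%N.
    by apply: D; [exact: lift_up | rewrite addnC; exact: lift_up].
  - by exists d; have [_ _ Z] := lift_sub d; exact: Z.
have [D [top [htop gtop]]] : exists D, exists t : seq T,
    (forall f, f \in t -> I f /\ (size (f : {poly R}) <= D.+1)%N)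
    /\ forall a, J a -> gen [seq (f : {poly R})`_D : R^o | f : T <- t] a.
  have [s [hs gs]] := nR J sJ.
  have [D hD] : exists D, forall a, a \in s -> lift D a.
    elim: s hs {gs} => [|a s IH] h; first by exists 0%N.
    have [D hD] := IH (fun b hb => h b (mem_behead (s := a :: s) hb)).
    have [d ha] := h a (mem_head _ _); exists (D + d)%N => b.
    rewrite inE => /orP[/eqP ->|/hD]; last exact: lift_up.
    by rewrite addnC; exact: lift_up.
  have [t ht gt] := level D J sJ (fun a Ja => submodule_gen (lift_sub D) hD (gs a Ja)).
  by exists D, t.
have levels d : exists t : seq T,
    (forall f, f \in t -> I f /\ (size (f : {poly R}) <= d.+1)%N)
    /\ forall a, lift d a -> gen [seq (f : {poly R})`_d : R^o | f : T <- t] a.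
  by have [t ht gt] := level d _ (lift_sub d) (fun _ h => h); exists t.
have [low hlow] := boolp.choice levels.
(* From degree [D] on, [top] produces every leading coefficient after multiplication by powers of
   the variable; below it each of the finitely many degrees has its own generators. *)
pose all_gens := top ++ flatten [seq low d | d <- iota 0 D].
exists all_gens; split=> [f|f].
  rewrite mem_cat => /orP[/htop[] //|/flattenP [t /mapP [d _ ->] /((hlow d).1 f)]].
  by case.
move: {2}(size _) (leqnn (size (f : {poly R}))) => k; elim: k f => [|k IH] f sf If.
  suff -> : f = 0 by exact: gen0.
  by apply/eqP; rewrite -size_poly_leq0.
have reduce (t : seq T) d : (d <= k)%N -> (forall g, g \in t -> I g /\ (size (g : {poly R}) <= d.+1)%N) ->
    gen [seq (g : {poly R})`_d : R^o | g : T <- t] ((f : {poly R})`_k) ->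
    (forall g, g \in t -> g \in all_gens) -> gen all_gens f.
  move=> dk ht gf sub.
  have [g [Ig sg ggen eg]] : exists g : T, [/\ I g, (size (g : {poly R}) <= k.+1)%N,
      gen all_gens g & (g : {poly R})`_k = (f : {poly R})`_k].
    have [u hu] := (gen_nthP _ _).1 gf.
    exists (\sum_(i < size t) (u (cast_ord (esym (size_map _ t)) i))%:P * 'X^(k - d) * t`_i).
    split.
    - apply: (big_ind I) => [||i _]; [exact: I0 | exact: ID |].
      by apply: (IZ (_ * _)); have [] := ht _ (mem_nth 0 (ltn_ord i)).
    - apply: leq_trans (size_sum _ _ _) _; apply/bigmax_leqP => i _.
      have [_ st] := ht _ (mem_nth 0 (ltn_ord i)).
      rewrite -mulrA mul_polyC; apply: leq_trans (size_scale_leq _ _) _.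
      apply: leq_trans (size_polyMleq _ _) _; rewrite size_polyXn addSn /=.
      by apply: leq_trans (leq_add (leqnn _) st) _; rewrite addnS subnK.
    - apply: gen_sum => i _; apply: (genZ (_ * _)); apply/gen_mem/sub/mem_nth.
      exact: ltn_ord.
    - rewrite coef_sum hu (reindex (cast_ord (esym (size_map _ t)))) /=; last first.
        by exists (cast_ord (size_map _ t)) => i _; rewrite ?cast_ordK ?cast_ordKV.
      apply: eq_bigr => i _; rewrite (nth_map 0) //= -mulrA coefCM coefXnM.
      by rewrite ltnNge leq_subr /= subKn.
  rewrite -(subrK g f); apply: genD => //; apply: IH.
    apply/leq_sizeP => j; rewrite leq_eqVlt => /orP[/eqP <-|lt].
      by rewrite coefB eg subrr.
    by rewrite coefB !nth_default ?subrr //; [exact: leq_trans sg lt | exact: leq_trans sf lt].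
  by apply: ID => //; rewrite -scaleN1r; apply: IZ.
have fk : lift k (f : {poly R})`_k by exists f.
case: (ltnP k D) => hk.
  apply: (reduce (low k) k) => //; [exact: (hlow k).1 | exact: (hlow k).2 |].
  move=> g hg; rewrite mem_cat; apply/orP; right; apply/flattenP; exists (low k) => //.
  by apply: map_f; rewrite mem_iota.
apply: (reduce top D) => //; first by apply: gtop; exists k.
by move=> g hg; rewrite mem_cat hg.
Qed.

End HilbertBasis.

Lemma noetherian_surj (A B : comNzRingType) (phi : {rmorphism A -> B}) :
  (forall y, exists x, phi x = y) -> noetherian A^o -> noetherian B^o.
Proof.
move=> surj nA I [I0 ID IZ].
have [|s [hs gs]] := nA (fun x : A^o => I (phi x)).
  split=> [|x y hx hy|r x hx]; first by rewrite rmorph0.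
    by rewrite rmorphD; exact: ID.
  by rewrite rmorphM; apply: (IZ (phi r)).
exists [seq (phi x : B^o) | x : A^o <- s]; split=> [_ /mapP [x /hs hx ->] //|y Iy].
have [x ex] := surj y; move: (Iy); rewrite -ex => /gs {hs gs}.
elim: s x {ex} => [|a s IH] x /=; first by move=> ->; rewrite rmorph0.
move=> [c [z [gz ->]]]; exists (phi c), (phi z); split; first exact: IH.
by rewrite rmorphD rmorphM.
Qed.

(** Induction through the surjection from polynomials in one variable over the smaller ring that
    sends the variable to the last one. *)
Lemma noetherian_mpoly (F : fieldType) n : noetherian {mpoly F[n]}^o.
Proof.
elim: n => [|n IH].
  move=> I [I0 ID IZ]; have [[c [Ic c0]]|no] := boolp.pselect (exists c, I c /\ c != 0).
    exists [:: c]; split=> [x|x Ix]; first by rewrite inE => /eqP ->.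
    exists (x * c^-1), 0; split=> //; rewrite addr0 /GRing.scale /= mulrVK //.
    move: c0; rewrite (nvar0_mpolyC c) => c0.
    apply/unitrPr; exists ((c@_0%MM)^-1)%:MP; rewrite -mpolyCM divff ?mpolyC1 //.
    by move: c0; rewrite mpolyC_eq0.
  exists [::]; split=> // x Ix /=; apply: boolp.contrapT => /eqP x0.
  by apply: no; exists x.
pose phi0 := (@horner_eval {mpoly F[n.+1]} 'X_ord_max \o map_poly (@mwiden n F)).
pose phi : {rmorphism {poly {mpoly F[n]}} -> {mpoly F[n.+1]}} := phi0.
apply: (noetherian_surj (phi := phi)); last exact: noetherian_poly.
have im_ind (P := fun y => exists x, phi x = y) : (forall c, P c%:MP) -> (forall i, P 'X_i) ->
    forall y, P y.
  move=> hC hX y; rewrite (mpolyE y).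
  apply: (big_ind P) => [|_ _ [x <-] [z <-]|m _].
  - by exists 0; rewrite rmorph0.
  - by exists (x + z); rewrite rmorphD.
  have [c ec] := hC y@_m; rewrite -mul_mpolyC -ec mpolyXE_id.
  have [z ez] : P (\prod_(i < n.+1) 'X_i ^+ m i).
    apply: (big_ind P) => [|_ _ [x <-] [z <-]|i _].
    - by exists 1; rewrite rmorph1.
    - by exists (x * z); rewrite rmorphM.
    by have [x ex] := hX i; exists (x ^+ m i); rewrite rmorphXn ex.
  by exists (c * z); rewrite rmorphM ez.
apply: im_ind => [c|i].
  by exists (c%:MP)%:P; rewrite /phi /phi0 /= map_polyC /= /horner_eval hornerC mwidenC.
case: (unliftP ord_max i) => [j ->|->].
  exists ('X_j)%:P; rewrite /phi /phi0 /= map_polyC /= /horner_eval hornerC mwidenX mnmwiden1.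
  by congr 'X_[U_(_)]; apply: val_inj; rewrite /= /bump leqNgt ltn_ord.
by exists 'X; rewrite /phi /phi0 /= map_polyX /horner_eval hornerX.
Qed.

Section MinimalSyzygies.
Variables (F : fieldType) (n : nat).
Local Notation R := {mpoly F[n]}.

(** The component of degree [k] in the graded free module with shifts [e]. *)
Definition gcomp p (e : 'I_p -> nat) k (v : 'rV[R]_p) : 'rV[R]_p :=
  \row_i (if (e i <= k)%N then pihomog mdeg (k - e i) (v 0 i) else 0).

Lemma gcomp0 p (e : 'I_p -> nat) k : gcomp e k 0 = 0.
Proof. by apply/matrixP => i j; rewrite !mxE raddf0 if_same. Qed.

Lemma gcomp_mulmx p q (e : 'I_p -> nat) (f : 'I_q -> nat) (M : 'M[R]_(p, q)) k v :
  graded_map e f M -> gcomp e k v *m M = gcomp f k (v *m M).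
Proof.
move=> gM; apply/matrixP => i j; rewrite ord1 {i} !mxE.
transitivity (\sum_i (if (f j <= k)%N then pihomog mdeg (k - f j) (v 0 i * M i j) else 0)).
  apply: eq_bigr => i _; rewrite mxE.
  have := gM i j; case: ifP => fe; last by move=> /eqP ->; rewrite !mulr0 raddf0 if_same.
  move=> hM; rewrite (pihomogMr _ _ hM); case: (leqP (e i) k) => ek.
    rewrite (leq_trans fe ek) leq_sub2r //; congr (pihomog _ _ _ * _); lia.
  by rewrite mul0r; case: ifP => // fk; rewrite leqNgt ltn_sub2r //; apply: leq_ltn_trans ek.
by case: ifP => _; [rewrite raddf_sum | rewrite big1].
Qed.

Lemma gcomp_sum p (e : 'I_p -> nat) v : exists B, v = \sum_(k < B) gcomp e k v.
Proof.
exists (\max_i (e i + msize (v 0%R i)))%N; apply/matrixP => z i; rewrite !ord1.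
apply/mpolyP => m; rewrite summxE raddf_sum /=.
have E k : (gcomp e k v 0 i)@_m = if k == (e i + mdeg m)%N then (v 0 i)@_m else 0.
  rewrite mxE; case: leqP => le; last first.
    by rewrite mcoeff0 ltn_eqF // (leq_trans le) // leq_addr.
  by rewrite mcoeff_pihomog -(eqn_add2l (e i)) subnKC // eq_sym.
under eq_bigr => k _ do rewrite E.
have [lt|ge] := ltnP (e i + mdeg m) (\max_i (e i + msize (v 0%R i))).
  rewrite (bigD1 (Ordinal lt)) //= eqxx big1 ?addr0 // => k.
  by rewrite -val_eqE /= => /negbTE ->.
rewrite big1 => [|k _]; last by rewrite ltn_eqF // (leq_trans (ltn_ord k)).
apply/memN_msupp_eq0/msize_mdeg_ge; rewrite -(leq_add2l (e i)).
exact: leq_trans (leq_bigmax i) ge.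
Qed.

Lemma gcomp_idem p (e : 'I_p -> nat) k v : gcomp e k (gcomp e k v) = gcomp e k v.
Proof.
by apply/matrixP => z i; rewrite ord1 !mxE; case: (_ <= _)%N; rewrite ?pihomog_id.
Qed.

Lemma gcomp_homog p (e : 'I_p -> nat) k v i : gcomp e k v = v ->
  if (e i <= k)%N then v 0 i \is (k - e i).-homog else v 0 i == 0.
Proof.
move=> h; have := congr1 (fun x : 'rV_p => x 0 i) h; rewrite mxE.
by case: ifP => _ <- //; exact: pihomogP.
Qed.

(** The kernel is finitely generated, and the components of generators are homogeneous generators
    because the map is graded. A homogeneous generating list of least length is minimal. *)
Lemma minimal_syzygies p q (e : 'I_p -> nat) (f : 'I_q -> nat) (M : 'M[R]_(p, q)) :
  graded_map e f M ->
  exists p' (e' : 'I_p' -> nat) (M' : 'M[R]_(p', p)),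
    [/\ graded_map e' e M', exact_at M' M & forall v : 'rV[R]_p', v *m M' = 0 -> in_irrelevant v].
Proof.
move=> gM; pose U (v : 'rV[R]_p) := v *m M = 0.
have sU : submodule U.
  split=> [|x y hx hy|r x hx]; rewrite /U ?mul0mx // ?mulmxDl ?hx ?hy ?addr0 //.
  by rewrite -scalemxAl hx scaler0.
pose good_gens (s : seq (nat * 'rV[R]_p)) :=
  (forall x, x \in s -> U x.2 /\ gcomp e x.1 x.2 = x.2)
  /\ forall v, U v -> gen [seq x.2 | x <- s] v.
have [s0 gs0] : exists s, good_gens s.
  have [s [hs gs]] := noetherian_rV (@noetherian_mpoly F n) sU.
  have Uc k v : U v -> U (gcomp e k v) by move=> Uv; rewrite /U (gcomp_mulmx _ _ gM) Uv gcomp0.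
  have [B hB] := boolp.choice (gcomp_sum e).
  pose comps v := [seq (k, gcomp e k v) | k <- iota 0 (B v)].
  exists (flatten [seq comps v | v <- s]); split.
    move=> x /flattenP [_ /mapP [v vs ->] /mapP [k _ ->]] /=.
    by split; [apply/Uc/hs | exact: gcomp_idem].
  move=> v /gs; apply: gen_trans => y ys; rewrite (hB y); apply: gen_sum => k _.
  apply: gen_mem; apply/mapP; exists (k : nat, gcomp e k y) => //.
  apply/flattenP; exists (comps y); first exact: map_f.
  by apply/mapP; exists (k : nat) => //; rewrite mem_iota add0n ltn_ord.
have ex : exists k, boolp.asbool (exists s, good_gens s /\ size s = k).
  by exists (size s0); apply/boolp.asboolP; exists s0.
case: (ex_minnP ex) => p' /boolp.asboolP [s [[hs gs] sz]] minp.
pose X (i : 'I_p') := nth (0%N, 0 : 'rV[R]_p) s i.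
have Xs i : X i \in s by rewrite mem_nth // sz.
pose e' i := (X i).1; pose M' : 'M[R]_(p', p) := \matrix_(i, j) (X i).2 0 j.
have rowM' i : row i M' = (X i).2.
  by apply/matrixP => z j; rewrite !mxE ord1.
have gM' : graded_map e' e M'.
  by move=> i j; rewrite mxE; apply: gcomp_homog; have [] := hs _ (Xs i).
have M'M : M' *m M = 0.
  by apply/row_matrixP => i; rewrite row_mul rowM' row0; have [] := hs _ (Xs i).
have mulE (u : 'rV_p') : u *m M' = \sum_i u 0 i *: (X i).2.
  by rewrite mulmx_sum_row; apply: eq_bigr => i _; rewrite rowM'.
exists p', e', M'; split=> // [v|v vM'].
  split=> [Uv|[u ->]]; last by rewrite -mulmxA M'M mulmx0.
  have [u ->] := (gen_nthP _ _).1 (gs v Uv).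
  have szs : size [seq x.2 | x <- s] = p' by rewrite size_map.
  exists (\row_i u (cast_ord (esym szs) i)); rewrite mulE.
  rewrite (reindex (cast_ord (esym szs))) /=; last first.
    by exists (cast_ord szs) => i _; rewrite ?cast_ordK ?cast_ordKV.
  by apply: eq_bigr => i _; rewrite mxE (nth_map (0%N, 0)) ?sz.
move=> z j; rewrite ord1 {z}; apply: boolp.contrapT => /eqP nz.
(* A relation with a unit coefficient at j makes the j-th generator redundant. *)
pose w := gcomp e' (e' j) v.
have wM' : w *m M' = 0 by rewrite (gcomp_mulmx _ _ gM') vM' gcomp0.
have wj : w 0 j = ((v 0 j)@_0%MM)%:MP.
  rewrite mxE leqnn subnn; apply/mpolyP => m; rewrite mcoeff_pihomog mcoeffC mdeg_eq0.
  by case: eqP => [->|]; rewrite ?mulr1 ?mulr0.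
pose s' := take j s ++ drop j.+1 s.
have js : (j < size s)%N by rewrite sz.
have inX i : i != j -> X i \in s'.
  rewrite -val_eqE /= neq_ltn mem_cat => /orP[lt|lt]; apply/orP; [left|right].
    by apply/(nthP (0%N, 0)); exists i; rewrite ?nth_take // size_take js.
  apply/(nthP (0%N, 0)); exists (i - j.+1)%N; last by rewrite nth_drop subnKC.
  by rewrite size_drop ltn_sub2r // ?sz // (leq_ltn_trans lt).
have genX i : gen [seq x.2 | x <- s'] (X i).2.
  have [->|ne] := eqVneq i j; last by apply/gen_mem/map_f/inX.
  have e0 : w 0 j *: (X j).2 + \sum_(i | i != j) w 0 i *: (X i).2 = 0.
    by have := wM'; rewrite mulE (bigD1 j).
  have -> : (X j).2 = (((v 0 j)@_0%MM)^-1)%:MP *: (w 0 j *: (X j).2).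
    by rewrite scalerA wj -mpolyCM mulVf // mpolyC1 scale1r.
  apply: genZ; move/eqP: e0; rewrite addr_eq0 => /eqP ->; apply/genN/gen_sum => k ne.
  by apply/genZ/gen_mem/map_f/inX.
have : (p' <= size s')%N.
  apply: minp; apply/boolp.asboolP; exists s'; split=> //; split=> [x|u Uu].
    by rewrite mem_cat => /orP[/mem_take|/mem_drop]; exact: hs.
  apply: gen_trans (gs u Uu) => y /mapP [x xs ->].
  have := nth_index (0%N, 0) xs; have : (index x s < p')%N by rewrite -sz index_mem.
  move=> lt <-; exact: (genX (Ordinal lt)).
by rewrite size_cat size_take size_drop js sz; have := ltn_ord j; lia.
Qed.

(** One differential packed with its ranks and shifts, which change at every step, so that the
    construction can be iterated. *)
Record resolution_stage := ResolutionStage {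
  stage_p : nat; stage_e : 'I_stage_p -> nat;
  stage_q : nat; stage_f : 'I_stage_q -> nat;
  stage_mx : 'M[R]_(stage_p, stage_q);
  stage_graded : graded_map stage_e stage_f stage_mx }.

Lemma next_stage (s : resolution_stage) :
  exists t : {x : nat & ('I_x -> nat) * 'M[R]_(x, stage_p s)}%type,
    [/\ graded_map (tagged t).1 (@stage_e s) (tagged t).2, exact_at (tagged t).2 (stage_mx s)
      & forall v : 'rV[R]_(tag t), v *m (tagged t).2 = 0 -> in_irrelevant v].
Proof.
have [p' [e' [M' h]]] := minimal_syzygies (stage_graded (r := s)).
by exists (Tagged (fun x => ('I_x -> nat) * 'M[R]_(x, stage_p s))%type (e', M')).
Qed.

Definition next_data (s : resolution_stage) := projT1 (boolp.cid (next_stage s)).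

Lemma next_dataP s :
  [/\ graded_map (tagged (next_data s)).1 (@stage_e s) (tagged (next_data s)).2,
      exact_at (tagged (next_data s)).2 (stage_mx s)
    & forall v : 'rV[R]_(tag (next_data s)), v *m (tagged (next_data s)).2 = 0 -> in_irrelevant v].
Proof. exact: projT2 (boolp.cid (next_stage s)). Qed.

Definition next (s : resolution_stage) : resolution_stage :=
  ResolutionStage (let: And3 g _ _ := next_dataP s in g).

Lemma in_irrelevant_exact p q r (M : 'M[R]_(p, q)) (N : 'M[R]_(q, r)) :
  exact_at M N -> (forall v : 'rV_q, v *m N = 0 -> in_irrelevant v) -> in_irrelevant M.
Proof.
move=> ex minN i j; have := minN (row i M) _ 0 j; rewrite mxE; apply.
by apply/ex; exists (delta_mx 0 i); rewrite rowE.
Qed.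

Lemma extend_resolution b1 b2 (I : {pred R}) (Q : 'cV[R]_b1) (M : 'M[R]_(b2, b1)) :
  graded_map (fun _ => 3%N) (fun _ => 2%N) M -> graded_map (fun _ => 2%N) (fun _ => 0%N) Q ->
  (forall f : R, f \in I <-> exists v : 'rV[R]_b1, f = (v *m Q) 0 0) ->
  exact_at M Q ->
  (forall v : 'rV[R]_b1, v *m Q = 0 -> in_irrelevant v) ->
  (forall v : 'rV[R]_b2, v *m M = 0 -> in_irrelevant v) ->
  exists C, minimal_resolution I C /\ resolution_starts b1 b2 C.
Proof.
move=> gM gQ IQ exMQ minQ minM.
pose T k := iter k next (ResolutionStage gM).
have minT k (v : 'rV[R]_(stage_p (T k))) : v *m stage_mx (T k) = 0 -> in_irrelevant v.
  by case: k v => [|k] v; [exact: minM | have [_ _ h] := next_dataP (T k); exact: h].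
(* Ranks are read off the targets: the target of [next s] is the source of [s] by conversion, so the
   matrices fit without casts. *)
pose rk k := if k is k'.+1 then stage_q (T k') else 1%N.
pose sh k : 'I_(rk k) -> nat := if k is k'.+1 then @stage_f (T k') else fun=> 0%N.
pose df k : 'M[R]_(rk k.+1, rk k) := if k is k'.+1 then stage_mx (T k') else Q.
exists (@FreeComplex F n rk sh (1%:M : 'cV_1) df); split; last first.
  by split; split.
split=> /=.
- split; first by move=> i j; rewrite !ord1 mxE eqxx; exact: dhomog1.
  case=> [|k] /=; first exact: gQ.
  exact: (@stage_graded (T k)).
- move=> f; exists f%:M; rewrite mulmx1 mxE eqxx mulr1n subrr.
  by apply/IQ; exists 0; rewrite mul0mx mxE.
- move=> v; rewrite mulmx1; split=> [/IQ [u e]|[u ->]]; last by apply/IQ; exists u.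
  by exists u; apply/matrixP => i j; rewrite !ord1.
- by case=> [|k] /=; [exact: exMQ | have [_ h _] := next_dataP (T k)].
- case=> [|[|k]] /=.
  + move=> i j; have := gQ i j; rewrite /= subn0 => hQ.
    by apply: (dhomog_nemf_coeff hQ); rewrite /= mdeg0.
  + exact: in_irrelevant_exact exMQ minQ.
  + have [_ h _] := next_dataP (T k); exact: in_irrelevant_exact h (@minT k).
Qed.

End MinimalSyzygies.

(** * Quadrics and linear syzygies *)

Section EulerHomotopy.
Variables (F : fieldType) (N : nat).
Hypothesis char0 : forall k, k.+1%:R != 0 :> F.
Local Notation R := {mpoly F[N]}.

Definition vars : 'cV[R]_N := \col_i 'X_i.

Lemma dhomog_mderiv k (f : R) i : f \is k.+1.-homog -> f^`M(i) \is k.-homog.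
Proof.
move=> hf; apply/dhomogP => m; rewrite mcoeff_msupp mcoeff_deriv => nz.
have hm : (m + U_(i))%MM \in msupp f.
  by rewrite mcoeff_msupp; apply: contraNneq nz => ->; rewrite mul0rn.
by have := dhomog_mf hf hm; rewrite /= mdegD mdeg1 addn1 => -[].
Qed.

Lemma euler_identity k (f : R) : f \is k.-homog -> \sum_i 'X_i * f^`M(i) = f *+ k.
Proof.
move=> hf; apply/mpolyP => m; rewrite raddf_sum /= mcoeffMn.
have E i : ('X_i * f^`M(i))@_m = f@_m *+ m i.
  rewrite mcoeffXM lep1mP; case: eqP => [->|/eqP mi]; first by rewrite mulr0n.
  have le : (U_(i) <= m)%MM by rewrite lep1mP.
  by rewrite mcoeff_deriv submK // mnmBE mnm1E eqxx subn1 prednK // lt0n.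
under eq_bigr => i _ do rewrite E.
rewrite sumrMnr -mdegE; have [ms|/memN_msupp_eq0 ->] := boolP (m \in msupp f).
  by rewrite (dhomog_mf hf ms).
by rewrite !mul0rn.
Qed.

(* Euler's identity makes the antisymmetrized Jacobian a contracting homotopy of
   the Koszul complex of R. *)
Lemma koszul_vars k (v : 'cV[R]_N) : (forall i, v i 0 \is k.+1.-homog) ->
  vars^T *m v = 0 -> exists C : 'M[R]_N,
    [/\ C^T = - C, C *m vars = v & forall i j, C i j \is k.-homog].
Proof.
move=> hv /matrixP/(_ 0 0); rewrite mxE [RHS]mxE => e0.
pose C : 'M[R]_N := \matrix_(i, j) ((k.+2%:R^-1) *: ((v i 0)^`M(j) - (v j 0)^`M(i))).
exists C; split.
- by apply/matrixP => i j; rewrite !mxE -scalerN opprB.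
- apply/matrixP => i z; rewrite ord1 {z} mxE.
  have -> : \sum_j C i j * vars j 0 = k.+2%:R^-1 *:
      (\sum_j 'X_j * (v i 0)^`M(j) - \sum_j 'X_j * (v j 0)^`M(i)).
    rewrite -sumrB scaler_sumr; apply: eq_bigr => j _.
    by rewrite !mxE mulrC -scalerAr mulrBr.
  rewrite (euler_identity (hv i)).
  have -> : \sum_j 'X_j * (v j 0)^`M(i) = - v i 0.
    have := congr1 (mderiv i) e0; rewrite mderiv0 raddf_sum /=.
    under eq_bigr => j _ do rewrite mderivM !mxE mderivX mnm1E.
    rewrite big_split /= (bigD1 i) //= eqxx scale1r big1 => [|j /negbTE ne]; last first.
      by rewrite ne scale0r mul0r.
    have -> : (U_(i) - U_(i))%MM = 0%MM :> 'X_{1..N} by apply/mnmP => j; rewrite mnmBE subnn mnm0E.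
    by rewrite mpolyX0 mul1r addr0 => /eqP; rewrite addr_eq0 => /eqP ->; rewrite opprK.
  by rewrite opprK -mulrSr -scaler_nat scalerA mulVf // scale1r.
- by move=> i j; rewrite mxE rpredZ // rpredB // dhomog_mderiv.
Qed.

Lemma vars_split k (f : R) : f \is k.+1.-homog ->
  exists v : 'cV[R]_N, (forall i, v i 0 \is k.-homog) /\ (vars^T *m v) 0 0 = f.
Proof.
move=> hf; exists (\col_i (k.+1%:R^-1 *: f^`M(i))); split=> [i|].
  by rewrite mxE rpredZ // dhomog_mderiv.
rewrite mxE; under eq_bigr => i _ do rewrite !mxE -scalerAr.
by rewrite -scaler_sumr (euler_identity hf) -scaler_nat scalerA mulVf // scale1r.
Qed.

End EulerHomotopy.

Section LinearSyzygies.
Variables (F : fieldType) (n N d : nat).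
Hypothesis char0 : forall k, k.+1%:R != 0 :> F.
Variable mf : measure n.
Local Notation S := {mpoly F[n]}.
Local Notation R := {mpoly F[N]}.
Variable ev : {rmorphism R -> S}.
Hypothesis d_pos : (0 < d)%N.
Hypothesis evC : forall c, ev c%:MP = c%:MP.
Hypothesis evX : forall i, ev 'X_i \is d.-homog for mf.
Let X : 'cV[R]_N := vars F N.
Let f0 : 'cV[S]_N := map_mx ev X.

Hypothesis lift1 : forall q (c : 'rV[S]_N),
  (forall k, c 0 k \is (q.+2 * d).-homog for mf) -> c *m f0 = 0 ->
  exists D : 'rV[R]_N, D *m X = 0 /\ map_mx ev D = c.
Hypothesis lift2 : forall q (c : 'M[S]_N), c^T = - c ->
  (forall i k, c i k \is (q.+2 * d).-homog for mf) -> c *m f0 = 0 ->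
  exists D : 'M[R]_N, [/\ D^T = - D, D *m X = 0 & map_mx ev D = c].

Let evX' i : ev 'X_i \is (d * mdeg U_(i)%MM).-homog for mf.
Proof. by rewrite mdeg1 muln1. Qed.

Lemma ev_pihomog k f : ev (pihomog mdeg k f) = pihomog mf (k * d) (ev f).
Proof. by rewrite mulnC (graded_pihomog d_pos evC evX'). Qed.

Lemma ev_homog k f : f \is k.-homog -> ev f \is (k * d).-homog for mf.
Proof. by move=> hf; rewrite mulnC (graded_hom_dhomog d_pos evC evX'). Qed.

Definition mxcomp p q k (A : 'M[R]_(p, q)) : 'M[R]_(p, q) := map_mx (pihomog mdeg k) A.

Lemma mxcomp_vars p k (A : 'M[R]_(p, N)) : A *m X = 0 -> mxcomp k A *m X = 0.
Proof.
move=> AX; apply/matrixP => i j; rewrite [RHS]mxE ord1 {j}.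
have e : \sum_z A i z * 'X_z = 0.
  have /matrixP/(_ i 0) := AX; rewrite mxE [RHS]mxE => e1; rewrite -[RHS]e1.
  by apply: eq_bigr => z _; rewrite [X _ _]mxE.
rewrite mxE; transitivity (pihomog mdeg k.+1 (\sum_z A i z * 'X_z)).
  rewrite raddf_sum /=; apply: eq_bigr => z _; rewrite [X _ _]mxE [mxcomp _ _ _ _]mxE.
  by rewrite (@pihomogMr _ _ mdeg 1) ?subn1 // dhomogX /= mdeg1.
by rewrite e raddf0.
Qed.

Lemma ideal_linear_step k f : f \is k.+3.-homog -> ev f = 0 ->
  exists v : 'cV[R]_N, [/\ forall i, v i 0 \is k.+2.-homog, forall i, ev (v i 0) = 0
    & f = (X^T *m v) 0 0].
Proof.
move=> hf ef; have [v [hv vf]] := vars_split char0 hf.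
have [||D [DX evD]] := @lift1 k (map_mx ev v^T).
- by move=> i; rewrite !mxE; apply: ev_homog.
- rewrite -map_mxM; apply/matrixP => i j; rewrite !ord1 [LHS]mxE [RHS]mxE.
  by rewrite -ef -vf -[v in RHS]trmxK -trmx_mul [in RHS]mxE.
(* The lift need not be homogeneous; its component of degree [k.+2] is still a cycle and has the
   same image. *)
exists (v - (mxcomp k.+2 D)^T); split=> [i|i|].
- by rewrite /mxcomp !mxE; apply: rpredB; [exact: hv | exact: pihomogP].
- rewrite /mxcomp !mxE rmorphB /= ev_pihomog; have /matrixP/(_ 0 i) := evD; rewrite !mxE => ->.
  by rewrite pihomog_dE ?subrr // ev_homog.
- by rewrite mulmxBr -trmx_mul (mxcomp_vars _ DX) trmx0 subr0.
Qed.

Variables (b1 : nat) (Q : 'cV[R]_b1).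
Hypothesis Q_homog : forall a, Q a 0 \is 2.-homog.
Hypothesis Q_ideal : forall a, ev (Q a 0) = 0.
Hypothesis Q_span : forall f, f \is 2.-homog -> ev f = 0 ->
  exists u : 'rV[F]_b1, f = (map_mx (@mpolyC N F) u *m Q) 0 0.
Hypothesis Q_free : forall u : 'rV[F]_b1, map_mx (@mpolyC N F) u *m Q = 0 -> u = 0.

Lemma dhomogC (c : F) : (c%:MP : R) \is 0.-homog.
Proof. by rewrite -[c]mulr1 mpolyCM mul_mpolyC mpolyC1 rpredZ // dhomog1. Qed.

Lemma ideal_homog_gen k f : f \is k.+2.-homog -> ev f = 0 ->
  exists u : 'rV[R]_b1, (forall a, u 0 a \is k.-homog) /\ f = (u *m Q) 0 0.
Proof.
elim: k f => [|k IH] f hf ef.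
  have [u ->] := Q_span hf ef; exists (map_mx (@mpolyC N F) u); split=> // a.
  by rewrite mxE dhomogC.
have [v [hv ev0 ->]] := ideal_linear_step hf ef.
have [U hU] : exists U : 'I_N -> 'rV[R]_b1, forall i,
    (forall a, U i 0 a \is k.-homog) /\ v i 0 = (U i *m Q) 0 0.
  apply: (@fin_all_exists _ (fun=> 'rV[R]_b1)
    (fun i u => (forall a, u 0 a \is k.-homog) /\ v i 0 = (u *m Q) 0 0)) => i.
  exact: IH.
pose UM : 'M[R]_(N, b1) := \matrix_(i, a) U i 0 a.
have vU : v = UM *m Q.
  apply/matrixP => i z; rewrite ord1 (hU i).2 !mxE; apply: eq_bigr => a _.
  by rewrite mxE.
exists (X^T *m UM); split; last by rewrite vU mulmxA.
move=> a; rewrite mxE rpred_sum // => i _; rewrite -[k.+1]add1n dhomogM //.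
  by rewrite !mxE dhomogX /= mdeg1.
by rewrite mxE; have [] := hU i.
Qed.

(** Write h = X^T H0. The column H0 Q is a Koszul cycle over R, hence equals C X with C
    antisymmetric, and C becomes a 2-cycle over A. Subtracting a lift of it leaves C' with entries
    in the ideal and C' X = H0 Q. Expanding C' in the quadrics with antisymmetric coefficients A_a,
    the matrix W with columns A_a X satisfies W Q = H0 Q and X^T W = 0, so H0 - W is the required
    matrix. *)
Lemma syzygy_linear_step j (h : 'rV[R]_b1) : (forall a, h 0 a \is j.+2.-homog) ->
  h *m Q = 0 -> exists H : 'M[R]_(N, b1),
    [/\ h = X^T *m H, H *m Q = 0 & forall i a, H i a \is j.+1.-homog].
Proof.
move=> hh hQ.
have [V hV] : exists V : 'I_b1 -> 'cV[R]_N, forall a,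
    (forall i, V a i 0 \is j.+1.-homog) /\ (X^T *m V a) 0 0 = h 0 a.
  apply: (@fin_all_exists _ (fun=> 'cV[R]_N)
    (fun a v => (forall i, v i 0 \is j.+1.-homog) /\ (X^T *m v) 0 0 = h 0 a)) => a.
  exact: vars_split.
pose H0 : 'M[R]_(N, b1) := \matrix_(i, a) V a i 0.
have hH0 i a : H0 i a \is j.+1.-homog by rewrite mxE; have [] := hV a.
have hXH0 : X^T *m H0 = h.
  apply/matrixP => z a; rewrite ord1 -(hV a).2 !mxE; apply: eq_bigr => i _.
  by rewrite [H0 _ _]mxE.
have hf i : (H0 *m Q) i 0 \is j.+3.-homog.
  by rewrite mxE rpred_sum // => a _; rewrite -[j.+3](addn2 j.+1) dhomogM.
have evf : map_mx ev (H0 *m Q) = 0.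
  apply/matrixP => i z; rewrite ord1 !mxE rmorph_sum big1 // => a _ /=.
  by rewrite rmorphM /= Q_ideal mulr0.
have [|C [antiC CX hC]] := koszul_vars char0 hf; first by rewrite mulmxA hXH0 hQ.
have [|||D [antiD DX evD]] := @lift2 j (map_mx ev C).
- by rewrite map_trmx antiC map_mxN.
- by move=> i k; rewrite mxE ev_homog.
- by rewrite -map_mxM CX evf.
pose C' := C - mxcomp j.+2 D.
have antiD' : (mxcomp j.+2 D)^T = - mxcomp j.+2 D.
  apply/matrixP => i k; rewrite /mxcomp !mxE; have /matrixP/(_ i k) := antiD; rewrite !mxE => ->.
  by rewrite raddfN.
have antiC' : C'^T = - C' by rewrite linearB /= antiC antiD' opprB opprK addrC.
have C'X : C' *m X = H0 *m Q by rewrite mulmxBl CX (mxcomp_vars _ DX) subr0.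
have hC' i k : C' i k \is j.+2.-homog by rewrite /C' /mxcomp !mxE; apply: rpredB; [exact: hC | exact: pihomogP].
have evC' i k : ev (C' i k) = 0.
  rewrite /C' /mxcomp !mxE rmorphB /= ev_pihomog; have /matrixP/(_ i k) := evD; rewrite !mxE => ->.
  by rewrite pihomog_dE ?subrr // ev_homog.
have [u hu] : exists u : 'I_N * 'I_N -> 'rV[R]_b1, forall x,
    (forall a, u x 0 a \is j.-homog) /\ C' x.1 x.2 = (u x *m Q) 0 0.
  apply: (@fin_all_exists _ (fun=> 'rV[R]_b1)
    (fun x v => (forall a, v 0 a \is j.-homog) /\ C' x.1 x.2 = (v *m Q) 0 0)) => x.
  exact: ideal_homog_gen.
have two : 2%:R != 0 :> F by exact: char0.
(* Averaging over transposition makes each coefficient matrix antisymmetric, which is what makes X^T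
   A_a X vanish. *)
pose A a : 'M[R]_N := \matrix_(i, k) (2%:R^-1 *: (u (i, k) 0 a - u (k, i) 0 a)).
have antiA a : (A a)^T = - A a.
  by apply/matrixP => i k; rewrite !mxE -scalerN opprB.
have C'A i k : C' i k = \sum_a A a i k * Q a 0.
  have e : C' i k = 2%:R^-1 *: (C' i k - C' k i).
    have /matrixP/(_ i k) := antiC'; rewrite mxE [RHS]mxE => ->; rewrite opprK -mulr2n.
    by rewrite -scaler_nat scalerA mulVf // scale1r.
  rewrite e (hu (i, k)).2 (hu (k, i)).2 !mxE -sumrB scaler_sumr; apply: eq_bigr => a _.
  by rewrite !mxE -scalerAl mulrBl.
pose W : 'M[R]_(N, b1) := \matrix_(i, a) (A a *m X) i 0.
exists (H0 - W); split.
- rewrite mulmxBr hXH0; have -> : X^T *m W = 0; last by rewrite subr0.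
  apply/matrixP => z a; rewrite ord1 [RHS]mxE.
  have := antisym_form two X (antiA a); rewrite -mulmxA => /matrixP/(_ 0 0).
  rewrite [RHS]mxE => <-; rewrite mxE [RHS]mxE; apply: eq_bigr => i _.
  by rewrite [W _ _]mxE.
- rewrite mulmxBl -C'X; apply/eqP; rewrite subr_eq0; apply/eqP/matrixP => i z.
  rewrite ord1 !mxE; under eq_bigr => k _ do rewrite C'A mulr_suml.
  rewrite exchange_big /=; apply: eq_bigr => a _; rewrite !mxE mulr_suml.
  by apply: eq_bigr => k _; rewrite mulrAC.
- move=> i a; have -> : (H0 - W) i a = H0 i a - W i a by rewrite mxE [X in _ + X]mxE.
  rewrite rpredB // [W _ _]mxE mxE rpred_sum // => k _.
  rewrite -[j.+1]addn1 dhomogM //; last by rewrite !mxE dhomogX /= mdeg1.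
  by rewrite mxE rpredZ // rpredB //; [have [] := hu (i, k) | have [] := hu (k, i)].
Qed.

End LinearSyzygies.

Section LinearPresentation.
Variables (F : fieldType) (N : nat) (S : nzRingType).
Local Notation R := {mpoly F[N]}.
Variable ev : {rmorphism R -> S}.
Hypothesis evC_inj : forall c : F, ev c%:MP = 0 -> c = 0.
Hypothesis ev1_inj : forall f, f \is 1.-homog -> ev f = 0 -> f = 0.
Hypothesis ev_comp : forall k f, ev f = 0 -> ev (pihomog mdeg k f) = 0.
Variables (b1 b2 : nat) (Q : 'cV[R]_b1) (M : 'M[R]_(b2, b1)).
Local Notation C := (map_mx (@mpolyC N F)).
Hypothesis Q_homog : forall a, Q a 0 \is 2.-homog.
Hypothesis Q_ideal : forall a, ev (Q a 0) = 0.
Hypothesis Q_free : forall u : 'rV[F]_b1, C u *m Q = 0 -> u = 0.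
Hypothesis Q_gen : forall k f, f \is k.+2.-homog -> ev f = 0 ->
  exists u : 'rV[R]_b1, f = (u *m Q) 0 0.
Hypothesis M_homog : forall i a, M i a \is 1.-homog.
Hypothesis M_syz : M *m Q = 0.
Hypothesis M_free : forall u : 'rV[F]_b2, C u *m M = 0 -> u = 0.
Hypothesis M_span : forall h : 'rV[R]_b1, (forall a, h 0 a \is 1.-homog) -> h *m Q = 0 ->
  exists u : 'rV[F]_b2, h = C u *m M.
Hypothesis linear_step : forall j (h : 'rV[R]_b1), (forall a, h 0 a \is j.+2.-homog) ->
  h *m Q = 0 -> exists H : 'M[R]_(N, b1),
    [/\ h = (vars F N)^T *m H, H *m Q = 0 & forall i a, H i a \is j.+1.-homog].

Lemma dhomog0C (f : R) : f \is 0.-homog -> f = (f@_0%MM)%:MP.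
Proof.
move=> hf; apply/mpolyP => m; rewrite mcoeffC; have [->|ne] := eqVneq m 0%MM.
  by rewrite mulr1.
by rewrite mulr0; apply: (dhomog_nemf_coeff hf); rewrite /= mdeg_eq0.
Qed.

Lemma Q_graded : graded_map (fun=> 2) (fun=> 0%N) Q.
Proof. by move=> i j; rewrite ord1 leq0n subn0; exact: Q_homog. Qed.

Lemma M_graded : graded_map (fun=> 3) (fun=> 2) M.
Proof. by move=> i j; exact: M_homog. Qed.

(** The component of degree [c] of a relation is again a relation, and its entries are the constant
    terms; independence over the field makes them zero. *)
Lemma in_irrelevant_free p q c (f : 'I_q -> nat) (A : 'M[R]_(p, q)) :
  graded_map (fun=> c) f A -> (forall u : 'rV[F]_p, C u *m A = 0 -> u = 0) ->
  forall v : 'rV[R]_p, v *m A = 0 -> in_irrelevant v.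
Proof.
move=> gA free v vA i j; rewrite ord1 {i}.
have : C (\row_i (v 0 i)@_0%MM) *m A = 0.
  have -> : C (\row_i (v 0 i)@_0%MM) = gcomp (fun=> c) c v.
    apply/matrixP => i k; rewrite ord1 !mxE leqnn subnn [RHS]dhomog0C ?pihomogP //.
    by rewrite mcoeff_pihomog /= mdeg0 eqxx.
  by rewrite (gcomp_mulmx _ _ gA) vA gcomp0.
by move=> /free /matrixP/(_ 0 j); rewrite !mxE.
Qed.

Lemma ideal_gen f : ev f = 0 <-> exists v : 'rV[R]_b1, f = (v *m Q) 0 0.
Proof.
split=> [ef|[v ->]]; last first.
  by rewrite mxE rmorph_sum big1 // => a _; rewrite rmorphM /= Q_ideal mulr0.
have ek k : exists v : 'rV[R]_b1, pihomog mdeg k f = (v *m Q) 0 0.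
  have hk := pihomogP mdeg k f; have := ev_comp k ef.
  case: k hk => [|[|k]] hk e; last exact: Q_gen hk e.
    exists 0; rewrite mul0mx mxE; move: (e); rewrite (dhomog0C hk) => /evC_inj ->.
    by rewrite mpolyC0.
  by exists 0; rewrite mul0mx mxE (ev1_inj hk e).
rewrite (pihomog_partitionE (leqnn (msize f))).
have [V hV] := boolp.choice ek.
exists (\sum_(k < msize f) V k); rewrite mulmx_suml summxE.
exact: eq_bigr.
Qed.

(** Induction on the degree of a homogeneous syzygy: independence of the quadrics in degree 0, the
    chosen basis in degree 1, and [linear_step] above. *)
Lemma syzygy_gen : exact_at M Q.
Proof.
move=> v; split=> [vQ|[u ->]]; last by rewrite -mulmxA M_syz mulmx0.
have base j (h : 'rV[R]_b1) : (forall a, h 0 a \is j.-homog) -> h *m Q = 0 ->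
    exists u : 'rV[R]_b2, h = u *m M.
  elim: j h => [|[|j] IH] h hh hQ.
  - exists 0; rewrite mul0mx; have e : h = C (\row_a (h 0 a)@_0%MM).
      by apply/matrixP => i a; rewrite ord1 !mxE -dhomog0C.
    by rewrite e (Q_free (u := \row_a (h 0 a)@_0%MM)) ?map_mx0 // -e.
  - by have [u ->] := M_span hh hQ; exists (C u).
  have [H [-> HQ hH]] := linear_step hh hQ.
  have [U hU] : exists U : 'I_N -> 'rV[R]_b2, forall i, row i H = U i *m M.
    apply: (@fin_all_exists _ (fun=> 'rV[R]_b2) (fun i u => row i H = u *m M)) => i.
    by apply: IH => [a|]; rewrite ?mxE // -row_mul HQ row0.
  exists ((vars F N)^T *m \matrix_i U i); rewrite -mulmxA; congr (_ *m _).
  by apply/row_matrixP => i; rewrite row_mul rowK.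
have ek k : exists u : 'rV[R]_b2, gcomp (fun=> 2) k v = u *m M.
  have [k2|k2] := leqP 2 k; last first.
    by exists 0; rewrite mul0mx; apply/matrixP => i a; rewrite !mxE leqNgt k2.
  apply: (base (k - 2)%N) => [a|]; first by rewrite mxE k2; exact: pihomogP.
  by rewrite (gcomp_mulmx _ _ Q_graded) vQ gcomp0.
have [U hU] := boolp.choice ek; have [B ->] := gcomp_sum (fun=> 2) v.
by exists (\sum_(k < B) U k); rewrite mulmx_suml; exact: eq_bigr.
Qed.

Lemma linear_N2_presentation (I : {pred R}) : (forall f, f \in I <-> ev f = 0) ->
  N2_presentation I.
Proof.
move=> hI; exists b2, b1, M, Q; split.
- by split; [exact: M_graded | exact: Q_graded].
- by move=> f; apply: (iff_trans (hI f)); exact: ideal_gen.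
- exact: syzygy_gen.
- exact: in_irrelevant_free Q_graded Q_free.
- exact: in_irrelevant_free M_graded M_free.
Qed.

Lemma linear_resolution (I : {pred R}) : (forall f, f \in I <-> ev f = 0) ->
  exists C, minimal_resolution I C /\ resolution_starts b1 b2 C.
Proof.
move=> hI; apply: (extend_resolution M_graded Q_graded).
- by move=> f; apply: (iff_trans (hI f)); exact: ideal_gen.
- exact: syzygy_gen.
- exact: in_irrelevant_free Q_graded Q_free.
- exact: in_irrelevant_free M_graded M_free.
Qed.

End LinearPresentation.

(** * Betti numbers as dimensions of graded pieces *)

Section GradedDimensions.
Variables (F : fieldType) (n r d : nat) (mf : measure n).
Local Notation S := {mpoly F[n]}.
Local Notation R := {mpoly F[r.+1]}.
Variable ev : {rmorphism R -> S}.
Hypothesis evC : forall c, ev c%:MP = c%:MP.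
Hypothesis ev_graded : forall k f, f \is k.-homog -> ev f \is (k * d).-homog for mf.
Hypothesis ev_surj : forall k f, f \is (k * d).-homog for mf ->
  exists2 p, p \is k.-homog & ev p = f.
Variable mons : nat -> seq 'X_{1..n}.
Hypothesis mons_uniq : forall k, uniq (mons k).
Hypothesis mem_mons : forall k m, (m \in mons k) = (mf m == k * d)%N.
Local Notation C := (map_mx (@mpolyC r.+1 F)).

Section Degree.
Variable k : nat.

Definition coords (f : S) : 'rV[F]_(size (mons k)) := \row_j f@_(nth 0%MM (mons k) j).

Definition ev_coords (p : dhomog r.+1 F k) := coords (ev (val p)).

Lemma ev_coords_linear : linear ev_coords.
Proof.
move=> c p q; apply/matrixP => i j; rewrite !mxE linearP /= -mul_mpolyC rmorphD rmorphM /=.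
by rewrite evC mul_mpolyC mcoeffD mcoeffZ.
Qed.

HB.instance Definition _ :=
  GRing.isLinear.Build F (dhomog r.+1 F k) 'rV[F]_(size (mons k)) _ ev_coords ev_coords_linear.

Lemma coords_eq0 f : f \is (k * d).-homog for mf -> (coords f == 0) = (f == 0).
Proof.
move=> hf; apply/eqP/eqP => [/matrixP e|->]; last by apply/matrixP => i j; rewrite !mxE mcoeff0.
apply/mpolyP => m; rewrite mcoeff0; have [hm|hm] := boolP (m \in mons k).
  have lt : (index m (mons k) < size (mons k))%N by rewrite index_mem.
  by have := e 0 (Ordinal lt); rewrite !mxE /= nth_index.
by apply: (dhomog_nemf_coeff hf); rewrite -mem_mons.
Qed.

Definition degree_kernel : {vspace dhomog r.+1 F k} := lker (linfun ev_coords).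

Lemma mem_degree_kernel p : (p \in degree_kernel) = (ev (val p) == 0).
Proof. by rewrite memv_ker lfunE /= coords_eq0 // ev_graded // dhomog_is_dhomog. Qed.

(** Rank and nullity of the evaluation map from the forms of degree [k] onto the span of
    [mons k]. *)
Lemma dim_degree_kernel : \dim degree_kernel = ('C(k + r, k) - size (mons k))%N.
Proof.
have := limg_ker_dim (linfun ev_coords) fullv.
have -> : limg (linfun ev_coords) = fullv.
  apply/vspaceP => v; rewrite memvf; apply/memv_imgP.
  pose f : S := \sum_j v 0 j *: 'X_[nth 0%MM (mons k) j].
  have hf : f \is (k * d).-homog for mf.
    rewrite rpred_sum // => j _; rewrite rpredZ // dhomogX -mem_mons.
    by rewrite mem_nth.
  have [p hp e] := ev_surj hf; exists (DHomog hp); rewrite ?memvf // lfunE.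
  apply/matrixP => i j; rewrite ord1 /= /ev_coords /= e mxE raddf_sum /= (bigD1 j) //=.
  rewrite mcoeffZ mcoeffX eqxx mulr1 big1 ?addr0 // => l ne; rewrite mcoeffZ mcoeffX.
  by rewrite nth_uniq // (inj_eq val_inj) (negbTE ne) mulr0.
rewrite capfv !dimvf => e; have : dim (dhomog r.+1 F k) = 'C(k + r, k) by [].
by rewrite -e => <-; rewrite -[dim 'rV_ _]/(1 * size (mons k))%N mul1n addnK.
Qed.

Lemma degree_kernel_basis : exists Q : 'cV[R]_('C(k + r, k) - size (mons k)),
  [/\ forall a, Q a 0 \is k.-homog, forall a, ev (Q a 0) = 0,
      forall f, f \is k.-homog -> ev f = 0 -> exists u : 'rV[F]_('C(k + r, k) - size (mons k)),
        f = (C u *m Q) 0 0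
    & forall u : 'rV[F]_('C(k + r, k) - size (mons k)), C u *m Q = 0 -> u = 0].
Proof.
rewrite -dim_degree_kernel; pose K := degree_kernel; pose B := vbasis K.
pose Q : 'cV[R]_(\dim K) := \col_a val B`_a.
have QE (u : 'rV[F]_(\dim K)) : (C u *m Q) 0 0 = val (\sum_a u 0 a *: B`_a).
  rewrite mxE linear_sum; apply: eq_bigr => a _.
  by rewrite !mxE linearZ /= mul_mpolyC.
exists Q; split.
- by move=> a; rewrite mxE dhomog_is_dhomog.
- move=> a; apply/eqP; rewrite mxE -mem_degree_kernel.
  by apply: vbasis_mem; rewrite mem_nth // size_tuple.
- move=> f hf ef; have hK : DHomog hf \in K by rewrite mem_degree_kernel /= ef.
  exists (\row_a coord B a (DHomog hf)); rewrite QE.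
  rewrite [LHS](_ : f = val (DHomog hf)) //; congr val.
  by rewrite {1}(coord_vbasis hK); apply: eq_bigr => a _; rewrite mxE.
- move=> u /matrixP/(_ 0 0); rewrite QE mxE => e.
  have /freeP fB := basis_free (vbasisP K).
  apply/matrixP => i a; rewrite ord1 mxE; apply: (fB (fun a => u 0 a)).
  exact: val_inj.
Qed.

End Degree.

Section LinearSyzygyBasis.
Variables (b1 : nat) (Q : 'cV[R]_b1).
Hypothesis Q_homog : forall a, Q a 0 \is 2.-homog.
Hypothesis Q_ideal : forall a, ev (Q a 0) = 0.
Hypothesis Q_gen3 : forall f, f \is 3.-homog -> ev f = 0 ->
  exists u : 'rV[R]_b1, (forall a, u 0 a \is 1.-homog) /\ f = (u *m Q) 0 0.

Lemma mul_linear_homog (h : {ffun 'I_b1 -> dhomog r.+1 F 1}) :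
  \sum_a val (h a) * Q a 0 \is 3.-homog.
Proof. by rewrite rpred_sum // => a _; apply: (dhomogM (d := 1) (e := 2)) => //; exact: dhomog_is_dhomog. Qed.

Definition mul_linear h : dhomog r.+1 F 3 := DHomog (mul_linear_homog h).

Lemma mul_linear_linear : linear mul_linear.
Proof.
move=> c h g; apply/val_inj; rewrite /= scaler_sumr -big_split /=.
apply: eq_bigr => a _; rewrite scalerAl -mulrDl; congr (_ * _).
by rewrite !ffunE.
Qed.

HB.instance Definition _ :=
  GRing.isLinear.Build F {ffun 'I_b1 -> dhomog r.+1 F 1} (dhomog r.+1 F 3) _
    mul_linear mul_linear_linear.

Local Notation b2 := (b1 * r.+1 - ('C(3 + r, 3) - size (mons 3)))%N.

(** Multiplying the quadrics by linear forms reaches all cubics of the ideal, as these are generated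
    by the quadrics. The linear syzygies are the kernel of this map. *)
Lemma dim_linear_syzygies : \dim (lker (linfun mul_linear)) = b2.
Proof.
have := limg_ker_dim (linfun mul_linear) fullv.
have -> : limg (linfun mul_linear) = degree_kernel 3.
  apply/vspaceP => p; rewrite mem_degree_kernel; apply/memv_imgP/eqP => [[h _ ->]|e].
    rewrite lfunE /= rmorph_sum big1 // => a _.
    by rewrite rmorphM /= Q_ideal mulr0.
  have [u [hu pu]] := Q_gen3 (dhomog_is_dhomog p) e.
  exists [ffun a => DHomog (hu a)]; rewrite ?memvf // lfunE; apply/val_inj.
  by rewrite /= pu mxE; apply: eq_bigr => a _; rewrite ffunE.
rewrite capfv !dimvf dim_degree_kernel => e.
have : dim {ffun 'I_b1 -> dhomog r.+1 F 1} = (b1 * r.+1)%N.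
  by rewrite -[LHS]/(#|'I_b1| * 'C(1 + r, 1))%N card_ord bin1.
by rewrite -e => <-; rewrite addnK.
Qed.

Lemma linear_syzygy_basis : exists M : 'M[R]_(b2, b1),
  [/\ forall i a, M i a \is 1.-homog, M *m Q = 0,
      forall u : 'rV[F]_b2, C u *m M = 0 -> u = 0
    & forall h : 'rV[R]_b1, (forall a, h 0 a \is 1.-homog) -> h *m Q = 0 ->
        exists u : 'rV[F]_b2, h = C u *m M].
Proof.
rewrite -dim_linear_syzygies; set K := lker _; pose B := vbasis K.
pose M : 'M[R]_(\dim K, b1) := \matrix_(i, a) val (B`_i a).
have ME (u : 'rV[F]_(\dim K)) a : (C u *m M) 0 a = val ((\sum_i u 0 i *: B`_i) a).
  rewrite mxE sum_ffunE linear_sum; apply: eq_bigr => i _.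
  by rewrite !mxE !ffunE linearZ /= mul_mpolyC.
have inK (h : {ffun 'I_b1 -> dhomog r.+1 F 1}) :
    (h \in K) = (\sum_a val (h a) * Q a 0 == 0).
  by rewrite memv_ker lfunE.
exists M; split.
- by move=> i a; rewrite mxE dhomog_is_dhomog.
- apply/matrixP => i z; rewrite ord1 mxE [RHS]mxE.
  have /eqP e : \sum_a val (B`_i a) * Q a 0 == 0.
    by rewrite -inK; apply: vbasis_mem; rewrite mem_nth // size_tuple.
  by rewrite -[RHS]e; apply: eq_bigr => a _; rewrite [M _ _]mxE.
- move=> u e; have /freeP fB := basis_free (vbasisP K).
  apply/matrixP => z i; rewrite ord1 mxE; apply: (fB (fun i => u 0 i)).
  by apply/ffunP => a; apply/val_inj; rewrite -ME e !mxE ffunE.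
- move=> h hh hQ; pose g : {ffun 'I_b1 -> dhomog r.+1 F 1} := [ffun a => DHomog (hh a)].
  have gK : g \in K.
    rewrite inK; apply/eqP; have /matrixP/(_ 0 0) := hQ; rewrite mxE [RHS]mxE => e.
    by rewrite -[RHS]e; apply: eq_bigr => a _; rewrite ffunE.
  exists (\row_i coord B i g); apply/matrixP => z a; rewrite ord1 ME.
  have -> : \sum_i (\row_i coord B i g) 0 i *: B`_i = g.
    by rewrite [RHS](coord_vbasis gK); apply: eq_bigr => i _; rewrite mxE.
  by rewrite ffunE.
Qed.

End LinearSyzygyBasis.

End GradedDimensions.

Section LinearPresentationExists.
Variables (F : fieldType) (n r d : nat) (mf : measure n).
Local Notation S := {mpoly F[n]}.
Local Notation R := {mpoly F[r.+1]}.
Hypothesis char0 : forall k, k.+1%:R != 0 :> F.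
Variable ev : {rmorphism R -> S}.
Hypothesis d_pos : (0 < d)%N.
Hypothesis evC : forall c, ev c%:MP = c%:MP.
Hypothesis evX : forall i, ev 'X_i \is d.-homog for mf.
Hypothesis ev_surj : forall k f, f \is (k * d).-homog for mf -> exists g, ev g = f.
Variable mons : nat -> seq 'X_{1..n}.
Hypothesis mons_uniq : forall k, uniq (mons k).
Hypothesis mem_mons : forall k m, (m \in mons k) = (mf m == k * d)%N.
Hypothesis size_mons1 : size (mons 1) = r.+1.
Let X : 'cV[R]_r.+1 := vars F r.+1.
Let f0 : 'cV[S]_r.+1 := map_mx ev X.
Hypothesis lift1 : forall q (c : 'rV[S]_r.+1),
  (forall k, c 0 k \is (q.+2 * d).-homog for mf) -> c *m f0 = 0 ->
  exists D : 'rV[R]_r.+1, D *m X = 0 /\ map_mx ev D = c.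
Hypothesis lift2 : forall q (c : 'M[S]_r.+1), c^T = - c ->
  (forall i k, c i k \is (q.+2 * d).-homog for mf) -> c *m f0 = 0 ->
  exists D : 'M[R]_r.+1, [/\ D^T = - D, D *m X = 0 & map_mx ev D = c].

Let b1 := ('C(2 + r, 2) - size (mons 2))%N.
Let b2 := (b1 * r.+1 - ('C(3 + r, 3) - size (mons 3)))%N.

Lemma ev_surj_homog k f : f \is (k * d).-homog for mf ->
  exists2 p, p \is k.-homog & ev p = f.
Proof.
move=> hf; have [g gf] := ev_surj hf; exists (pihomog mdeg k g); first exact: pihomogP.
by rewrite (ev_pihomog d_pos evC evX) gf pihomog_dE.
Qed.

(** There are as many coordinates as monomials of degree d, so the kernel in degree 1 has a basis
    with no elements. *)
Lemma ev1_inj f : f \is 1.-homog -> ev f = 0 -> f = 0.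
Proof.
move=> hf ef.
have [Q [_ _ /(_ f hf ef) [u ->] _]] :=
  degree_kernel_basis evC (ev_homog d_pos evC evX) ev_surj_homog mons_uniq mem_mons 1.
rewrite mxE big1 // => a; case: a => a lt; exfalso.
by move: lt; rewrite bin1 size_mons1 subnn.
Qed.

Lemma linear_presentation_exists (I : {pred R}) : (forall f, f \in I <-> ev f = 0) ->
  N2_presentation I /\ exists C, minimal_resolution I C /\ resolution_starts b1 b2 C.
Proof.
move=> hI; have evh := ev_homog d_pos evC evX.
have [Q [Qh Q0 Qs Qf]] := degree_kernel_basis evC evh ev_surj_homog mons_uniq mem_mons 2.
have gen k f := @ideal_homog_gen _ _ _ _ char0 mf ev d_pos evC evX lift1 _ Q Qs k f.
have gen3 f := @gen 1%N f.
have [M [Mh MQ Mf Ms]] :=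
  linear_syzygy_basis evC evh ev_surj_homog mons_uniq mem_mons Qh Q0 gen3.
have step := syzygy_linear_step char0 d_pos evC evX lift1 lift2 Qh Q0 Qs.
have evC0 c : ev c%:MP = 0 -> c = 0 by rewrite evC => /eqP; rewrite mpolyC_eq0 => /eqP.
have evcomp k f : ev f = 0 -> ev (pihomog mdeg k f) = 0.
  by move=> ef; rewrite (ev_pihomog d_pos evC evX) ef raddf0.
have gen' k f : f \is k.+2.-homog -> ev f = 0 -> exists u : 'rV[R]_b1, f = (u *m Q) 0 0.
  by move=> hf ef; have [u [_ ->]] := gen k f hf ef; exists u.
split; first exact: (linear_N2_presentation evC0 ev1_inj evcomp Qh Q0 Qf gen' Mh MQ Mf Ms).
exact: (linear_resolution evC0 ev1_inj evcomp Qh Q0 Qf gen' Mh MQ Mf Ms).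
Qed.

End LinearPresentationExists.

(** * From monomial coordinates to an arbitrary basis of sections *)

Section ChangeOfBasis.
Variables (F : fieldType) (n N d : nat) (mf : measure n).
Local Notation S := {mpoly F[n]}.
Local Notation R := {mpoly F[N]}.
Variable ev : {rmorphism R -> S}.
Hypothesis evC : forall c, ev c%:MP = c%:MP.
Variables (T : 'M[F]_N).
Hypothesis T_unit : T \in unitmx.
Let X : 'cV[R]_N := vars F N.
Let f0 : 'cV[S]_N := map_mx ev X.
Let L : 'cV[R]_N := map_mx (@mpolyC N F) T *m X.
Let g0 : 'cV[S]_N := map_mx (@mpolyC n F) T *m f0.
Local Notation CR := (map_mx (@mpolyC N F)).
Local Notation CS := (map_mx (@mpolyC n F)).

Let evCR p q (A : 'M[F]_(p, q)) : map_mx ev (CR A) = CS A.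
Proof. by apply/matrixP => i j; rewrite !mxE evC. Qed.

Lemma ev_linear_forms : map_mx ev L = g0.
Proof. by rewrite map_mxM evCR. Qed.

Lemma homog_mulC p q s k (c : 'M[S]_(p, q)) (A : 'M[F]_(q, s)) :
  (forall i j, c i j \is k.-homog for mf) -> forall i j, (c *m CS A) i j \is k.-homog for mf.
Proof.
move=> hc i j; rewrite mxE rpred_sum // => z _.
by rewrite mxE mulrC mul_mpolyC rpredZ.
Qed.

Lemma homog_mulCl p q s k (c : 'M[S]_(p, q)) (A : 'M[F]_(s, p)) :
  (forall i j, c i j \is k.-homog for mf) -> forall i j, (CS A *m c) i j \is k.-homog for mf.
Proof.
move=> hc i j; rewrite mxE rpred_sum // => z _.
by rewrite mxE mul_mpolyC rpredZ.
Qed.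

Lemma change_lift1 q :
  (forall c : 'rV[S]_N, (forall k, c 0 k \is (q.+2 * d).-homog for mf) -> c *m g0 = 0 ->
    exists D : 'rV[R]_N, D *m L = 0 /\ map_mx ev D = c) ->
  forall c : 'rV[S]_N, (forall k, c 0 k \is (q.+2 * d).-homog for mf) -> c *m f0 = 0 ->
    exists D : 'rV[R]_N, D *m X = 0 /\ map_mx ev D = c.
Proof.
move=> lift c hc cf; have [||D [DL evD]] := lift (c *m CS (invmx T)).
- by move=> k; apply: homog_mulC => i j; rewrite ord1.
- by rewrite -mulmxA [X in _ *m X]mulmxA -map_mxM mulVmx // map_mx1 mul1mx.
exists (D *m CR T); split; first by rewrite -mulmxA.
by rewrite map_mxM evD evCR -mulmxA -map_mxM mulVmx // map_mx1 mulmx1.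
Qed.

(** A 2-chain transforms as a bivector, hence by congruence with the inverse coordinate matrix,
    which preserves antisymmetry. *)
Lemma change_lift2 q :
  (forall c : 'M[S]_N, c^T = - c -> (forall i k, c i k \is (q.+2 * d).-homog for mf) ->
    c *m g0 = 0 ->
    exists D : 'M[R]_N, [/\ D^T = - D, D *m L = 0 & map_mx ev D = c]) ->
  forall c : 'M[S]_N, c^T = - c -> (forall i k, c i k \is (q.+2 * d).-homog for mf) ->
    c *m f0 = 0 ->
    exists D : 'M[R]_N, [/\ D^T = - D, D *m X = 0 & map_mx ev D = c].
Proof.
move=> lift c antic hc cf.
have [|||D [antiD DL evD]] := lift (CS (invmx T)^T *m c *m CS (invmx T)).
- by rewrite !trmx_mul antic -!map_trmx trmxK mulNmx mulmxN mulmxA.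
- exact/homog_mulC/homog_mulCl.
- by rewrite -!mulmxA [X in _ *m (_ *m X)]mulmxA -map_mxM mulVmx // map_mx1 mul1mx cf mulmx0.
exists (CR T^T *m D *m CR T); split.
- by rewrite !trmx_mul antiD -!map_trmx trmxK mulNmx mulmxN mulmxA.
- by rewrite -mulmxA -[CR T *m X]/L -mulmxA DL mulmx0.
- rewrite !map_mxM evD !evCR !mulmxA -map_mxM -trmx_mul mulVmx // trmx1 map_mx1 mul1mx.
  by rewrite -mulmxA -map_mxM mulVmx // map_mx1 mulmx1.
Qed.

End ChangeOfBasis.

(** * The anticanonical model *)

Lemma mpolyX_neq0 (F : fieldType) n (m : 'X_{1..n}) : 'X_[m] != 0 :> {mpoly F[n]}.
Proof. by rewrite -msupp_eq0 msuppX. Qed.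

Section SectionRing.
Variables (F : fieldType) (n N d : nat) (w : 'I_n -> nat).
Local Notation S := {mpoly F[n]}.
Local Notation R := {mpoly F[N]}.
Variables (i0 i1 : 'I_n).
Hypothesis i01 : i0 != i1.
Hypothesis d_pos : (0 < d)%N.
Variables (s : 'I_N -> {fraction S}) (f : 'I_N -> S).
Hypothesis f_homog : forall i, f i \is d.-homog for (wdeg w).
Hypothesis sE : forall i, s i = tofrac (f i).

Definition section_eval : R -> S := mmap (@mpolyC n F) f.
HB.instance Definition _ := GRing.RMorphism.on section_eval.
Local Notation ev := section_eval.

Lemma section_evalC c : ev c%:MP = c%:MP.
Proof. exact: mmapC. Qed.

Lemma section_evalXU i : ev 'X_i = f i.
Proof. by rewrite /section_eval mmapX mmap1U. Qed.

Lemma section_evalX i : ev 'X_i \is d.-homog for (wdeg w).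
Proof. by rewrite section_evalXU. Qed.

Lemma eval_atE p : eval_at s p = tofrac (ev p).
Proof.
rewrite /eval_at /section_eval /mmap raddf_sum /=; apply: eq_bigr => m _.
rewrite rmorphM; congr (_ * _); rewrite /mmap1 rmorph_prod /=; apply: eq_bigr => i _.
by rewrite rmorphXn sE.
Qed.

Lemma coord_idealE p : (p \in coord_ideal s) = (ev p == 0).
Proof. by rewrite inE eval_atE tofrac_eq0. Qed.

Hypothesis ev_surj : forall k g, g \is (k * d).-homog for (wdeg w) -> exists p, ev p = g.

Lemma section_eval_dvd p m : m \in msupp (ev p) -> (d %| wdeg w m)%N.
Proof.
rewrite mcoeff_msupp (pihomog_partitionE (leqnn (msize p))) rmorph_sum raddf_sum /=.
apply: contraNT => nd; rewrite big1 // => k _.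
apply: (dhomog_nemf_coeff (d := k * d)).
  by apply: (ev_homog d_pos section_evalC section_evalX); exact: pihomogP.
by apply: contraNneq nd => /= ->; rewrite dvdn_mull.
Qed.

Lemma section_eval_onto g : {in msupp g, forall m, d %| wdeg w m}%N -> exists p, ev p = g.
Proof.
move=> hg; rewrite (mpolyE g) big_seq.
apply: (big_ind (fun g => exists p, ev p = g)) => [|_ _ [p1 <-] [p2 <-]|m /hg /dvdnP[k hk]].
- by exists 0; rewrite rmorph0.
- by exists (p1 + p2); rewrite rmorphD.
by apply: (ev_surj (k := k)); rewrite rpredZ // dhomogX /= hk.
Qed.

(** Split [u] into the terms of degree divisible by [d], which lie in the image, and the rest. The
    rest times [ev q] has no degree divisible by [d] but lies in the image, so it is zero. *)
Lemma section_eval_divides (u : S) p q : ev q != 0 -> u * ev q = ev p -> exists h, ev h = u.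
Proof.
move=> q0 e; pose P m := (d %| wdeg w m)%N.
pose u1 : S := \sum_(m <- msupp u | P m) u@_m *: 'X_[m].
pose u2 : S := \sum_(m <- msupp u | ~~ P m) u@_m *: 'X_[m].
have eu : u = u1 + u2 by rewrite {1}(mpolyE u) (bigID P).
have supp (Z : pred 'X_{1..n}) m : m \in msupp (\sum_(m <- msupp u | Z m) u@_m *: 'X_[m]) -> Z m.
  rewrite mcoeff_msupp raddf_sum /=; apply: contraNT => nZ; rewrite big1 // => m' Zm.
  rewrite mcoeffZ mcoeffX; case: eqP => [em|]; last by rewrite mulr0.
  by move: Zm; rewrite em (negbTE nZ).
have [h1 hu1] : exists h, ev h = u1 by apply: section_eval_onto => m /supp.
suff u20 : u2 = 0 by exists h1; rewrite hu1 eu u20 addr0.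
apply/eqP; have : u2 * ev q == 0; last by rewrite mulf_eq0 (negbTE q0) orbF.
have e2 : u2 * ev q = ev (p - h1 * q).
  by rewrite rmorphB rmorphM /= hu1 -e eu mulrDl addrC addKr.
rewrite -msupp_eq0; case E : (msupp _) => [//|m s'].
have hm : m \in msupp (u2 * ev q) by rewrite E mem_head.
have := msuppM_le hm => /allpairsP [[m1 m2] /= [h1' h2 em]].
have := supp _ _ h1'; rewrite /P.
move: hm; rewrite e2 => /section_eval_dvd; rewrite em wdegD dvdn_addl ?section_eval_dvd //.
  by move=> ->.
exact: section_eval_dvd h2.
Qed.

(** An integral fraction is a polynomial because S is normal, and a polynomial in the fraction field
    of the section ring lies in that ring. *)
Lemma section_ring_projectively_normal : projectively_normal w d s.
Proof.
split=> [g h|k z].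
  rewrite !eval_atE tofrac_eq0 => h0 [P mP rP].
  have [|u hu] := integral_fraction_poly h0 (f := g).
    have eP : map_poly (eval_at s) P = map_poly (@tofrac S \o ev) P.
      by apply: eq_map_poly => p; exact: eval_atE.
    by exists P; [exact: mP | rewrite -eP; exact: rP].
  have := section_eval_divides (u := u) (p := g) h0; case.
    apply: tofrac_inj; rewrite rmorphM /= -hu mulfVK // tofrac_eq0 //.
  by move=> v hv; exists v; rewrite hu eval_atE hv.
case/(global_sectionP _ _ _ i01) => u hu ->.
have [p hp] := ev_surj hu; exists (pihomog mdeg k p); first exact: pihomogP.
rewrite eval_atE; congr tofrac.
by have := ev_pihomog d_pos section_evalC section_evalX k p; rewrite /= hp (pihomog_dE hu).
Qed.

Variables (c0 c1 : nat) (l0 l1 : R).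
Hypothesis ev_l0 : ev l0 = 'X_[(U_(i0) *+ c0)%MM].
Hypothesis ev_l1 : ev l1 = 'X_[(U_(i1) *+ c1)%MM].
Hypothesis l0_homog : l0 \is 1.-homog.
Hypothesis c1_pos : (0 < c1)%N.

Let phi : {rmorphism R -> S} := (@vertex_eval F n i0 \o ev)%FUN.

Lemma vertex_section_neq0 : exists i, phi 'X_i != 0.
Proof.
apply: boolp.contrapT => no; have z i : phi 'X_i = 0.
  by apply/eqP; apply: boolp.contrapT => /negP h; apply: no; exists i.
have : phi l0 != 0.
  by rewrite /= ev_l0 vertex_evalX mulmnE mnm1E eqxx mul1n eqxx mpolyX_neq0.
suff -> : phi l0 = 0 by rewrite eqxx.
rewrite (mpolyE l0) big_seq rmorph_sum big1 // => m /(dhomog_mf l0_homog) /= m1.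
have /mdeg1P [i /eqP ->] : mdeg m == 1%N by rewrite m1.
by have /= zi := z i; rewrite -mul_mpolyC !rmorphM /= zi mulr0.
Qed.

Lemma coord_ideal_kernel : coord_ideal s = (fun p => ev p == 0).
Proof. by apply: boolp.funext => p; rewrite -coord_idealE. Qed.

Lemma section_ring_point : proj_point (fun=> 1%N) (coord_ideal s).
Proof.
have [i hi] := vertex_section_neq0; rewrite coord_ideal_kernel.
have h : ev 'X_i != 0 by apply: contraNneq hi => /= ->; rewrite rmorph0.
apply: (kernel_proj_point (mf' := wdeg w) (phi := section_eval) d_pos section_evalC _ h).
by move=> j; rewrite muln1; exact: section_evalX.
Qed.

Lemma vertex_section_point : proj_point (fun=> 1%N) (fun p => phi p == 0).
Proof.
have [i hi] := vertex_section_neq0.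
apply: (kernel_proj_point (mf' := wdeg w) (phi := phi) d_pos _ _ hi).
  by move=> c; rewrite /= section_evalC vertex_evalC.
move=> j; rewrite muln1 /=; rewrite -[d]mul1n.
apply: (graded_hom_dhomog (mf := wdeg w)) => //; last exact: section_evalX.
- exact: vertex_evalC.
- move=> k; rewrite /= vertex_evalXU mul1n; case: eqP => _; last exact: rpred0.
  by rewrite dhomogX /= wdegU.
Qed.

Lemma component_coord_ideal p : component (fun=> 1%N) (coord_ideal s) p -> p =i coord_ideal s.
Proof.
case=> _ Ip /(_ _ section_ring_point (fun _ h => h) Ip) pI f0.
by apply/idP/idP; [exact: pI | exact: Ip].
Qed.

(** The ideal is a homogeneous prime, hence its own only component. The ideal of the image of a
    vertex lies strictly above it: it contains [l1], which maps to a power of another variable. *)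
Lemma section_ring_pure_dim : pure_dim_ge1 (fun=> 1%N) (coord_ideal s).
Proof.
split=> [p hp|p q l hp hq [c [cp cP cS]]]; last first.
  exists c; split=> // x; rewrite cp (component_coord_ideal hp).
  by rewrite (component_coord_ideal hq).
have pE := component_coord_ideal hp; have [pp _ _] := hp.
exists (fun k => if k is 0 then p else (fun x => phi x == 0)); split=> //.
- by case=> [|k] _ //; exact: vertex_section_point.
case=> // _; split=> [x|/(_ l1)].
  by rewrite pE coord_idealE unfold_in /= => /eqP ->; rewrite rmorph0.
rewrite pE coord_idealE ev_l1 unfold_in /= ev_l1 vertex_evalX.
rewrite mulmnE mnm1E [i1 == i0]eq_sym (negbTE i01) mul0n mulm0n.
have -> : ((U_(i1) *+ c1)%MM == 0%MM :> 'X_{1..n}) = false.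
  apply/negP => /eqP /mnmP/(_ i1); rewrite mulmnE mnm1E eqxx mnm0E mul1n.
  by move=> e; move: c1_pos; rewrite e.
by rewrite eqxx => /(_ isT); rewrite (negbTE (mpolyX_neq0 _ _)).
Qed.

End SectionRing.

Section AnticanonicalModel.
Variables (F : fieldType) (w b : 'I_4 -> nat) (d N : nat) (mons : nat -> seq 'X_{1..4}).
Variables (sigma : 'X_{1..4}) (root : 'X_{1..4} -> 'X_{1..4}).
Hypothesis char0 : forall k, k.+1%:R != 0 :> F.
Hypothesis wd : weight_data w b d N mons sigma root.
Local Notation S := {mpoly F[4]}.
Local Notation R := {mpoly F[N.+4]}.
Let i0 : 'I_4 := ord0.
Let i1 : 'I_4 := ord_max.

Lemma ord0_neq_max : i0 != i1. Proof. by []. Qed.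

Lemma size_anticanonical : size (mons 1) = N.+4.
Proof. by have := wd_size wd 1; lia. Qed.

Lemma weights_pos i : (0 < w i)%N.
Proof. by have := wd_pos wd; rewrite -(wd_wb wd i) muln_gt0 => /andP[]. Qed.

Lemma exponents_pos i : (0 < b i)%N.
Proof. by have := wd_pos wd; rewrite -(wd_wb wd i) muln_gt0 => /andP[]. Qed.

Lemma wdeg_pos_eq0 m : wdeg w m = 0%N -> m = 0%MM.
Proof.
move/eqP; rewrite sum_nat_eq0 => /forallP h; apply/mnmP => i; rewrite mnm0E.
by have /implyP/(_ isT) := h i; rewrite muln_eq0 gtn_eqF ?weights_pos //= => /eqP.
Qed.

Let m (k : 'I_N.+4) : 'X_{1..4} := nth 0%MM (mons 1) k.

Lemma anticanonical_mem k : m k \in mons 1.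
Proof. by rewrite mem_nth // size_anticanonical. Qed.

Lemma wdeg_anticanonical k : wdeg w (m k) = d.
Proof. by have := anticanonical_mem k; rewrite (wd_mem wd) mul1n => /eqP. Qed.

Lemma anticanonical_inj : injective m.
Proof.
move=> k l /eqP; rewrite nth_uniq ?size_anticanonical ?(wd_uniq wd) // => /eqP.
exact: val_inj.
Qed.

Lemma anticanonical_onto u : u \in mons 1 -> exists k, m k = u.
Proof.
move=> hu; have lt : (index u (mons 1) < N.+4)%N by rewrite -size_anticanonical index_mem.
by exists (Ordinal lt); rewrite /m /= nth_index.
Qed.

Lemma vpow_anticanonical i : exists k, m k = vpow b i.
Proof.
by apply: anticanonical_onto; rewrite (wd_mem wd) mul1n (wdeg_vpow (wd_wb wd)).
Qed.

Lemma mons_div q mu : wdeg w mu = (q.+1 * d)%N -> exists k, (m k <= mu)%MM.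
Proof. by case/(wd_div wd) => u /anticanonical_onto [k <-] le; exists k. Qed.

Variable s : 'I_N.+4 -> {fraction S}.
Hypothesis s_basis : section_basis w d%:Z s.

Lemma sections_lift : exists f : 'I_N.+4 -> S, forall i,
  f i \is d.-homog for (wdeg w) /\ s i = tofrac (f i).
Proof.
apply: (@fin_all_exists _ (fun=> S)
  (fun i g => g \is d.-homog for (wdeg w) /\ s i = tofrac g)) => i.
by have [/(_ i)/(global_sectionP _ _ _ ord0_neq_max)[g hg ->] _] := s_basis; exists g.
Qed.

Variable f : 'I_N.+4 -> S.
Hypothesis f_homog : forall i, f i \is d.-homog for (wdeg w).
Hypothesis sE : forall i, s i = tofrac (f i).
Local Notation ev := (section_eval f).

(** The monomials of degree d are sections, so they expand in the given basis. The matrix is square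
    with independent rows because distinct monomials are independent. *)
Lemma coordinate_matrix : exists2 T : 'M[F]_N.+4, T \in unitmx
  & forall k, ev ((map_mx (@mpolyC N.+4 F) T *m vars F N.+4) k 0) = 'X_[m k].
Proof.
have [_ span] := s_basis.
have [c hc] : exists c : 'I_N.+4 -> 'rV[F]_N.+4, forall k,
    tofrac ('X_[m k] : S) = \sum_i const_frac 4 (c k 0 i) * s i.
  apply: (@fin_all_exists _ (fun=> 'rV[F]_N.+4)
    (fun k c => tofrac ('X_[m k] : S) = \sum_i const_frac 4 (c 0 i) * s i)) => k.
  have [|c [hc _]] := span (tofrac 'X_[m k]); last by exists c.
  by apply/(global_sectionP _ _ _ ord0_neq_max); exists 'X_[m k]; rewrite ?dhomogX /= ?wdeg_anticanonical.
have Xm k : 'X_[m k] = \sum_i c k 0 i *: f i.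
  apply: (@tofrac_inj F 4); rewrite hc raddf_sum; apply: eq_bigr => i _ /=.
  by rewrite sE -mul_mpolyC rmorphM.
pose T := \matrix_(k, i) c k 0 i; exists T; last first.
  move=> k; rewrite Xm mxE rmorph_sum; apply: eq_bigr => i _.
  by rewrite rmorphM /= !mxE section_evalC section_evalXU mul_mpolyC.
rewrite -row_free_unit; apply: inj_row_free => v vT.
have e : \sum_k v 0 k *: 'X_[m k] = 0 :> S.
  under eq_bigr => k _ do rewrite Xm scaler_sumr.
  rewrite exchange_big big1 // => i _ /=.
  under eq_bigr => k _ do rewrite scalerA.
  rewrite -scaler_suml; have := congr1 (fun A : 'rV_N.+4 => A 0 i) vT.
  rewrite /T !mxE; under eq_bigr => k _ do rewrite mxE.
  by move=> ->; rewrite scale0r.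
apply/matrixP => z k; rewrite ord1 mxE; have := congr1 (mcoeff (m k)) e.
rewrite raddf_sum mcoeff0 (bigD1 k) //= mcoeffZ mcoeffX eqxx mulr1 big1 ?addr0 // => l ne.
by rewrite mcoeffZ mcoeffX (inj_eq anticanonical_inj) (negbTE ne) mulr0.
Qed.

Lemma anticanonical_model :
  [/\ projectively_normal w d s,
      exists C : free_complex F N.+4, minimal_resolution (coord_ideal s) C /\
        resolution_starts ('C(N.+4.+1, 2) - size (mons 2))
          (('C(N.+4.+1, 2) - size (mons 2)) * N.+4 - ('C(N.+4.+2, 3) - size (mons 3))) C
    & property_N2 w d s].
Proof.
have d_pos := wd_pos wd.
have [T T_unit evl] := coordinate_matrix.
pose L := map_mx (@mpolyC N.+4 F) T *m vars F N.+4; pose l k := L k 0.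
have [y my] : exists y : 'I_4 -> 'I_N.+4, forall i, m (y i) = vpow b i.
  exact: (@fin_all_exists _ (fun=> 'I_N.+4) (fun i k => m k = vpow b i)) vpow_anticanonical.
have evC := @section_evalC F 4 N.+4 f; have evX := section_evalX f_homog.
have two : 2%:R != 0 :> F := char0 1.
have ev_surj k g := @ev_onto _ _ _ _ _ _ _ evC m l evl wdeg_anticanonical mons_div wdeg_pos_eq0 k g.
have g0E : map_mx (@mpolyC 4 F) T *m map_mx ev (vars F N.+4) = \col_k 'X_[m k].
  rewrite -(ev_linear_forms evC T); apply/matrixP => k j; rewrite ord1 mxE [RHS]mxE.
  exact: evl.
have LE : L = \col_k l k by apply/matrixP => k j; rewrite ord1 [RHS]mxE.
(* The lifting statements are known in coordinates that evaluate to monomials; these two facts bring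
   them to the given ones. *)
have lift1 q := change_lift1 evC T_unit (q := q) (d := d) (mf := wdeg w).
have lift2 q := change_lift2 evC T_unit (q := q) (d := d) (mf := wdeg w).
rewrite g0E -/L LE in lift1 lift2.
have K1 q := @koszul1_lift _ _ _ _ _ two _ _ _ evC _ _ evl wdeg_anticanonical _ my mons_div wdeg_pos_eq0
  _ _ anticanonical_inj (wd_root_deg wd) (wd_root_neq wd) (wd_root_le wd) (wd_sigma wd) (wd_good wd) q.
have K2 q := @koszul2_lift _ _ _ _ _ two _ _ _ evC _ _ evl wdeg_anticanonical _ my mons_div wdeg_pos_eq0
  _ _ anticanonical_inj (wd_root_deg wd) (wd_root_neq wd) (wd_root_le wd) (wd_sigma wd) (wd_good wd) q.
have idealE p : p \in coord_ideal s <-> ev p = 0.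
  by rewrite (coord_idealE sE); split=> /eqP.
have [pN2 res] := linear_presentation_exists char0 d_pos evC evX ev_surj (wd_uniq wd) (wd_mem wd)
  size_anticanonical (fun q => lift1 q (K1 q)) (fun q => lift2 q (K2 q)) idealE.
have nd : Defs.nondegenerate s.
  move=> p hp /idealE; exact: (ev1_inj d_pos evC evX ev_surj (wd_uniq wd) (wd_mem wd) size_anticanonical hp).
have pn : projectively_normal w d s.
  exact: (section_ring_projectively_normal ord0_neq_max d_pos f_homog sE ev_surj).
split=> //; split=> //.
have l_homog k : l k \is 1.-homog.
  rewrite /l /L mxE rpred_sum // => i _; rewrite !mxE mul_mpolyC rpredZ //.
  by rewrite dhomogX /= mdeg1.
have evy i : ev (l (y i)) = 'X_[(U_(i) *+ b i)%MM] by rewrite evl my.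
exact: (section_ring_pure_dim ord0_neq_max d_pos f_homog sE (evy i0) (evy i1) (l_homog _)
  (exponents_pos i1)).
Qed.

End AnticanonicalModel.

(** * The anticanonical degree *)

Section AnticanonicalGenus.
Variables (F : fieldType) (w b : 'I_4 -> nat) (d N : nat) (mons : nat -> seq 'X_{1..4}).
Variables (sigma : 'X_{1..4}) (root : 'X_{1..4} -> 'X_{1..4}).
Hypothesis wd : weight_data w b d N mons sigma root.
Local Notation S := {mpoly F[4]}.

Lemma monomial_sections k : h0 F w (k * d)%N%:Z (size (mons k)).
Proof.
pose m j := nth 0%MM (mons k) j.
exists (fun j => tofrac ('X_[m j] : S)).
have m_mem (j : 'I_(size (mons k))) : m j \in mons k by rewrite mem_nth.
have m_deg (j : 'I_(size (mons k))) : wdeg w (m j) = (k * d)%N.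
  by have := m_mem j; rewrite (wd_mem wd) => /eqP.
have coefE (c : 'rV[F]_(size (mons k))) (j : 'I_(size (mons k))) :
    (\sum_i c 0 i *: ('X_[m i] : S))@_(m j) = c 0 j.
  rewrite raddf_sum (bigD1 j) //= mcoeffZ mcoeffX eqxx mulr1 big1 ?addr0 // => i ne.
  by rewrite mcoeffZ mcoeffX nth_uniq ?(wd_uniq wd) // (inj_eq val_inj) (negbTE ne) mulr0.
have sumE (c : 'rV[F]_(size (mons k))) :
    \sum_i const_frac 4 (c 0 i) * tofrac ('X_[m i] : S) = tofrac (\sum_i c 0 i *: 'X_[m i]).
  rewrite raddf_sum; apply: eq_bigr => i _ /=.
  by rewrite -mul_mpolyC rmorphM.
have i01 : (ord0 : 'I_4) != ord_max by [].
split=> [j|z /(global_sectionP _ _ _ i01) [u hu ->]].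
  by apply/(global_sectionP _ _ _ i01); exists 'X_[m j]; rewrite // dhomogX /= m_deg.
exists (\row_j u@_(m j)); split=> [|c]; rewrite sumE; last first.
  by move=> /tofrac_inj ->; apply/matrixP => i j; rewrite ord1 mxE coefE.
congr tofrac; apply/mpolyP => mu; have [hm|hm] := boolP (mu \in mons k).
  have lt : (index mu (mons k) < size (mons k))%N by rewrite index_mem.
  by have := coefE (\row_j u@_(m j)) (Ordinal lt); rewrite mxE /m /= nth_index // => ->.
have deg0 (g : S) : g \is (k * d).-homog for (wdeg w) -> g@_mu = 0.
  by move=> hg; apply: (dhomog_nemf_coeff hg); rewrite /= -(wd_mem wd).
rewrite !deg0 // rpred_sum // => i _; by rewrite rpredZ // dhomogX /= m_deg.
Qed.

Lemma anticanonical_genus : twist_top_power F w d (2 * N.+2%:R - 2).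
Proof.
(* Expanding [wd_size] divided by 6 gives 2e k^3 + 3e k^2 + (e + 2) k + 1, so the degree is 3! 2e =
   2 (N + 1), that is 2g - 2 with g = N + 2. *)
pose e : rat := N.+1%:R / 6%:R.
pose c : seq rat := [:: 1; e + 2%:R; 3%:R * e; 2%:R * e].
exists (\poly_(i < 4) c`_i); split; first exact: size_poly.
  rewrite coef_poly /= -[RHS]mulr_natr /e -[N.+2]addn1 natrD.
  by rewrite -[(3`!)%:R]/(6%:R : rat); field.
exists 0%N => k _; exists (size (mons k)); first exact: monomial_sections.
rewrite horner_poly !big_ord_recr big_ord0 /=.
apply: (@mulfI _ 6%:R) => //; rewrite -[RHS]natrM (wd_size wd).
by rewrite -muln2 -[k.+1]addn1 -[(k * 2).+1]addn1 !(natrD, natrM) /e; field.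
Qed.

End AnticanonicalGenus.

(** Here 5N + 10 and 14N + 21 are the values of the Hilbert function in degrees 2 and 3. *)
Definition gorenstein_invariants (N : nat) : nat * nat :=
  let b1 := ('C(N.+4.+1, 2) - (5 * N + 10))%N in
  (b1, b1 * N.+4 - ('C(N.+4.+2, 3) - (14 * N + 21)))%N.

Lemma gorenstein_rows_table :
  all (fun r : quad * quad * nat * nat => let: (w, b, d, N) := r in
    (quad_seq w, N.+2, (gorenstein_invariants N).1, (gorenstein_invariants N).2)
      \in gorenstein_table) gorenstein_rows.
Proof. by vm_compute. Qed.

Theorem proposition6p1 (R : realType) (a : 4.-tuple nat) :
  well_formed a -> gorenstein R[i] a ->
  exists (w : seq nat) (g b1 b2 : nat),
    [/\ (w, g, b1, b2) \in gorenstein_table, perm_eq a w, has_genus R[i] a g,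
        h0 R[i] (tnth a) (anticanonical_twist a)%:Z g.+2
      & forall s : 'I_g.+2 -> {fraction {mpoly R[i][4]}},
          section_basis (tnth a) (anticanonical_twist a)%:Z s ->
          [/\ projectively_normal (tnth a) (anticanonical_twist a) s,
              exists C : free_complex R[i] g.+2,
                minimal_resolution (coord_ideal s) C /\
                resolution_starts b1 b2 C
            & property_N2 (tnth a) (anticanonical_twist a) s]].
Proof.
move=> wf gor; have [apos agcd] := wf.
have [w [b [d [N [row aw]]]]] := gorenstein_classification wf
  (fun i => twist_invertible_dvd i apos agcd gor).
have check := allP gorenstein_rows_check _ row.
have table := allP gorenstein_rows_table _ row.
have sw : size (quad_seq w) == 4%N by case: (w) => [[[]]].
(* The permutation that brings the table row into the order of the given weights. *)
have /tuple_permP [p ap] : perm_eq a (Tuple sw) by [].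
have wE : (fun i : 'I_4 => qnth w (p i)) = tnth a.
  apply: boolp.funext => i; rewrite (tnth_nth 0%N) ap (nth_mktuple _ _ i) (tnth_nth 0%N) /=.
  by case: (w) (p i) => [[[w0 w1] w2] w3] [[|[|[|[|j]]]] hj].
have wd := row_weight_data p check; rewrite wE in wd.
have dE : anticanonical_twist a = d := esym (wd_sum wd).
have s2 : size (row_monos p w b d 2) = (5 * N + 10)%N by have := wd_size wd 2; lia.
have s3 : size (row_monos p w b d 3) = (14 * N + 21)%N by have := wd_size wd 3; lia.
have char0 k : k.+1%:R != 0 :> R[i] by rewrite pnatr_eq0.
exists (quad_seq w), N.+2, (gorenstein_invariants N).1, (gorenstein_invariants N).2.
rewrite /has_genus dE; split=> //.
- exact: anticanonical_genus wd.
- by have := monomial_sections R[i] wd 1; rewrite mul1n (size_anticanonical wd).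
- move=> s hs; have [f hf] := sections_lift hs.
  have := anticanonical_model char0 wd hs (fun i => (hf i).1) (fun i => (hf i).2).
  by rewrite s2 s3.
Qed.
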